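(* (1) Let $\mathcal{A}$ be an abelian category with enough injectives. (a) $\big(\mathsf{K}^{\infty,\emptyset}(\mathsf{Inj}\,\mathcal{A}),(\mathsf{K}^{+,\mathrm{b}}/\mathsf{K}^{\mathrm{b}})(\mathsf{Inj}\,\mathcal{A})\big)$ and $\big((\mathsf{K}^{+,\mathrm{b}}/\mathsf{K}^{\mathrm{b}})(\mathsf{Inj}\,\mathcal{A}),(\mathsf{K}^{-,\mathrm{b}}/\mathsf{K}^{\mathrm{b}})(\mathsf{Inj}\,\mathcal{A})\big)$ are stable t-structures in $(\mathsf{K}^{\infty,\mathrm{b}}/\mathsf{K}^{\mathrm{b}})(\mathsf{Inj}\,\mathcal{A})$. (b) The canonical embedding $i_*:(\mathsf{K}^{+,\mathrm{b}}/\mathsf{K}^{\mathrm{b}})(\mathsf{Inj}\,\mathcal{A})\to(\mathsf{K}^{\infty,\mathrm{b}}/\mathsf{K}^{\mathrm{b}})(\mathsf{Inj}\,\mathcal{A})$ induces a recollement $(i^*,i_*,i^!;j_!,j^*,j_* )$ of the form $$(\mathsf{K}^{+,\mathrm{b}}/\mathsf{K}^{\mathrm{b}})(\mathsf{Inj}\,\mathcal{A})\xrightarrow{\,i_*\,}(\mathsf{K}^{\infty,\mathrm{b}}/\mathsf{K}^{\mathrm{b}})(\mathsf{Inj}\,\mathcal{A})\xrightarrow{\,j^*\,}(\mathsf{K}^{\infty,\mathrm{b}}/\mathsf{K}^{+,\mathrm{b}})(\mathsf{Inj}\,\mathcal{A})$$ such that $\operatorname{Im}j_!=\mathsf{K}^{\infty,\emptyset}(\mathsf{Inj}\,\mathcal{A})$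 and $\operatorname{Im}j_*=(\mathsf{K}^{-,\mathrm{b}}/\mathsf{K}^{\mathrm{b}})(\mathsf{Inj}\,\mathcal{A})$. (2) Let $\mathcal{A}'$ be an abelian category with enough projectives. (a) $\big((\mathsf{K}^{+,\mathrm{b}}/\mathsf{K}^{\mathrm{b}})(\mathsf{Proj}\,\mathcal{A}'),(\mathsf{K}^{-,\mathrm{b}}/\mathsf{K}^{\mathrm{b}})(\mathsf{Proj}\,\mathcal{A}')\big)$ and $\big((\mathsf{K}^{-,\mathrm{b}}/\mathsf{K}^{\mathrm{b}})(\mathsf{Proj}\,\mathcal{A}'),\mathsf{K}^{\infty,\emptyset}(\mathsf{Proj}\,\mathcal{A}')\big)$ are stable t-structures in $(\mathsf{K}^{\infty,\mathrm{b}}/\mathsf{K}^{\mathrm{b}})(\mathsf{Proj}\,\mathcal{A}')$. (b) The canonical embedding $i_*:(\mathsf{K}^{-,\mathrm{b}}/\mathsf{K}^{\mathrm{b}})(\mathsf{Proj}\,\mathcal{A}')\to(\mathsf{K}^{\infty,\mathrm{b}}/\mathsf{K}^{\mathrm{b}})(\mathsf{Proj}\,\mathcal{A}')$ induces a recollement $(i^*,i_*,i^!;j_!,j^*,j_* )$ of the form $$(\mathsf{K}^{-,\mathrm{b}}/\mathsf{K}^{\mathrm{b}})(\mathsf{Proj}\,\mathcal{A}')\xrightarrow{\,i_*\,}(\mathsf{K}^{\infty,\mathrm{b}}/\mathsf{K}^{\mathrm{b}})(\mathsf{Proj}\,\mathcal{A}')\xrightarrow{\,j^*\,}(\mathsf{K}^{\infty,\mathrm{b}}/\mathsf{K}^{-,\mathrm{b}})(\mathsf{Proj}\,\mathcal{A}')$$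 such that $\operatorname{Im}j_!=(\mathsf{K}^{+,\mathrm{b}}/\mathsf{K}^{\mathrm{b}})(\mathsf{Proj}\,\mathcal{A}')$ and $\operatorname{Im}j_*=\mathsf{K}^{\infty,\emptyset}(\mathsf{Proj}\,\mathcal{A}')$.
   Context: $\mathsf{Inj}\,\mathcal{A}$ (resp. $\mathsf{Proj}\,\mathcal{A}$) is the full subcategory of injective (resp. projective) objects. For an additive full subcategory $\mathcal{B}$ of an abelian category: $\mathsf{K}(\mathcal{B})$ is the homotopy category of complexes over $\mathcal{B}$; $\mathsf{K}^{\mathrm{b}}(\mathcal{B})$ its full subcategory of bounded complexes; $\mathsf{K}^{\infty,\mathrm{b}}(\mathcal{B})$ the full subcategory of complexes with bounded homology; $\mathsf{K}^{+,\mathrm{b}}(\mathcal{B})$ (resp. $\mathsf{K}^{-,\mathrm{b}}(\mathcal{B})$) the full subcategory of bounded below (resp. bounded above) complexes with bounded homology; $\mathsf{K}^{\infty,\emptyset}(\mathcal{B})$ the full subcategory of acyclic complexes. $(\mathsf{K}^{*}/\mathsf{K}^{\#})(\mathcal{B})$ is the Verdier quotient of $\mathsf{K}^{*}(\mathcal{B})$ by $\mathsf{K}^{\#}(\mathcal{B})$. The categories $(\mathsf{K}^{\pm,\mathrm{b}}/\mathsf{K}^{\mathrm{b}})(\mathcal{B})$ and $\mathsf{K}^{\infty,\emptyset}(\mathcal{B})$ are regarded as full subcategories of $(\mathsf{K}^{\infty,\mathrm{b}}/\mathsf{K}^{\mathrm{b}})(\mathcal{B})$ via the canonical functors; $\operatorname{Im}$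 means essential image (equalities are up to isomorphic closure). A pair $(\mathcal{U},\mathcal{V})$ of full subcategories of a triangulated category $\mathcal{D}$ (translation $\Sigma$) is a stable t-structure in $\mathcal{D}$ if (a) $\mathcal{U}=\Sigma\mathcal{U}$, $\mathcal{V}=\Sigma\mathcal{V}$; (b) $\operatorname{Hom}_{\mathcal{D}}(\mathcal{U},\mathcal{V})=0$; (c) every $X\in\mathcal{D}$ fits in a triangle $U\to X\to V\to\Sigma U$ with $U\in\mathcal{U}$, $V\in\mathcal{V}$. A recollement $\mathcal{D}'\xrightarrow{i_*}\mathcal{D}\xrightarrow{j^*}\mathcal{D}''$ consists of triangle functors $i_*:\mathcal{D}'\to\mathcal{D}$, $i^*,i^!:\mathcal{D}\to\mathcal{D}'$, $j^*:\mathcal{D}\to\mathcal{D}''$, $j_!,j_*:\mathcal{D}''\to\mathcal{D}$ such that $i_*,j_!,j_*$ are fully faithful; $(i^*,i_* )$, $(i_*,i^!)$, $(j_!,j^* )$, $(j^*,j_* )$ are adjoint pairs; and the canonical embeddings $\operatorname{Im}j_!\hookrightarrow\operatorname{Ker}i^*$, $\operatorname{Im}i_*\hookrightarrow\operatorname{Ker}j^*$, $\operatorname{Im}j_*\hookrightarrow\operatorname{Ker}i^!$ exist and are equivalences. *)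

(* Defs.v *)
(* Categories are preadditive and setoid-enriched: morphisms are compared with
   the congruence [heq], written [==], rather than with Leibniz equality.  Thus
   a quotient of the morphisms of a category (homotopy category, Verdier
   quotient) is obtained by changing [heq], and objects are never compared with
   Leibniz equality either. *)
From Stdlib Require Import ZArith Lia Setoid Morphisms.

Set Implicit Arguments.
Unset Strict Implicit.
Unset Printing Implicit Defensive.

Declare Scope cat_scope.
Delimit Scope cat_scope with cat.
Open Scope cat_scope.

#[local] Obligation Tactic := idtac.

Record preadditive := Preadditive {
  ob :> Type;
  hom : ob -> ob -> Type;
  heq : forall X Y : ob, hom X Y -> hom X Y -> Prop;
  idm : forall X : ob, hom X X;
  comp : forall X Y Z : ob, hom Y Z -> hom X Y -> hom X Z;
  hzero : forall X Y : ob, hom X Y;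
  hadd : forall X Y : ob, hom X Y -> hom X Y -> hom X Y;
  hopp : forall X Y : ob, hom X Y -> hom X Y;
  heq_equiv : forall X Y, Equivalence (@heq X Y);
  comp_heq : forall X Y Z (g g' : hom Y Z) (f f' : hom X Y),
    heq g g' -> heq f f' -> heq (comp g f) (comp g' f');
  hadd_heq : forall X Y (f f' g g' : hom X Y),
    heq f f' -> heq g g' -> heq (hadd f g) (hadd f' g');
  comp_id_l : forall X Y (f : hom X Y), heq (comp (idm Y) f) f;
  comp_id_r : forall X Y (f : hom X Y), heq (comp f (idm X)) f;
  comp_assoc : forall X Y Z W (h : hom Z W) (g : hom Y Z) (f : hom X Y),
    heq (comp h (comp g f)) (comp (comp h g) f);
  hadd_assoc : forall X Y (f g h : hom X Y),
    heq (hadd f (hadd g h)) (hadd (hadd f g) h);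
  hadd_comm : forall X Y (f g : hom X Y), heq (hadd f g) (hadd g f);
  hadd_0 : forall X Y (f : hom X Y), heq (hadd f (hzero X Y)) f;
  hadd_opp : forall X Y (f : hom X Y), heq (hadd f (hopp f)) (hzero X Y);
  comp_hadd_l : forall X Y Z (g g' : hom Y Z) (f : hom X Y),
    heq (comp (hadd g g') f) (hadd (comp g f) (comp g' f));
  comp_hadd_r : forall X Y Z (g : hom Y Z) (f f' : hom X Y),
    heq (comp g (hadd f f')) (hadd (comp g f) (comp g f'))
}.

Arguments hom {p} X Y.
Arguments heq {p X Y} f g.
Arguments idm {p} X.
Arguments comp {p X Y Z} g f.
Arguments hzero {p X Y}.
Arguments hadd {p X Y} f g.
Arguments hopp {p X Y} f.

Notation "f == g" := (heq f g) (at level 70, no associativity) : cat_scope.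
Notation "g 'o' f" := (comp g f) (at level 40, left associativity) : cat_scope.
Notation "f + g" := (hadd f g) : cat_scope.
Notation "- f" := (hopp f) : cat_scope.
Notation "0" := hzero : cat_scope.

#[export] Existing Instance heq_equiv.
#[export] Instance comp_Proper (C : preadditive) (X Y Z : C) :
  Proper (heq ==> heq ==> heq) (@comp C X Y Z).
Proof. intros g g' Hg f f' Hf; apply comp_heq; assumption. Qed.
#[export] Instance hadd_Proper (C : preadditive) (X Y : C) :
  Proper (heq ==> heq ==> heq) (@hadd C X Y).
Proof. intros g g' Hg f f' Hf; apply hadd_heq; assumption. Qed.

Lemma hadd_0l (C : preadditive) (X Y : C) (f : hom X Y) : 0 + f == f.
Proof. rewrite hadd_comm; apply hadd_0. Qed.

Lemma hadd_inj (C : preadditive) (X Y : C) (f g h : hom X Y) :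
  f + h == g + h -> f == g.
Proof.
  intro H.
  rewrite <- (hadd_0 f), <- (hadd_0 g), <- (hadd_opp h), 2!hadd_assoc, H.
  reflexivity.
Qed.

Lemma hopp_unique (C : preadditive) (X Y : C) (f g : hom X Y) :
  f + g == 0 -> f == - g.
Proof.
  intro H; apply (hadd_inj (h := g)); rewrite H, hadd_comm, hadd_opp; reflexivity.
Qed.

#[export] Instance hopp_Proper (C : preadditive) (X Y : C) :
  Proper (heq ==> heq) (@hopp C X Y).
Proof.
  intros f g H; apply hopp_unique.
  rewrite <- H, hadd_comm; apply hadd_opp.
Qed.

Lemma hopp_opp (C : preadditive) (X Y : C) (f : hom X Y) : - - f == f.
Proof. symmetry; apply hopp_unique, hadd_opp. Qed.

Lemma comp_0r (C : preadditive) (X Y Z : C) (g : hom Y Z) : g o (0 : hom X Y) == 0.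
Proof.
  apply (hadd_inj (h := g o 0)).
  rewrite <- comp_hadd_r, hadd_0, hadd_0l; reflexivity.
Qed.

Lemma comp_0l (C : preadditive) (X Y Z : C) (f : hom X Y) : (0 : hom Y Z) o f == 0.
Proof.
  apply (hadd_inj (h := 0 o f)).
  rewrite <- comp_hadd_l, hadd_0, hadd_0l; reflexivity.
Qed.

Lemma comp_opp_r (C : preadditive) (X Y Z : C) (g : hom Y Z) (f : hom X Y) :
  g o (- f) == - (g o f).
Proof.
  apply hopp_unique.
  rewrite <- comp_hadd_r, (hadd_comm (- f)), hadd_opp; apply comp_0r.
Qed.

Lemma comp_opp_l (C : preadditive) (X Y Z : C) (g : hom Y Z) (f : hom X Y) :
  (- g) o f == - (g o f).
Proof.
  apply hopp_unique.
  rewrite <- comp_hadd_l, (hadd_comm (- g)), hadd_opp; apply comp_0l.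
Qed.

Lemma hopp_0 (C : preadditive) (X Y : C) : - (0 : hom X Y) == 0.
Proof. symmetry; apply hopp_unique, hadd_0. Qed.

Lemma hopp_add (C : preadditive) (X Y : C) (f g : hom X Y) :
  - (f + g) == - f + - g.
Proof.
  symmetry; apply hopp_unique.
  rewrite (hadd_comm f g), hadd_assoc, <- (hadd_assoc (- f)), (hadd_comm (- g)),
    hadd_opp, hadd_0, hadd_comm; apply hadd_opp.
Qed.

Lemma hadd_swap (C : preadditive) (X Y : C) (f g h k : hom X Y) :
  (f + g) + (h + k) == (f + h) + (g + k).
Proof.
  rewrite <- !hadd_assoc, (hadd_assoc g), (hadd_comm g h), <- hadd_assoc.
  reflexivity.
Qed.

Definition is_inverse (C : preadditive) (X Y : C) (f : hom X Y) (g : hom Y X) :=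
  g o f == idm X /\ f o g == idm Y.
Definition is_iso (C : preadditive) (X Y : C) (f : hom X Y) :=
  exists g : hom Y X, is_inverse f g.
Definition isomorphic (C : preadditive) (X Y : C) :=
  exists f : hom X Y, is_iso f.
Definition is_zero (C : preadditive) (Z : C) :=
  forall X : C, (forall f : hom X Z, f == 0) /\ (forall f : hom Z X, f == 0).
Definition mono (C : preadditive) (X Y : C) (f : hom X Y) :=
  forall (W : C) (g h : hom W X), f o g == f o h -> g == h.
Definition epi (C : preadditive) (X Y : C) (f : hom X Y) :=
  forall (W : C) (g h : hom Y W), g o f == h o f -> g == h.

Record functor (C D : preadditive) := Functor {
  fob :> C -> D;
  fmap : forall X Y : C, hom X Y -> hom (fob X) (fob Y);
  fmap_heq : forall X Y (f g : hom X Y), f == g -> fmap f == fmap g;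
  fmap_id : forall X, fmap (idm X) == idm (fob X);
  fmap_comp : forall X Y Z (g : hom Y Z) (f : hom X Y),
    fmap (g o f) == fmap g o fmap f;
  fmap_add : forall X Y (f g : hom X Y), fmap (f + g) == fmap f + fmap g
}.
Arguments fmap {C D} f {X Y} _ : rename.

#[export] Instance fmap_Proper (C D : preadditive) (F : functor C D) (X Y : C) :
  Proper (heq ==> heq) (@fmap C D F X Y).
Proof. intros f g H; apply fmap_heq; assumption. Qed.

Lemma fmap_0 (C D : preadditive) (F : functor C D) (X Y : C) :
  fmap F (0 : hom X Y) == 0.
Proof.
  apply (hadd_inj (h := fmap F 0)).
  rewrite <- fmap_add, hadd_0, hadd_0l; reflexivity.
Qed.

Lemma fmap_opp (C D : preadditive) (F : functor C D) (X Y : C) (f : hom X Y) :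
  fmap F (- f) == - fmap F f.
Proof.
  apply hopp_unique.
  rewrite <- fmap_add, (hadd_comm (- f)), hadd_opp; apply fmap_0.
Qed.

Lemma fmap_iso (C D : preadditive) (F : functor C D) (X Y : C) (f : hom X Y) :
  is_iso f -> is_iso (fmap F f).
Proof.
  intros [g [H1 H2]]; exists (fmap F g); split;
    rewrite <- fmap_comp, ?H1, ?H2; apply fmap_id.
Qed.

Program Definition fcomp (C D E : preadditive) (G : functor D E) (F : functor C D) :
  functor C E := {| fob X := G (F X); fmap X Y f := fmap G (fmap F f) |}.
Next Obligation. intros C D E G F X Y f g H; cbn; rewrite H; reflexivity. Qed.
Next Obligation. intros; cbn; rewrite 2!fmap_id; reflexivity. Qed.
Next Obligation. intros; cbn; rewrite 2!fmap_comp; reflexivity. Qed.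
Next Obligation. intros; cbn; rewrite 2!fmap_add; reflexivity. Qed.

Definition faithful (C D : preadditive) (F : functor C D) :=
  forall (X Y : C) (f g : hom X Y), fmap F f == fmap F g -> f == g.
Definition full (C D : preadditive) (F : functor C D) :=
  forall (X Y : C) (h : hom (F X) (F Y)), exists f : hom X Y, fmap F f == h.
Definition fully_faithful (C D : preadditive) (F : functor C D) :=
  full F /\ faithful F.

Definition ess_image (C D : preadditive) (F : functor C D) (Y : D) : Prop :=
  exists X : C, isomorphic (F X) Y.
Definition ker_functor (C D : preadditive) (F : functor C D) (X : C) : Prop :=
  is_zero (F X).

(* [adjunction F G] : F is left adjoint to G. *)
Record adjunction (C D : preadditive) (F : functor C D) (G : functor D C) := {
  adj : forall X Y, hom (F X) Y -> hom X (G Y);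
  adj_inv : forall X Y, hom X (G Y) -> hom (F X) Y;
  adj_heq : forall X Y (f g : hom (F X) Y), f == g -> adj f == adj g;
  adj_inv_heq : forall X Y (f g : hom X (G Y)), f == g -> adj_inv f == adj_inv g;
  adjK : forall X Y (f : hom (F X) Y), adj_inv (adj f) == f;
  adj_invK : forall X Y (f : hom X (G Y)), adj (adj_inv f) == f;
  adj_nat : forall X X' Y Y' (a : hom X' X) (f : hom (F X) Y) (b : hom Y Y'),
    adj (b o f o fmap F a) == fmap G b o adj f o a
}.

Definition full_sub (C : preadditive) (P : C -> Prop) : preadditive := {|
  ob := {X : C | P X};
  hom X Y := @hom C (proj1_sig X) (proj1_sig Y);
  heq X Y := @heq C (proj1_sig X) (proj1_sig Y);
  idm X := @idm C (proj1_sig X);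
  comp X Y Z := @comp C (proj1_sig X) (proj1_sig Y) (proj1_sig Z);
  hzero X Y := @hzero C (proj1_sig X) (proj1_sig Y);
  hadd X Y := @hadd C (proj1_sig X) (proj1_sig Y);
  hopp X Y := @hopp C (proj1_sig X) (proj1_sig Y);
  heq_equiv X Y := @heq_equiv C (proj1_sig X) (proj1_sig Y);
  comp_heq X Y Z := @comp_heq C (proj1_sig X) (proj1_sig Y) (proj1_sig Z);
  hadd_heq X Y := @hadd_heq C (proj1_sig X) (proj1_sig Y);
  comp_id_l X Y := @comp_id_l C (proj1_sig X) (proj1_sig Y);
  comp_id_r X Y := @comp_id_r C (proj1_sig X) (proj1_sig Y);
  comp_assoc X Y Z W :=
    @comp_assoc C (proj1_sig X) (proj1_sig Y) (proj1_sig Z) (proj1_sig W);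
  hadd_assoc X Y := @hadd_assoc C (proj1_sig X) (proj1_sig Y);
  hadd_comm X Y := @hadd_comm C (proj1_sig X) (proj1_sig Y);
  hadd_0 X Y := @hadd_0 C (proj1_sig X) (proj1_sig Y);
  hadd_opp X Y := @hadd_opp C (proj1_sig X) (proj1_sig Y);
  comp_hadd_l X Y Z := @comp_hadd_l C (proj1_sig X) (proj1_sig Y) (proj1_sig Z);
  comp_hadd_r X Y Z := @comp_hadd_r C (proj1_sig X) (proj1_sig Y) (proj1_sig Z)
|}.

Record is_biproduct (C : preadditive) (X Y S : C)
    (iX : hom X S) (iY : hom Y S) (pX : hom S X) (pY : hom S Y) : Prop := {
  bip_XX : pX o iX == idm X;
  bip_YY : pY o iY == idm Y;
  bip_XY : pY o iX == 0;
  bip_YX : pX o iY == 0;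
  bip_id : iX o pX + iY o pY == idm S
}.

Definition is_kernel (C : preadditive) (K X Y : C) (f : hom X Y) (k : hom K X) :=
  f o k == 0 /\
  forall (W : C) (g : hom W X), f o g == 0 ->
    exists u : hom W K, k o u == g /\ forall u', k o u' == g -> u' == u.
Definition is_cokernel (C : preadditive) (X Y Q : C) (f : hom X Y) (c : hom Y Q) :=
  c o f == 0 /\
  forall (W : C) (g : hom Y W), g o f == 0 ->
    exists u : hom Q W, u o c == g /\ forall u', u' o c == g -> u' == u.

Record abelian (A : preadditive) : Prop := {
  ab_zero : exists Z : A, is_zero Z;
  ab_biproduct : forall X Y : A, exists (S : A)
    (iX : hom X S) (iY : hom Y S) (pX : hom S X) (pY : hom S Y),
    is_biproduct iX iY pX pY;
  ab_kernel : forall (X Y : A) (f : hom X Y), exists (K : A) (k : hom K X),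
    is_kernel f k;
  ab_cokernel : forall (X Y : A) (f : hom X Y), exists (Q : A) (c : hom Y Q),
    is_cokernel f c;
  ab_mono : forall (X Y : A) (f : hom X Y), mono f ->
    exists (Z : A) (g : hom Y Z), is_kernel g f;
  ab_epi : forall (X Y : A) (f : hom X Y), epi f ->
    exists (W : A) (g : hom W X), is_cokernel g f
}.

Definition injective (A : preadditive) (I : A) : Prop :=
  forall (X Y : A) (m : hom X Y) (f : hom X I), mono m ->
    exists g : hom Y I, g o m == f.
Definition projective (A : preadditive) (P : A) : Prop :=
  forall (X Y : A) (e : hom Y X) (f : hom P X), epi e ->
    exists g : hom P Y, e o g == f.
Definition enough_injectives (A : preadditive) : Prop :=
  forall X : A, exists (I : A) (m : hom X I), injective I /\ mono m.
Definition enough_projectives (A : preadditive) : Prop :=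
  forall X : A, exists (P : A) (e : hom P X), projective P /\ epi e.

(* H is the cokernel of the map X -> Ker g induced by f. *)
Definition is_homology (A : preadditive) (X Y Z : A)
    (f : hom X Y) (g : hom Y Z) (H : A) : Prop :=
  exists (K : A) (k : hom K Y) (f' : hom X K) (c : hom K H),
    is_kernel g k /\ k o f' == f /\ is_cokernel f' c.
Definition homology_vanishes (A : preadditive) (X Y Z : A)
    (f : hom X Y) (g : hom Y Z) : Prop :=
  exists H : A, is_homology f g H /\ is_zero H.

Definition tri_iso (C : preadditive) (S : functor C C)
    (X Y Z : C) (f : hom X Y) (g : hom Y Z) (h : hom Z (S X))
    (X' Y' Z' : C) (f' : hom X' Y') (g' : hom Y' Z') (h' : hom Z' (S X')) : Prop :=
  exists (a : hom X X') (b : hom Y Y') (c : hom Z Z'),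
    is_iso a /\ is_iso b /\ is_iso c /\
    b o f == f' o a /\ c o g == g' o b /\ fmap S a o h == h' o c.

Lemma is_iso_id (C : preadditive) (X : C) : is_iso (idm X).
Proof. exists (idm X); split; apply comp_id_l. Qed.

Lemma tri_iso_heq (C : preadditive) (S : functor C C)
    (X Y Z : C) (f f' : hom X Y) (g g' : hom Y Z) (h h' : hom Z (S X)) :
  f == f' -> g == g' -> h == h' -> tri_iso f g h f' g' h'.
Proof.
  intros Ef Eg Eh; exists (idm X), (idm Y), (idm Z).
  do 3 (split; [apply is_iso_id |]).
  rewrite fmap_id, !comp_id_l, !comp_id_r; auto.
Qed.

Lemma is_iso_comp (C : preadditive) (X Y Z : C) (g : hom Y Z) (f : hom X Y) :
  is_iso g -> is_iso f -> is_iso (g o f).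
Proof.
  intros [g' [G1 G2]] [f' [F1 F2]]; exists (f' o g'); split.
  - rewrite comp_assoc, <- (comp_assoc f'), G1, comp_id_r; exact F1.
  - rewrite comp_assoc, <- (comp_assoc g), F2, comp_id_r; exact G2.
Qed.

Lemma tri_iso_trans (C : preadditive) (S : functor C C)
    (X Y Z : C) (f : hom X Y) (g : hom Y Z) (h : hom Z (S X))
    (X' Y' Z' : C) (f' : hom X' Y') (g' : hom Y' Z') (h' : hom Z' (S X'))
    (X1 Y1 Z1 : C) (f1 : hom X1 Y1) (g1 : hom Y1 Z1) (h1 : hom Z1 (S X1)) :
  tri_iso f g h f' g' h' -> tri_iso f' g' h' f1 g1 h1 -> tri_iso f g h f1 g1 h1.
Proof.
  intros (a & b & c & Ha & Hb & Hc & E1 & E2 & E3)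
    (a' & b' & c' & Ha' & Hb' & Hc' & E1' & E2' & E3').
  exists (a' o a), (b' o b), (c' o c).
  do 3 (split; [apply is_iso_comp; assumption |]).
  split; [rewrite <- comp_assoc, E1, comp_assoc, E1', comp_assoc; reflexivity |].
  split; [rewrite <- comp_assoc, E2, comp_assoc, E2', comp_assoc; reflexivity |].
  rewrite fmap_comp, <- comp_assoc, E3, comp_assoc, E3', comp_assoc; reflexivity.
Qed.

(* The triangulated categories of this file are built from their translation and
   their class of triangles.  The notions below (Verdier quotients, triangle
   functors, stable t-structures, recollements) refer to nothing else, so of
   Verdier's axioms only two consequences are kept as fields: invariance under
   isomorphism, and [tri_shift] (rotate a triangle three times), by which the
   translation descends to Verdier quotients. *)
Record tricat := Tricat {
  tcat :> preadditive;
  shift : functor tcat tcat;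
  tri : forall X Y Z : tcat, hom X Y -> hom Y Z -> hom Z (shift X) -> Prop;
  tri_closed : forall (X Y Z : tcat) (f : hom X Y) (g : hom Y Z) (h : hom Z (shift X))
    (X' Y' Z' : tcat) (f' : hom X' Y') (g' : hom Y' Z') (h' : hom Z' (shift X')),
    tri_iso f g h f' g' h' -> tri f' g' h' -> tri f g h;
  tri_shift : forall (X Y Z : tcat) (f : hom X Y) (g : hom Y Z) (h : hom Z (shift X)),
    tri f g h -> tri (fmap shift f) (fmap shift g) (- fmap shift h)
}.
Arguments shift {t}.
Arguments tri {t X Y Z} f g h.

Lemma tri_iso_map (C D : preadditive) (S : functor C C) (T : functor D D)
    (F : functor C D) (th : forall X, hom (F (S X)) (T (F X)))
    (th_nat : forall (X Y : C) (f : hom X Y),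
       th Y o fmap F (fmap S f) == fmap T (fmap F f) o th X)
    (X Y Z : C) (f : hom X Y) (g : hom Y Z) (h : hom Z (S X))
    (X' Y' Z' : C) (f' : hom X' Y') (g' : hom Y' Z') (h' : hom Z' (S X')) :
  tri_iso f g h f' g' h' ->
  tri_iso (S := T) (fmap F f) (fmap F g) (th X o fmap F h)
          (fmap F f') (fmap F g') (th X' o fmap F h').
Proof.
  intros (a & b & c & Ha & Hb & Hc & E1 & E2 & E3).
  exists (fmap F a), (fmap F b), (fmap F c).
  do 3 (split; [apply fmap_iso; assumption |]).
  split; [rewrite <- !fmap_comp, E1; reflexivity |].
  split; [rewrite <- !fmap_comp, E2; reflexivity |].
  rewrite comp_assoc, <- th_nat, <- !comp_assoc, <- !fmap_comp, E3; reflexivity.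
Qed.

Lemma tri_iso_shift (C : preadditive) (S : functor C C)
    (X Y Z : C) (f : hom X Y) (g : hom Y Z) (h : hom Z (S X))
    (X' Y' Z' : C) (f' : hom X' Y') (g' : hom Y' Z') (h' : hom Z' (S X')) :
  tri_iso f g h f' g' h' ->
  tri_iso (S := S) (fmap S f) (fmap S g) (- fmap S h)
          (fmap S f') (fmap S g') (- fmap S h').
Proof.
  intros (a & b & c & Ha & Hb & Hc & E1 & E2 & E3).
  exists (fmap S a), (fmap S b), (fmap S c).
  do 3 (split; [apply fmap_iso; assumption |]).
  split; [rewrite <- !fmap_comp, E1; reflexivity |].
  split; [rewrite <- !fmap_comp, E2; reflexivity |].
  rewrite comp_opp_r, comp_opp_l, <- !fmap_comp, E3; reflexivity.
Qed.

Record tri_functor (D E : tricat) := TriFunctor {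
  tfun :> functor D E;
  tfun_shift : forall X : D, hom (tfun (shift X)) (shift (tfun X));
  tfun_shift_iso : forall X, is_iso (tfun_shift X);
  tfun_shift_nat : forall (X Y : D) (f : hom X Y),
    tfun_shift Y o fmap tfun (fmap shift f)
      == fmap shift (fmap tfun f) o tfun_shift X;
  tfun_tri : forall (X Y Z : D) (f : hom X Y) (g : hom Y Z) (h : hom Z (shift X)),
    tri f g h -> tri (fmap tfun f) (fmap tfun g) (tfun_shift X o fmap tfun h)
}.

Record tsub (D : tricat) := TSub {
  tmem :> D -> Prop;
  tmem_shift : forall X : D, tmem X -> tmem (shift X)
}.

Program Definition sub_shift (D : tricat) (P : tsub D) :
  functor (full_sub P) (full_sub P) := {|
  fob X := exist P (shift (proj1_sig X)) (tmem_shift (proj2_sig X));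
  fmap X Y f := fmap (@shift D) (X := proj1_sig X) (Y := proj1_sig Y) f
|}.
Next Obligation. intros D P X Y f g H; exact (fmap_heq shift H). Qed.
Next Obligation. intros D P X; exact (fmap_id (@shift D) _). Qed.
Next Obligation. intros D P X Y Z g f; exact (fmap_comp (@shift D) g f). Qed.
Next Obligation. intros D P X Y f g; exact (fmap_add (@shift D) f g). Qed.

Definition sub_tricat (D : tricat) (P : tsub D) : tricat := {|
  tcat := full_sub P;
  shift := sub_shift P;
  tri X Y Z f g h :=
    @tri D (proj1_sig X) (proj1_sig Y) (proj1_sig Z) f g h;
  tri_closed X Y Z f g h X' Y' Z' f' g' h' :=
    @tri_closed D (proj1_sig X) (proj1_sig Y) (proj1_sig Z) f g h
      (proj1_sig X') (proj1_sig Y') (proj1_sig Z') f' g' h';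
  tri_shift X Y Z f g h :=
    @tri_shift D (proj1_sig X) (proj1_sig Y) (proj1_sig Z) f g h
|}.

Definition tsub_restrict (D : tricat) (P N : tsub D) : tsub (sub_tricat P) := {|
  tmem := fun X : sub_tricat P => N (proj1_sig X);
  tmem_shift := fun X (HX : N (proj1_sig X)) => tmem_shift HX
|}.

Program Definition sub_incl_functor (D : tricat) (P Q : tsub D)
    (HPQ : forall X, P X -> Q X) : functor (sub_tricat P) (sub_tricat Q) := {|
  fob X := exist Q (proj1_sig X) (HPQ _ (proj2_sig X));
  fmap X Y f := f
|}.
Next Obligation. intros; assumption. Qed.
Next Obligation. intros; reflexivity. Qed.
Next Obligation. intros; reflexivity. Qed.
Next Obligation. intros; reflexivity. Qed.

Section Verdier.
Variables (D : tricat) (N : tsub D).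

Definition cone_in (X Y : D) (s : hom X Y) : Prop :=
  exists (Z : D) (g : hom Y Z) (h : hom Z (shift X)), tri s g h /\ N Z.

Lemma cone_in_shift (X Y : D) (s : hom X Y) : cone_in s -> cone_in (fmap shift s).
Proof.
  intros (Z & g & h & H & HZ).
  exists (shift Z), (fmap shift g), (- fmap shift h); split;
    [apply tri_shift, H | apply tmem_shift, HZ].
Qed.

(* D / N is the localization D[S^-1], S being the class of morphisms with a cone
   in N ([cone_in]): it has the objects of D, and its morphisms are the formal expressions
   generated by the morphisms of D and inverses of those of S, modulo the axioms
   of a preadditive category, functoriality and additivity of D -> D[S^-1], and
   the relations making [vinv s] inverse to s.  As S admits a calculus of
   fractions, the plain localization of categories is already preadditive, hence
   the two coincide, and morphisms are represented by roofs. *)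
Inductive vhom : D -> D -> Type :=
| vincl X Y (f : hom X Y) : vhom X Y
| vinv X Y (s : hom X Y) (Hs : cone_in s) : vhom Y X
| vcomp X Y Z (g : vhom Y Z) (f : vhom X Y) : vhom X Z
| vadd X Y (f g : vhom X Y) : vhom X Y
| vopp X Y (f : vhom X Y) : vhom X Y.

Inductive veq : forall X Y : D, vhom X Y -> vhom X Y -> Prop :=
| veq_refl X Y (f : vhom X Y) : veq f f
| veq_sym X Y (f g : vhom X Y) : veq f g -> veq g f
| veq_trans X Y (f g h : vhom X Y) : veq f g -> veq g h -> veq f h
| veq_vcomp X Y Z (g g' : vhom Y Z) (f f' : vhom X Y) :
    veq g g' -> veq f f' -> veq (vcomp g f) (vcomp g' f')
| veq_vadd X Y (f f' g g' : vhom X Y) :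
    veq f f' -> veq g g' -> veq (vadd f g) (vadd f' g')
| veq_id_l X Y (f : vhom X Y) : veq (vcomp (vincl (idm Y)) f) f
| veq_id_r X Y (f : vhom X Y) : veq (vcomp f (vincl (idm X))) f
| veq_assoc X Y Z W (h : vhom Z W) (g : vhom Y Z) (f : vhom X Y) :
    veq (vcomp h (vcomp g f)) (vcomp (vcomp h g) f)
| veq_add_assoc X Y (f g h : vhom X Y) :
    veq (vadd f (vadd g h)) (vadd (vadd f g) h)
| veq_add_comm X Y (f g : vhom X Y) : veq (vadd f g) (vadd g f)
| veq_add_0 X Y (f : vhom X Y) : veq (vadd f (vincl 0)) f
| veq_add_opp X Y (f : vhom X Y) : veq (vadd f (vopp f)) (vincl 0)
| veq_comp_add_l X Y Z (g g' : vhom Y Z) (f : vhom X Y) :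
    veq (vcomp (vadd g g') f) (vadd (vcomp g f) (vcomp g' f))
| veq_comp_add_r X Y Z (g : vhom Y Z) (f f' : vhom X Y) :
    veq (vcomp g (vadd f f')) (vadd (vcomp g f) (vcomp g f'))
| veq_vincl X Y (f g : hom X Y) : f == g -> veq (vincl f) (vincl g)
| veq_vincl_comp X Y Z (g : hom Y Z) (f : hom X Y) :
    veq (vincl (g o f)) (vcomp (vincl g) (vincl f))
| veq_vincl_add X Y (f g : hom X Y) :
    veq (vincl (f + g)) (vadd (vincl f) (vincl g))
| veq_inv_l X Y (s : hom X Y) (Hs : cone_in s) :
    veq (vcomp (vinv Hs) (vincl s)) (vincl (idm X))
| veq_inv_r X Y (s : hom X Y) (Hs : cone_in s) :
    veq (vcomp (vincl s) (vinv Hs)) (vincl (idm Y)).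

Program Definition vcat : preadditive := {|
  ob := D;
  hom := vhom;
  heq := veq;
  idm X := vincl (idm X);
  comp := vcomp;
  hzero X Y := vincl 0;
  hadd := vadd;
  hopp := vopp
|}.
Next Obligation.
  intros; split;
    [exact (@veq_refl X Y) | exact (@veq_sym X Y) | exact (@veq_trans X Y)].
Qed.
Next Obligation. intros; apply veq_vcomp; assumption. Qed.
Next Obligation. intros; apply veq_vadd; assumption. Qed.
Next Obligation. exact veq_id_l. Qed.
Next Obligation. exact veq_id_r. Qed.
Next Obligation. exact veq_assoc. Qed.
Next Obligation. exact veq_add_assoc. Qed.
Next Obligation. exact veq_add_comm. Qed.
Next Obligation. exact veq_add_0. Qed.
Next Obligation. exact veq_add_opp. Qed.
Next Obligation. exact veq_comp_add_l. Qed.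
Next Obligation. exact veq_comp_add_r. Qed.

Program Definition vproj : functor D vcat := {|
  fob X := X : vcat;
  fmap X Y f := vincl f : @hom vcat X Y
|}.
Next Obligation. intros; apply veq_vincl; assumption. Qed.
Next Obligation. intros; apply veq_refl. Qed.
Next Obligation. exact veq_vincl_comp. Qed.
Next Obligation. exact veq_vincl_add. Qed.

End Verdier.

Lemma inverse_unique (C : preadditive) (X Y : C) (f : hom X Y) (g g' : hom Y X) :
  is_inverse f g -> is_inverse f g' -> g == g'.
Proof.
  intros [H1 H2] [H1' H2'].
  rewrite <- (comp_id_l g), <- H1', <- comp_assoc, H2; apply comp_id_r.
Qed.

Lemma vinv_inverse (D : tricat) (N : tsub D) (X Y : D) (s : hom X Y)
    (Hs : cone_in N s) :
  is_inverse (C := vcat N) (vincl N s : @hom (vcat N) X Y) (vinv Hs).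
Proof. split; [apply veq_inv_l | apply veq_inv_r]. Qed.

Section VerdierLift.
Variables (D : tricat) (N : tsub D) (E : tricat) (M : tsub E) (F : functor D E).
Hypothesis F_cone : forall (X Y : D) (s : hom X Y), cone_in N s -> cone_in M (fmap F s).

Fixpoint vlift_hom (X Y : D) (f : vhom N X Y) : vhom M (F X) (F Y) :=
  match f in vhom _ X Y return vhom M (F X) (F Y) with
  | vincl _ f => vincl M (fmap F f)
  | vinv Hs => vinv (F_cone Hs)
  | vcomp g f => vcomp (vlift_hom g) (vlift_hom f)
  | vadd f g => vadd (vlift_hom f) (vlift_hom g)
  | vopp f => vopp (vlift_hom f)
  end.

Lemma vlift_heq (X Y : D) (f g : vhom N X Y) :
  veq f g -> veq (vlift_hom f) (vlift_hom g).
Proof.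
  induction 1; simpl.
  - apply veq_refl.
  - apply veq_sym; assumption.
  - eapply veq_trans; eassumption.
  - apply veq_vcomp; assumption.
  - apply veq_vadd; assumption.
  - eapply veq_trans; [| apply veq_id_l].
    apply veq_vcomp; [apply veq_vincl, fmap_id | apply veq_refl].
  - eapply veq_trans; [| apply veq_id_r].
    apply veq_vcomp; [apply veq_refl | apply veq_vincl, fmap_id].
  - apply veq_assoc.
  - apply veq_add_assoc.
  - apply veq_add_comm.
  - eapply veq_trans; [| apply veq_add_0].
    apply veq_vadd; [apply veq_refl | apply veq_vincl, fmap_0].
  - eapply veq_trans; [apply veq_add_opp | apply veq_vincl].
    symmetry; apply fmap_0.
  - apply veq_comp_add_l.
  - apply veq_comp_add_r.
  - apply veq_vincl, fmap_heq; assumption.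
  - eapply veq_trans; [apply veq_vincl, fmap_comp | apply veq_vincl_comp].
  - eapply veq_trans; [apply veq_vincl, fmap_add | apply veq_vincl_add].
  - eapply veq_trans; [apply veq_inv_l | apply veq_vincl].
    symmetry; apply fmap_id.
  - eapply veq_trans; [apply veq_inv_r | apply veq_vincl].
    symmetry; apply fmap_id.
Qed.

Program Definition vlift : functor (vcat N) (vcat M) := {|
  fob X := F X : vcat M;
  fmap := vlift_hom
|}.
Next Obligation. exact vlift_heq. Qed.
Next Obligation. intros; apply veq_vincl, fmap_id. Qed.
Next Obligation. intros; apply veq_refl. Qed.
Next Obligation. intros; apply veq_refl. Qed.

End VerdierLift.

Lemma vcat_nat (D : tricat) (N : tsub D) (E : preadditive)
    (F G : functor (vcat N) E) (th : forall X : D, hom (F X) (G X))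
    (Hth : forall (X Y : D) (f : hom X Y),
      th Y o fmap F (vincl N f : @hom (vcat N) X Y)
        == fmap G (vincl N f : @hom (vcat N) X Y) o th X)
    (X Y : vcat N) (f : hom X Y) :
  th Y o fmap F f == fmap G f o th X.
Proof.
  simpl in f; induction f as [X Y f | X Y s Hs | X Y Z g IHg f IHf
    | X Y f IHf g IHg | X Y f IHf].
  - apply Hth.
  - destruct (vinv_inverse Hs) as [H1 H2].
    pose (v := vinv Hs : @hom (vcat N) Y X).
    pose (u := vincl N s : @hom (vcat N) X Y).
    change (th X o fmap F v == fmap G v o th Y).
    assert (E1 : fmap G v o fmap G u == idm _)
      by (rewrite <- fmap_comp, <- fmap_id; apply fmap_heq; exact H1).
    assert (E2 : fmap F u o fmap F v == idm _)
      by (rewrite <- fmap_comp, <- fmap_id; apply fmap_heq; exact H2).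
    rewrite <- (comp_id_l (th X)), <- E1, <- (comp_assoc (fmap G v)).
    unfold u at 1; rewrite <- Hth; fold u.
    rewrite <- !comp_assoc, E2, comp_id_r; reflexivity.
  - change (th Z o fmap F (@comp (vcat N) X Y Z g f)
      == fmap G (@comp (vcat N) X Y Z g f) o th X).
    rewrite !fmap_comp, comp_assoc, IHg, <- comp_assoc, IHf, comp_assoc; reflexivity.
  - change (th Y o fmap F (@hadd (vcat N) X Y f g)
      == fmap G (@hadd (vcat N) X Y f g) o th X).
    rewrite !fmap_add, comp_hadd_l, comp_hadd_r, IHf, IHg; reflexivity.
  - change (th Y o fmap F (@hopp (vcat N) X Y f)
      == fmap G (@hopp (vcat N) X Y f) o th X).
    rewrite !fmap_opp, comp_opp_l, comp_opp_r, IHf; reflexivity.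
Qed.

(* The triangles of D / N are those isomorphic to images of triangles of D. *)
Program Definition verdier (D : tricat) (N : tsub D) : tricat := {|
  tcat := vcat N;
  shift := vlift (@cone_in_shift D N);
  tri X Y Z f g h :=
    exists (X' Y' Z' : D) (f' : hom X' Y') (g' : hom Y' Z') (h' : hom Z' (shift X')),
      tri f' g' h' /\
      @tri_iso (vcat N) (vlift (@cone_in_shift D N)) X Y Z f g h
        X' Y' Z' (vincl N f') (vincl N g') (vincl N h')
|}.
Next Obligation.
  intros D N X Y Z f g h X1 Y1 Z1 f1 g1 h1 HI
    (X' & Y' & Z' & f' & g' & h' & H & HI').
  exists X', Y', Z', f', g', h'; split; [exact H |].
  exact (tri_iso_trans HI HI').
Qed.
Next Obligation.
  intros D N X Y Z f g h (X' & Y' & Z' & f' & g' & h' & H & HI).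
  exists (shift X'), (shift Y'), (shift Z'), (fmap shift f'), (fmap shift g'),
    (- fmap shift h').
  split; [apply tri_shift, H |].
  destruct (tri_iso_shift HI) as (a & b & c & Ha & Hb & Hc & E1 & E2 & E3).
  exists a, b, c; do 5 (split; [assumption |]).
  etransitivity; [exact E3 |].
  apply comp_heq; [| reflexivity].
  symmetry; apply (fmap_opp (vproj N)).
Qed.

Section VerdierMap.
Variables (D E : tricat) (N : tsub D) (M : tsub E) (F : tri_functor D E).
Hypothesis HNM : forall X : D, N X -> M (F X).

Lemma tri_functor_cone (X Y : D) (s : hom X Y) :
  cone_in N s -> cone_in M (fmap F s).
Proof.
  intros (Z & g & h & H & HZ).
  exists (F Z), (fmap F g), (tfun_shift F X o fmap F h); split;
    [apply tfun_tri, H | apply HNM, HZ].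
Qed.

Definition vmap : functor (verdier N) (verdier M) := vlift tri_functor_cone.

Definition vmap_shift (X : verdier N) :
  hom (vmap (shift X)) (shift (vmap X)) := vincl M (tfun_shift F X).

Lemma vmap_shift_iso (X : verdier N) : is_iso (vmap_shift X).
Proof. apply (fmap_iso (vproj M)), tfun_shift_iso. Qed.

Lemma vmap_shift_nat (X Y : verdier N) (f : hom X Y) :
  vmap_shift Y o fmap vmap (fmap shift f)
    == fmap shift (fmap vmap f) o vmap_shift X.
Proof.
  apply (@vcat_nat D N (verdier M) (fcomp vmap shift) (fcomp shift vmap)
           vmap_shift).
  clear X Y f; intros X Y f; simpl; unfold vmap_shift.
  eapply veq_trans; [apply veq_sym, veq_vincl_comp |].
  eapply veq_trans; [apply veq_vincl, tfun_shift_nat | apply veq_vincl_comp].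
Qed.

Lemma vmap_tri (X Y Z : verdier N) (f : hom X Y) (g : hom Y Z)
    (h : hom Z (shift X)) :
  tri f g h -> tri (fmap vmap f) (fmap vmap g) (vmap_shift X o fmap vmap h).
Proof.
  intros (X' & Y' & Z' & f' & g' & h' & H & HI).
  exists (F X'), (F Y'), (F Z'), (fmap F f'), (fmap F g'),
    (tfun_shift F X' o fmap F h').
  split; [apply tfun_tri, H |].
  destruct (tri_iso_map (T := @shift (verdier M)) vmap_shift_nat HI)
    as (a & b & c & Ha & Hb & Hc & E1 & E2 & E3).
  exists a, b, c; do 5 (split; [assumption |]).
  etransitivity; [exact E3 |].
  apply comp_heq; [| reflexivity].
  apply veq_sym, veq_vincl_comp.
Qed.

Definition verdier_map : tri_functor (verdier N) (verdier M) := {|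
  tfun := vmap;
  tfun_shift := vmap_shift;
  tfun_shift_iso := vmap_shift_iso;
  tfun_shift_nat := vmap_shift_nat;
  tfun_tri := vmap_tri
|}.
End VerdierMap.

Program Definition sub_incl (D : tricat) (P Q : tsub D)
    (HPQ : forall X, P X -> Q X) : tri_functor (sub_tricat P) (sub_tricat Q) := {|
  tfun := sub_incl_functor HPQ;
  tfun_shift X := @idm D (shift (proj1_sig X))
|}.
Next Obligation. intros; apply (is_iso_id (C := D)). Qed.
Next Obligation.
  intros; simpl; etransitivity; [apply comp_id_l | symmetry; apply comp_id_r].
Qed.
Next Obligation.
  intros D P Q HPQ X Y Z f g h H; simpl in *.
  refine (tri_closed (tri_iso_heq _ _ _) H); try reflexivity.
  apply comp_id_l.
Qed.

Section Complexes.
Variable B : preadditive.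

Record complex := Complex {
  cob :> Z -> B;
  dif : forall n : Z, hom (cob n) (cob (n + 1)%Z);
  dif_dif : forall n : Z, dif (n + 1)%Z o dif n == 0
}.

Record chain_map (X Y : complex) := ChainMap {
  cm :> forall n : Z, hom (X n) (Y n);
  cm_dif : forall n : Z, cm (n + 1)%Z o dif X n == dif Y n o cm n
}.

(* The relation f - g = d h + h d, where [h n] goes from X^(n+1) to Y^n; it is
   written in degree n + 1 so that all compositions typecheck. *)
Definition homotopic (X Y : complex) (f g : chain_map X Y) : Prop :=
  exists h : forall n : Z, hom (X (n + 1)%Z) (Y n),
    forall n : Z, f (n + 1)%Z ==
      g (n + 1)%Z + (dif Y n o h n + h (n + 1)%Z o dif X (n + 1)%Z).

Program Definition cm_id (X : complex) : chain_map X X := {| cm n := idm (X n) |}.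
Next Obligation. intros; cbn; rewrite comp_id_l, comp_id_r; reflexivity. Qed.

Program Definition cm_comp (X Y Z : complex) (g : chain_map Y Z) (f : chain_map X Y) :
  chain_map X Z := {| cm n := g n o f n |}.
Next Obligation.
  intros; cbn; rewrite <- comp_assoc, cm_dif, comp_assoc, cm_dif, comp_assoc.
  reflexivity.
Qed.

Program Definition cm_zero (X Y : complex) : chain_map X Y := {| cm n := 0 |}.
Next Obligation. intros; cbn; rewrite comp_0l, comp_0r; reflexivity. Qed.

Program Definition cm_add (X Y : complex) (f g : chain_map X Y) : chain_map X Y :=
  {| cm n := f n + g n |}.
Next Obligation.
  intros; cbn; rewrite comp_hadd_l, comp_hadd_r, !cm_dif; reflexivity.
Qed.

Program Definition cm_opp (X Y : complex) (f : chain_map X Y) : chain_map X Y :=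
  {| cm n := - f n |}.
Next Obligation.
  intros; cbn; rewrite comp_opp_l, comp_opp_r, cm_dif; reflexivity.
Qed.

Lemma homotopic_ext (X Y : complex) (f g : chain_map X Y) :
  (forall n, f n == g n) -> homotopic f g.
Proof.
  intro H; exists (fun n => 0); intro n.
  rewrite comp_0r, comp_0l, !hadd_0; apply H.
Qed.

Lemma homotopic_equiv (X Y : complex) : Equivalence (@homotopic X Y).
Proof.
  split.
  - intro f; apply homotopic_ext; reflexivity.
  - intros f g [h H]; exists (fun n => - h n); intro n.
    rewrite H, comp_opp_r, comp_opp_l, <- hopp_add, <- hadd_assoc, hadd_opp, hadd_0.
    reflexivity.
  - intros f g k [h H] [h' H']; exists (fun n => h' n + h n); intro n.
    rewrite H, H', comp_hadd_r, comp_hadd_l, <- hadd_assoc, hadd_swap; reflexivity.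
Qed.

Lemma homotopic_comp (X Y Z : complex) (g g' : chain_map Y Z) (f f' : chain_map X Y) :
  homotopic g g' -> homotopic f f' -> homotopic (cm_comp g f) (cm_comp g' f').
Proof.
  intros [k K] [h H].
  exists (fun n => g n o h n + k n o f' (n + 1)%Z); intro n; cbn.
  rewrite H, comp_hadd_r, K, comp_hadd_l, <- (K n), <- hadd_assoc.
  apply hadd_heq; [reflexivity |].
  rewrite !comp_hadd_r, !comp_hadd_l, <- !(comp_assoc _ (f' _)), cm_dif.
  rewrite !comp_assoc, cm_dif, (hadd_comm (_ + _) (_ + _)), hadd_swap; reflexivity.
Qed.

Lemma homotopic_add (X Y : complex) (f f' g g' : chain_map X Y) :
  homotopic f f' -> homotopic g g' -> homotopic (cm_add f g) (cm_add f' g').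
Proof.
  intros [h H] [k K]; exists (fun n => h n + k n); intro n; cbn.
  rewrite H, K, hadd_swap, comp_hadd_r, comp_hadd_l.
  rewrite (hadd_swap (dif Y n o h n)); reflexivity.
Qed.

Definition hcat : preadditive.
Proof.
  refine {| ob := complex; hom := chain_map; heq := homotopic; idm := cm_id;
    comp := cm_comp; hzero := cm_zero; hadd := cm_add; hopp := cm_opp;
    heq_equiv := homotopic_equiv; comp_heq := homotopic_comp;
    hadd_heq := homotopic_add |};
  intros; apply homotopic_ext; intro; cbn.
  - apply comp_id_l.
  - apply comp_id_r.
  - apply comp_assoc.
  - apply hadd_assoc.
  - apply hadd_comm.
  - apply hadd_0.
  - apply hadd_opp.
  - apply comp_hadd_l.
  - apply comp_hadd_r.
Defined.

Program Definition cshift_ob (X : complex) : complex :=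
  {| cob n := X (n + 1)%Z; dif n := - dif X (n + 1)%Z |}.
Next Obligation.
  intros; cbn; rewrite comp_opp_l, comp_opp_r, hopp_opp; apply dif_dif.
Qed.

Program Definition cshift_map (X Y : complex) (f : chain_map X Y) :
  chain_map (cshift_ob X) (cshift_ob Y) := {| cm n := f (n + 1)%Z |}.
Next Obligation.
  intros; cbn; rewrite comp_opp_l, comp_opp_r, cm_dif; reflexivity.
Qed.

Program Definition cshift : functor hcat hcat :=
  {| fob X := cshift_ob X : hcat; fmap := cshift_map |}.
Next Obligation.
  intros X Y f g [h H]; exists (fun n => - h (n + 1)%Z); intro n; cbn.
  rewrite comp_opp_l, comp_opp_r, comp_opp_l, comp_opp_r, !hopp_opp; apply H.
Qed.
Next Obligation. intros; apply homotopic_ext; intro; reflexivity. Qed.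
Next Obligation. intros; apply homotopic_ext; intro; reflexivity. Qed.
Next Obligation. intros; apply homotopic_ext; intro; reflexivity. Qed.

(* C is the mapping cone of u with i : Y -> C and p : C -> X[1]: in each degree C
   is a biproduct of X^(n+1) and Y^n, and its differential is the matrix
   (-d 0; u d).  Since i and p are chain maps, only the restriction of the
   differential to X^(n+1) has to be prescribed. *)
Definition is_cone (X Y C : complex) (u : chain_map X Y) (i : chain_map Y C)
    (p : chain_map C (cshift_ob X)) : Prop :=
  exists (iX : forall n : Z, hom (X (n + 1)%Z) (C n))
         (pY : forall n : Z, hom (C n) (Y n)),
    (forall n : Z, is_biproduct (iX n) (i n) (p n) (pY n)) /\
    (forall n : Z, dif C n o iX n ==
       iX (n + 1)%Z o (- dif X (n + 1)%Z) + i (n + 1)%Z o u (n + 1)%Z).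

Lemma is_cone_shift (X Y C : complex) (u : chain_map X Y) (i : chain_map Y C)
    (p : chain_map C (cshift_ob X)) :
  is_cone u i p -> is_cone (cshift_map u) (cshift_map i) (cm_opp (cshift_map p)).
Proof.
  intros (iX & pY & HB & HD).
  exists (fun n => - iX (n + 1)%Z), (fun n => pY (n + 1)%Z); split; intro n; cbn.
  - destruct (HB (n + 1)%Z) as [H1 H2 H3 H4 H5]; split.
    + rewrite comp_opp_l, comp_opp_r, hopp_opp; exact H1.
    + exact H2.
    + rewrite comp_opp_r, H3; apply hopp_0.
    + rewrite comp_opp_l, H4; apply hopp_0.
    + rewrite comp_opp_l, comp_opp_r, hopp_opp; exact H5.
  - rewrite comp_opp_l, comp_opp_r, hopp_opp, HD.
    rewrite (comp_opp_l (iX _) (- _)), (comp_opp_r (iX _) (- _)), hopp_opp.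
    reflexivity.
Qed.

(* The triangles are those isomorphic, in the homotopy category, to the triangle
   of a mapping cone. *)
Program Definition K : tricat := {|
  tcat := hcat;
  shift := cshift;
  tri X Y Z f g h :=
    exists (X' Y' C : hcat) (u : hom X' Y') (i : hom Y' C) (p : hom C (cshift X')),
      is_cone u i p /\ tri_iso f g h u i p
|}.
Next Obligation.
  intros X Y Z f g h X1 Y1 Z1 f1 g1 h1 HI (X' & Y' & C & u & i & p & HC & HI').
  exists X', Y', C, u, i, p; split; [exact HC | exact (tri_iso_trans HI HI')].
Qed.
Next Obligation.
  intros X Y Z f g h (X' & Y' & C & u & i & p & HC & HI).
  exists (cshift X'), (cshift Y'), (cshift C), (fmap cshift u), (fmap cshift i),
    (- fmap cshift p).
  split; [exact (is_cone_shift HC) | exact (tri_iso_shift HI)].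
Qed.

End Complexes.

Section Classes.
Variables (A : preadditive) (B : A -> Prop).

Definition underlying (X : complex (full_sub B)) : complex A :=
  @Complex A (fun n => proj1_sig (X n)) (dif X) (dif_dif X).

(* This is H^(n+1)(X) = 0. *)
Definition H_vanishes (X : complex A) (n : Z) : Prop :=
  homology_vanishes (dif X n) (dif X (n + 1)%Z).

Definition acyclic (X : complex (full_sub B)) : Prop :=
  forall n : Z, H_vanishes (underlying X) n.
Definition bounded_homology (X : complex (full_sub B)) : Prop :=
  exists m : Z, forall n : Z, (m < Z.abs (n + 1))%Z -> H_vanishes (underlying X) n.
Definition bounded_below (X : complex (full_sub B)) : Prop :=
  exists m : Z, forall n : Z, (n < m)%Z -> is_zero (underlying X n).
Definition bounded_above (X : complex (full_sub B)) : Prop :=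
  exists m : Z, forall n : Z, (m < n)%Z -> is_zero (underlying X n).

Lemma homology_vanishes_opp (X Y Z : A) (f : hom X Y) (g : hom Y Z) :
  homology_vanishes f g -> homology_vanishes (- f) (- g).
Proof.
  intros (H & (Kr & k & f' & c & [K1 K2] & E & [C1 C2]) & HZ).
  assert (N0 : forall (U V : A) (t : hom U V), - t == 0 -> t == 0)
    by (intros U V t Ht; rewrite <- (hopp_opp t), Ht; apply hopp_0).
  exists H; split; [| exact HZ].
  exists Kr, k, (- f'), c; split; [| split; [| split]].
  - split; [rewrite comp_opp_l, K1; apply hopp_0 |].
    intros W t Ht; apply K2, N0; rewrite <- comp_opp_l; exact Ht.
  - rewrite comp_opp_r, E; reflexivity.
  - rewrite comp_opp_r, C1; apply hopp_0.
  - intros W t Ht; apply C2, N0; rewrite <- comp_opp_r; exact Ht.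
Qed.

Lemma H_vanishes_shift (X : complex (full_sub B)) (n : Z) :
  H_vanishes (underlying X) (n + 1)%Z ->
  H_vanishes (underlying (cshift_ob X)) n.
Proof. exact (@homology_vanishes_opp _ _ _ _ _). Qed.

Lemma acyclic_shift (X : complex (full_sub B)) :
  acyclic X -> acyclic (cshift_ob X).
Proof. intros H n; apply H_vanishes_shift, H. Qed.

Lemma bounded_homology_shift (X : complex (full_sub B)) :
  bounded_homology X -> bounded_homology (cshift_ob X).
Proof.
  intros [m H]; exists (m + 1)%Z; intros n Hn; apply H_vanishes_shift, H; lia.
Qed.

Lemma bounded_below_shift (X : complex (full_sub B)) :
  bounded_below X -> bounded_below (cshift_ob X).
Proof. intros [m H]; exists (m - 1)%Z; intros n Hn; apply H; lia. Qed.

Lemma bounded_above_shift (X : complex (full_sub B)) :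
  bounded_above X -> bounded_above (cshift_ob X).
Proof. intros [m H]; exists m; intros n Hn; apply H; lia. Qed.

(* The degrees are cohomological. [Kb], [Kib], [Kpb], [Kmb] and [Kac] are K^b,
   K^{infty,b}, K^{+,b}, K^{-,b} and the acyclic complexes; homology and zero
   objects are taken in the ambient category A, not in the full subcategory B. *)
Program Definition Kb : tsub (K (full_sub B)) :=
  {| tmem X := bounded_below X /\ bounded_above X |}.
Next Obligation.
  intros X [H1 H2]; split; [apply bounded_below_shift | apply bounded_above_shift];
    assumption.
Qed.

Program Definition Kib : tsub (K (full_sub B)) := {| tmem := bounded_homology |}.
Next Obligation. exact bounded_homology_shift. Qed.

Program Definition Kpb : tsub (K (full_sub B)) :=
  {| tmem X := bounded_below X /\ bounded_homology X |}.
Next Obligation.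
  intros X [H1 H2]; split;
    [apply bounded_below_shift | apply bounded_homology_shift]; assumption.
Qed.

Program Definition Kmb : tsub (K (full_sub B)) :=
  {| tmem X := bounded_above X /\ bounded_homology X |}.
Next Obligation.
  intros X [H1 H2]; split;
    [apply bounded_above_shift | apply bounded_homology_shift]; assumption.
Qed.

Program Definition Kac : tsub (K (full_sub B)) := {| tmem := acyclic |}.
Next Obligation. exact acyclic_shift. Qed.

(* [Kquot P N] is (P / N)(B), for full subcategories P and N of K(B). *)
Definition Kquot (P N : tsub (K (full_sub B))) : tricat :=
  verdier (tsub_restrict P N).

Definition Kquot_map (P N Q M : tsub (K (full_sub B)))
    (HPQ : forall X, P X -> Q X) (HNM : forall X, P X -> N X -> M X) :
  tri_functor (Kquot P N) (Kquot Q M) :=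
  @verdier_map _ _ (tsub_restrict P N) (tsub_restrict Q M) (sub_incl HPQ)
    (fun X => HNM (proj1_sig X) (proj2_sig X)).

Lemma Kpb_Kib X : Kpb X -> Kib X.
Proof. intros [_ H]; exact H. Qed.
Lemma Kmb_Kib X : Kmb X -> Kib X.
Proof. intros [_ H]; exact H. Qed.
Lemma Kac_Kib X : Kac X -> Kib X.
Proof. intro H; exists 0%Z; intros n _; apply H. Qed.
Lemma Kib_Kb_Kpb X : Kib X -> Kb X -> Kpb X.
Proof. intros H [H1 _]; split; assumption. Qed.
Lemma Kib_Kb_Kmb X : Kib X -> Kb X -> Kmb X.
Proof. intros H [_ H1]; split; assumption. Qed.

Definition emb_pb : tri_functor (Kquot Kpb Kb) (Kquot Kib Kb) :=
  Kquot_map (N := Kb) (M := Kb) Kpb_Kib (fun _ _ H => H).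
Definition emb_mb : tri_functor (Kquot Kmb Kb) (Kquot Kib Kb) :=
  Kquot_map (N := Kb) (M := Kb) Kmb_Kib (fun _ _ H => H).
Definition emb_ac : functor (sub_tricat Kac) (Kquot Kib Kb) :=
  fcomp (vproj (tsub_restrict Kib Kb)) (sub_incl Kac_Kib).

Definition quot_pb : tri_functor (Kquot Kib Kb) (Kquot Kib Kpb) :=
  Kquot_map (Q := Kib) (N := Kb) (M := Kpb) (fun _ H => H) Kib_Kb_Kpb.
Definition quot_mb : tri_functor (Kquot Kib Kb) (Kquot Kib Kmb) :=
  Kquot_map (Q := Kib) (N := Kb) (M := Kmb) (fun _ H => H) Kib_Kb_Kmb.

End Classes.

(* U and V are given by the objects of their closures under isomorphism, so that
   the equality U = Sigma U is taken up to isomorphism. *)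
Record stable_t_structure (D : tricat) (U V : D -> Prop) : Prop := {
  st_shift_l : forall X : D, U X <-> exists X', U X' /\ isomorphic (shift X') X;
  st_shift_r : forall X : D, V X <-> exists X', V X' /\ isomorphic (shift X') X;
  st_hom : forall X Y : D, U X -> V Y -> forall f : hom X Y, f == 0;
  st_tri : forall X : D, exists (X1 X2 : D)
    (u : hom X1 X) (v : hom X X2) (w : hom X2 (shift X1)),
    U X1 /\ V X2 /\ tri u v w
}.

(* The recollements with given i_* and j^*.  Kernels are closed under isomorphism,
   so that the last three fields say that Im -> Ker exists and is an equivalence
   of full subcategories. *)
Record recollement (D' D D'' : tricat)
    (i_star : tri_functor D' D) (j_star : tri_functor D D'') := {
  rec_i_upper_star : tri_functor D D';
  rec_i_upper_shriek : tri_functor D D';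
  rec_j_lower_shriek : tri_functor D'' D;
  rec_j_lower_star : tri_functor D'' D;
  rec_i_ff : fully_faithful i_star;
  rec_j_shriek_ff : fully_faithful rec_j_lower_shriek;
  rec_j_star_ff : fully_faithful rec_j_lower_star;
  rec_adj_i_star : adjunction rec_i_upper_star i_star;
  rec_adj_i_shriek : adjunction i_star rec_i_upper_shriek;
  rec_adj_j_shriek : adjunction rec_j_lower_shriek j_star;
  rec_adj_j_star : adjunction j_star rec_j_lower_star;
  rec_im_j_shriek : forall X : D,
    ess_image rec_j_lower_shriek X <-> ker_functor rec_i_upper_star X;
  rec_im_i : forall X : D, ess_image i_star X <-> ker_functor j_star X;
  rec_im_j_star : forall X : D,
    ess_image rec_j_lower_star X <-> ker_functor rec_i_upper_shriek X
}.

(* Main.v *)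
(* The brutal truncations of X give a triangle X^{>0} -> X -> X^{<=0} with terms in
   K^{+,b} and K^{-,b}.  A truncated null-homotopic map is null-homotopic up to an
   error concentrated in one degree, so truncation is functorial modulo K^b and is
   adjoint there to the inclusions.

   For the other t-structure with injectives, maps from an acyclic complex to a
   bounded below complex are null-homotopic, and every X with bounded homology has
   a map v : X -> V with V in K^{+,b} and acyclic cone: V vanishes far to the left,
   where X is already exact, and continues by weak cokernels of
   X^n + V^{n-1} -> X^{n+1} + V^n in Inj A.  Exactness of a complex of injectives
   at a degree means that maps to injectives which kill one differential extend
   along the next, so that all of this takes place inside Inj A.

   Functors on K^{infty,b} which invert the maps with cone in K^b extend to the
   Verdier quotient along its presentation by generators and relations, and so do
   the units and counits; this yields the adjoints and full faithfulness without a
   calculus of fractions or the octahedral axiom.  That an object vanishing in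
   K^{+,b}/K^b comes from K^{-,b}, which the usual argument gets from roofs, is
   read off the category of complexes near an end of Z. *)
From Stdlib Require Import ZArith Lia Setoid Morphisms List ClassicalEpsilon Eqdep_dec.
Require Import Defs.

Set Implicit Arguments.
Unset Strict Implicit.
Unset Printing Implicit Defensive.
Open Scope cat_scope.

(** Morphisms of the quotients are formal words, which are never normalized or tested for zero
    directly: every statement about them comes from a functor defined before the quotient and shown
    to invert the right maps. Two obstacles shape the constructions. Truncation at a fixed degree
    does not commute with translation: the truncation of X[1] is the shift of X truncated one degree
    higher, so the comparison is invertible only modulo bounded complexes, and cones are preserved
    only after truncating their source differently. Moreover K^b consists of the complexes with
    bounded terms and need not be closed under direct summands or homotopy equivalence; a complex
    vanishing modulo K^b is shown only to be a retract of a bounded one, and this must suffice to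
    invert maps. The recollement glues two t-structures along their common term: one provides the
    reflection onto it, the other the coreflection, and the outer terms give j_! and j_* on the
    quotient. The part on truncations uses only a zero object, biproducts and the interface
    [exactness], and so serves injectives and projectives alike. *)

Section AbelianGroupReflection.
Variables (C : preadditive) (X Y : C).

(** * Deciding equations in the abelian groups of morphisms *)

Inductive gexp := GZero | GVar (n : nat) | GAdd (a b : gexp) | GOpp (a : gexp).

Fixpoint gden (env : list (hom X Y)) (e : gexp) : hom X Y :=
  match e with
  | GZero => 0
  | GVar n => nth n env 0
  | GAdd a b => gden env a + gden env b
  | GOpp a => - gden env a
  end.

Fixpoint gcoef (e : gexp) (i : nat) : Z :=
  match e with
  | GZero => 0%Z
  | GVar n => if Nat.eqb n i then 1%Z else 0%Z
  | GAdd a b => (gcoef a i + gcoef b i)%Z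
  | GOpp a => (- gcoef a i)%Z
  end.

Fixpoint nmul (n : nat) (f : hom X Y) : hom X Y :=
  match n with O => 0 | S n => f + nmul n f end.
Definition zmul (z : Z) (f : hom X Y) : hom X Y :=
  nmul (Z.to_nat z) f + - nmul (Z.to_nat (- z)) f.

Lemma nmul_add m n f : nmul (m + n)%nat f == nmul m f + nmul n f.
Proof.
  induction m as [| m IH]; simpl; [rewrite hadd_0l; reflexivity |].
  rewrite IH, hadd_assoc; reflexivity.
Qed.

Lemma sub_cross (a b c d : hom X Y) : a + d == c + b -> a + - b == c + - d.
Proof.
  intro H; apply (hadd_inj (h := d + b)); transitivity (a + d).
  - rewrite hadd_swap, (hadd_comm (- b)), hadd_opp; apply hadd_0.
  - rewrite (hadd_comm d b), hadd_swap, (hadd_comm (- d)), hadd_opp, hadd_0; exact H.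
Qed.

Lemma zmul_add a b f : zmul (a + b) f == zmul a f + zmul b f.
Proof.
  unfold zmul; rewrite hadd_swap, <- hopp_add.
  apply sub_cross; rewrite <- !nmul_add.
  match goal with |- nmul ?m _ == nmul ?n _ => replace m with n by lia end.
  reflexivity.
Qed.

Lemma zmul_0 f : zmul 0 f == 0.
Proof. unfold zmul; simpl; apply hadd_opp. Qed.

Fixpoint gsum (env : list (hom X Y)) (c : nat -> Z) : hom X Y :=
  match env with
  | nil => 0
  | f :: env => zmul (c O) f + gsum env (fun i => c (S i))
  end.

Lemma gsum_ext env c c' :
  (forall i, (i < length env)%nat -> c i = c' i) -> gsum env c = gsum env c'.
Proof.
  revert c c'; induction env as [| f env IH]; intros c c' H; simpl; [reflexivity |].
  rewrite (H O), (IH _ (fun i => c' (S i))); simpl; try lia; [reflexivity |].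
  intros i Hi; apply H; simpl; lia.
Qed.

Lemma gsum_0 env : gsum env (fun _ => 0%Z) == 0.
Proof.
  induction env as [| f env IH]; simpl; [reflexivity |].
  rewrite IH, zmul_0; apply hadd_0.
Qed.

Lemma gsum_add env c c' :
  gsum env (fun i => (c i + c' i)%Z) == gsum env c + gsum env c'.
Proof.
  revert c c'; induction env as [| f env IH]; intros c c'; simpl;
    [rewrite hadd_0; reflexivity |].
  rewrite (IH (fun i => c (S i))), zmul_add, hadd_swap; reflexivity.
Qed.

Lemma gsum_opp env c : gsum env (fun i => (- c i)%Z) == - gsum env c.
Proof.
  apply hopp_unique; rewrite <- gsum_add.
  rewrite (gsum_ext (c' := fun _ => 0%Z)); [apply gsum_0 | intros; lia].
Qed.

Lemma gsum_var env n : gsum env (gcoef (GVar n)) == nth n env 0.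
Proof.
  revert n; induction env as [| f env IH]; intros [| n]; simpl; try reflexivity.
  - rewrite gsum_0, hadd_0; unfold zmul; simpl; rewrite hopp_0, !hadd_0; reflexivity.
  - rewrite zmul_0, hadd_0l; apply IH.
Qed.

Lemma gden_gsum env e : gden env e == gsum env (gcoef e).
Proof.
  induction e as [| n | a IHa b IHb | a IHa].
  - symmetry; apply gsum_0.
  - symmetry; apply gsum_var.
  - simpl; rewrite gsum_add, IHa, IHb; reflexivity.
  - simpl; rewrite gsum_opp, IHa; reflexivity.
Qed.

(** Both sides equal the linear combination of the atoms with coefficients [gcoef]. The comparison
    of coefficients is boolean, so that [abel] discharges it by computation. *)
Lemma gexp_eq env e e' :
  forallb (fun i => Z.eqb (gcoef e i) (gcoef e' i)) (seq O (length env)) = true ->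
  gden env e == gden env e'.
Proof.
  intro H; rewrite !gden_gsum, (gsum_ext (c' := gcoef e')); [reflexivity |].
  intros i Hi; rewrite forallb_forall in H.
  apply Z.eqb_eq, H, in_seq; lia.
Qed.
End AbelianGroupReflection.

(** The [match constr:(Set)] wrappers run the test [constr_eq] inside a function that has to return
    a term; a failed test selects the next branch. *)
Ltac gindex x env :=
  lazymatch env with
  | cons ?y ?env' =>
      match constr:(Set) with
      | _ => let _ := match constr:(Set) with _ => constr_eq x y end in constr:(O)
      | _ => let n := gindex x env' in constr:(S n)
      end
  end.
Ltac gcollect env e :=
  lazymatch e with
  | hzero => env
  | hadd ?a ?b => let env1 := gcollect env a in gcollect env1 b
  | hopp ?a => gcollect env a
  | _ => match constr:(Set) with
         | _ => let n := gindex e env in env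
         | _ => constr:(cons e env)
         end
  end.
Ltac greify env e :=
  lazymatch e with
  | hzero => constr:(GZero)
  | hadd ?a ?b => let a' := greify env a in let b' := greify env b in
                  constr:(GAdd a' b')
  | hopp ?a => let a' := greify env a in constr:(GOpp a')
  | _ => let n := gindex e env in constr:(GVar n)
  end.
(* Decides equations between sums of atoms in the abelian group [hom X Y]. *)
Ltac abel :=
  lazymatch goal with
  | |- @heq ?C ?X ?Y ?a ?b =>
      let env0 := gcollect (@nil (@hom C X Y)) a in
      let env := gcollect env0 b in
      let a' := greify env a in let b' := greify env b in
      exact (@gexp_eq C X Y env a' b' eq_refl)
  end.

(** Combinators for the explicit proof terms that [expand] assembles along the syntax of a
    morphism. *)
Lemma expand_trans (C : preadditive) (X Y : C) (f g h : hom X Y) :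
  f == g -> g == h -> f == h.
Proof. intros E1 E2; rewrite E1; exact E2. Qed.
Lemma expand_goal (C : preadditive) (X Y : C) (f f' g g' : hom X Y) :
  f == f' -> g == g' -> f' == g' -> f == g.
Proof. intros E1 E2 E; rewrite E1, E2; exact E. Qed.
Lemma expand_hyp (C : preadditive) (X Y : C) (f f' g g' : hom X Y) :
  f == f' -> g == g' -> f == g -> f' == g'.
Proof. intros E1 E2 E; rewrite <- E1, <- E2; exact E. Qed.
Lemma expand_refl (C : preadditive) (X Y : C) (f : hom X Y) : f == f.
Proof. reflexivity. Qed.
Lemma expand_opp (C : preadditive) (X Y : C) (f g : hom X Y) : f == g -> - f == - g.
Proof. intro E; rewrite E; reflexivity. Qed.

(* [expand_comp g f] and [expand_opp_tac f] return a proof that [g o f], resp. [- f],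
   equals its expansion, for expanded [g] and [f]. *)
Ltac expand_opp_tac f :=
  lazymatch f with
  | hadd ?a ?b =>
      let pa := expand_opp_tac a in let pb := expand_opp_tac b in
      constr:(expand_trans (hopp_add a b) (hadd_heq pa pb))
  | hopp ?a => constr:(hopp_opp a)
  | @hzero ?C ?X ?Y => constr:(@hopp_0 C X Y)
  | _ => constr:(expand_refl (hopp f))
  end.
Ltac expand_comp g f :=
  lazymatch g with
  | hadd ?a ?b =>
      let pa := expand_comp a f in let pb := expand_comp b f in
      constr:(expand_trans (comp_hadd_l a b f) (hadd_heq pa pb))
  | hopp ?a =>
      let pa := expand_comp a f in
      lazymatch type of pa with
      | heq _ ?r => let pr := expand_opp_tac r in
          constr:(expand_trans (expand_trans (comp_opp_l a f) (expand_opp pa)) pr)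
      end
  | @hzero _ _ ?Z => constr:(comp_0l Z f)
  | idm _ => constr:(comp_id_l f)
  | _ =>
      lazymatch f with
      | hadd ?a ?b =>
          let pa := expand_comp g a in let pb := expand_comp g b in
          constr:(expand_trans (comp_hadd_r g a b) (hadd_heq pa pb))
      | hopp ?a =>
          let pa := expand_comp g a in
          lazymatch type of pa with
          | heq _ ?r => let pr := expand_opp_tac r in
              constr:(expand_trans (expand_trans (comp_opp_r g a) (expand_opp pa)) pr)
          end
      | @hzero _ ?X _ => constr:(comp_0r X g)
      | idm _ => constr:(comp_id_r g)
      | comp ?a ?b =>
          let pa := expand_comp g a in
          constr:(expand_trans (comp_assoc g a b) (comp_heq pa (expand_refl b)))
      | _ => constr:(expand_refl (comp g f))
      end
  end.
Ltac expand_rec e :=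
  lazymatch e with
  | hadd ?a ?b =>
      let pa := expand_rec a in let pb := expand_rec b in constr:(hadd_heq pa pb)
  | hopp ?a =>
      let pa := expand_rec a in
      lazymatch type of pa with
      | heq _ ?r => let pr := expand_opp_tac r in
          constr:(expand_trans (expand_opp pa) pr)
      end
  | comp ?a ?b =>
      let pa := expand_rec a in let pb := expand_rec b in
      lazymatch type of pa with
      | heq _ ?r =>
          lazymatch type of pb with
          | heq _ ?s => let pr := expand_comp r s in
              constr:(expand_trans (comp_heq pa pb) pr)
          end
      end
  | _ => constr:(expand_refl e)
  end.
(* Expands both sides into sums of composites associated to the left. *)
Ltac expand :=
  lazymatch goal with
  | |- heq ?a ?b =>
      let pa := expand_rec a in let pb := expand_rec b in
      refine (expand_goal pa pb _)
  end.

Ltac expand_in H :=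
  lazymatch type of H with
  | heq ?a ?b =>
      let pa := expand_rec a in let pb := expand_rec b in
      apply (expand_hyp pa pb) in H
  end.

Lemma rassoc (C : preadditive) (W X Y Z : C) (g : hom Y Z) (f : hom X Y) (k : hom X Z) :
  g o f == k -> forall h : hom Z W, (h o g) o f == h o k.
Proof. intros E h; rewrite <- comp_assoc, E; reflexivity. Qed.

(* Rewrites with [E : g o f == k] in a composite associated to the left. *)
Ltac crw E := first [rewrite E | rewrite (rassoc E)].

(** * Zero objects and isomorphisms *)

Lemma zero_id (C : preadditive) (Z : C) : idm Z == 0 -> is_zero Z.
Proof.
  intros H X; split; intro f.
  - rewrite <- (comp_id_l f), H; apply comp_0l.
  - rewrite <- (comp_id_r f), H; apply comp_0r.
Qed.

Lemma zero_to (C : preadditive) (X Z : C) (f : hom X Z) : is_zero Z -> f == 0.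
Proof. intro H; apply (proj1 (H X)). Qed.
Lemma zero_from (C : preadditive) (X Z : C) (f : hom Z X) : is_zero Z -> f == 0.
Proof. intro H; apply (proj2 (H X)). Qed.

Lemma is_iso_inv (C : preadditive) (X Y : C) (f : hom X Y) (g : hom Y X) :
  is_inverse f g -> is_iso g.
Proof. intros [H1 H2]; exists f; split; assumption. Qed.

Lemma is_iso_heq (C : preadditive) (X Y : C) (f g : hom X Y) :
  f == g -> is_iso f -> is_iso g.
Proof. intros E [k [H1 H2]]; exists k; split; rewrite <- E; assumption. Qed.

Lemma is_iso_opp (C : preadditive) (X Y : C) (f : hom X Y) : is_iso f -> is_iso (- f).
Proof.
  intros [g [H1 H2]]; exists (- g); split;
    rewrite comp_opp_l, comp_opp_r, hopp_opp; assumption.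
Qed.

Lemma is_iso_sides (C : preadditive) (X Y : C) (f : hom X Y) (g g' : hom Y X) :
  g o f == idm X -> f o g' == idm Y -> is_iso f.
Proof.
  intros H1 H2; exists g; split; [exact H1 |].
  rewrite <- H2; apply comp_heq; [reflexivity |].
  rewrite <- (comp_id_r g), <- H2, comp_assoc, H1; apply comp_id_l.
Qed.

Lemma iso_mono (C : preadditive) (X Y : C) (m : hom X Y) : is_iso m -> mono m.
Proof.
  intros [k [H _]] W g h E.
  rewrite <- (comp_id_l g), <- (comp_id_l h), <- H, <- !comp_assoc, E; reflexivity.
Qed.
Lemma iso_epi (C : preadditive) (X Y : C) (e : hom X Y) : is_iso e -> epi e.
Proof.
  intros [k [_ H]] W g h E.
  rewrite <- (comp_id_r g), <- (comp_id_r h), <- H, !comp_assoc, E; reflexivity.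
Qed.

Lemma zero_iso (C : preadditive) (X Y : C) : isomorphic X Y -> is_zero X -> is_zero Y.
Proof.
  intros [f [g [H1 H2]]] H; apply zero_id.
  rewrite <- H2, (zero_from f H); apply comp_0l.
Qed.

Lemma isomorphic_sym (C : preadditive) (X Y : C) : isomorphic X Y -> isomorphic Y X.
Proof. intros [f [g [H1 H2]]]; exists g, f; split; assumption. Qed.

Lemma isomorphic_trans (C : preadditive) (X Y Z : C) :
  isomorphic X Y -> isomorphic Y Z -> isomorphic X Z.
Proof.
  intros [f Hf] [g Hg]; exists (g o f); apply is_iso_comp; assumption.
Qed.

Lemma fmap_zero (C D : preadditive) (F : functor C D) (X : C) :
  is_zero X -> is_zero (F X).
Proof.
  intro H; apply zero_id.
  rewrite <- fmap_id, <- (fmap_0 F); apply fmap_heq, zero_to, H.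
Qed.

(** [is_iso] is a mere existence statement, whereas a functor on words must assign an actual inverse
    to each formal one; hence the choice. *)
Definition iso_inv (C : preadditive) (X Y : C) (f : hom X Y) (H : is_iso f) : hom Y X :=
  proj1_sig (constructive_indefinite_description _ H).
Lemma iso_inv_l (C : preadditive) (X Y : C) (f : hom X Y) (H : is_iso f) :
  iso_inv H o f == idm X.
Proof. exact (proj1 (proj2_sig (constructive_indefinite_description _ H))). Qed.
Lemma iso_inv_r (C : preadditive) (X Y : C) (f : hom X Y) (H : is_iso f) :
  f o iso_inv H == idm Y.
Proof. exact (proj2 (proj2_sig (constructive_indefinite_description _ H))). Qed.

Lemma tri_iso_sym (C : preadditive) (S : functor C C)
    (X Y Z : C) (f : hom X Y) (g : hom Y Z) (h : hom Z (S X))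
    (X' Y' Z' : C) (f' : hom X' Y') (g' : hom Y' Z') (h' : hom Z' (S X')) :
  tri_iso f g h f' g' h' -> tri_iso f' g' h' f g h.
Proof.
  intros (a & b & c & Ha & Hb & Hc & E1 & E2 & E3).
  exists (iso_inv Ha), (iso_inv Hb), (iso_inv Hc).
  do 3 (split; [eapply is_iso_inv; split; [apply iso_inv_l | apply iso_inv_r] |]).
  split; [| split].
  - apply (iso_mono Hb); rewrite !comp_assoc, iso_inv_r, E1, <- comp_assoc, iso_inv_r.
    expand; reflexivity.
  - apply (iso_mono Hc); rewrite !comp_assoc, iso_inv_r, E2, <- comp_assoc, iso_inv_r.
    expand; reflexivity.
  - apply (iso_mono (fmap_iso S Ha)).
    rewrite !comp_assoc, <- fmap_comp, iso_inv_r, E3, <- comp_assoc, iso_inv_r, fmap_id.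
    expand; reflexivity.
Qed.

(** * Adjunctions with a fully faithful adjoint *)

Section Coreflection.
Variables (C D : preadditive) (F : functor C D) (G : functor D C).
Variable eps : forall X : D, hom (F (G X)) X.
Variable mu : forall A : C, hom (G (F A)) A.
Hypothesis eps_nat : forall (X Y : D) (f : hom X Y),
  f o eps X == eps Y o fmap F (fmap G f).
Hypothesis mu_nat : forall (A B : C) (f : hom A B),
  f o mu A == mu B o fmap G (fmap F f).
Hypothesis mu_iso : forall A, is_iso (mu A).
Hypothesis F_mu : forall A, fmap F (mu A) == eps (F A).
Hypothesis G_eps : forall X, fmap G (eps X) == mu (G X).

Lemma coreflection_unit_nat (A B : C) (f : hom A B) :
  fmap G (fmap F f) o iso_inv (mu_iso A) == iso_inv (mu_iso B) o f.
Proof.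
  apply (iso_mono (mu_iso B)).
  rewrite !comp_assoc, <- mu_nat, iso_inv_r, <- comp_assoc, iso_inv_r.
  rewrite comp_id_l; apply comp_id_r.
Qed.

Lemma coreflection_counit_unit (A : C) :
  eps (F A) o fmap F (iso_inv (mu_iso A)) == idm (F A).
Proof. rewrite <- F_mu, <- fmap_comp, iso_inv_r; apply fmap_id. Qed.

(** The unit is the inverse of [mu]; [F_mu] and [G_eps] then turn into the two triangle
    identities. *)
Definition coreflection_adjunction : adjunction F G.
Proof.
  refine {| adj X Y f := fmap G f o iso_inv (mu_iso X);
            adj_inv X Y g := eps Y o fmap F g |}.
  - intros X Y f g E; rewrite E; reflexivity.
  - intros X Y f g E; rewrite E; reflexivity.
  - intros X Y f; rewrite fmap_comp, comp_assoc, <- eps_nat, <- comp_assoc.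
    rewrite coreflection_counit_unit; apply comp_id_r.
  - intros X Y f.
    rewrite fmap_comp, <- comp_assoc, coreflection_unit_nat, comp_assoc, G_eps.
    rewrite iso_inv_r; apply comp_id_l.
  - intros X X' Y Y' a f b.
    rewrite !fmap_comp, <- !comp_assoc, coreflection_unit_nat; reflexivity.
Defined.

Lemma coreflection_ff : fully_faithful F.
Proof.
  split.
  - intros X Y h; exists (mu Y o fmap G h o iso_inv (mu_iso X)).
    rewrite !fmap_comp, F_mu, <- eps_nat, <- comp_assoc, coreflection_counit_unit.
    apply comp_id_r.
  - intros X Y f g E; apply (iso_epi (mu_iso X)).
    rewrite !mu_nat, E; reflexivity.
Qed.
End Coreflection.

Section Reflection.
Variables (C D : preadditive) (F : functor D C) (G : functor C D).
Variable eta : forall X : D, hom X (G (F X)).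
Variable lam : forall A : C, hom A (F (G A)).
Hypothesis eta_nat : forall (X Y : D) (f : hom X Y),
  eta Y o f == fmap G (fmap F f) o eta X.
Hypothesis lam_nat : forall (A B : C) (f : hom A B),
  lam B o f == fmap F (fmap G f) o lam A.
Hypothesis lam_iso : forall A, is_iso (lam A).
Hypothesis G_lam : forall A, fmap G (lam A) == eta (G A).
Hypothesis F_eta : forall X, fmap F (eta X) == lam (F X).

Lemma reflection_counit_nat (A B : C) (f : hom A B) :
  iso_inv (lam_iso B) o fmap F (fmap G f) == f o iso_inv (lam_iso A).
Proof.
  apply (iso_epi (lam_iso A)).
  rewrite <- !comp_assoc, <- lam_nat, iso_inv_l, comp_assoc, iso_inv_l.
  rewrite comp_id_r; apply comp_id_l.
Qed.

Lemma reflection_counit_unit (A : C) :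
  fmap G (iso_inv (lam_iso A)) o eta (G A) == idm (G A).
Proof. rewrite <- G_lam, <- fmap_comp, iso_inv_l; apply fmap_id. Qed.

Definition reflection_adjunction : adjunction F G.
Proof.
  refine {| adj X Y f := fmap G f o eta X;
            adj_inv X Y g := iso_inv (lam_iso Y) o fmap F g |}.
  - intros X Y f g E; rewrite E; reflexivity.
  - intros X Y f g E; rewrite E; reflexivity.
  - intros X Y f.
    rewrite fmap_comp, comp_assoc, reflection_counit_nat, <- comp_assoc, F_eta.
    rewrite iso_inv_l; apply comp_id_r.
  - intros X Y f; rewrite fmap_comp, <- comp_assoc, <- eta_nat, comp_assoc.
    rewrite reflection_counit_unit; apply comp_id_l.
  - intros X X' Y Y' a f b.
    rewrite !fmap_comp, <- !comp_assoc, <- eta_nat; reflexivity.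
Defined.

Lemma reflection_ff : fully_faithful G.
Proof.
  split.
  - intros X Y h; exists (iso_inv (lam_iso Y) o fmap F h o lam X).
    rewrite !fmap_comp, G_lam, <- comp_assoc, <- eta_nat, comp_assoc.
    rewrite reflection_counit_unit; apply comp_id_l.
  - intros X Y f g E; apply (iso_mono (lam_iso Y)).
    rewrite !lam_nat, E; reflexivity.
Qed.
End Reflection.

Definition fid (C : preadditive) : functor C C.
Proof.
  refine {| fob X := X; fmap X Y f := f |}; intros; try assumption; reflexivity.
Defined.

Definition tcomp (D E F : tricat) (G : tri_functor E F) (H : tri_functor D E) :
  tri_functor D F.
Proof.
  refine {| tfun := fcomp G H;
            tfun_shift X := tfun_shift G (H X) o fmap G (tfun_shift H X) |}.
  - intro X; apply is_iso_comp; [apply tfun_shift_iso | apply fmap_iso, tfun_shift_iso].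
  - intros X Y f; cbn.
    rewrite <- comp_assoc, <- fmap_comp, tfun_shift_nat, fmap_comp, comp_assoc.
    rewrite tfun_shift_nat, comp_assoc; reflexivity.
  - intros X Y Z f g h T; cbn.
    refine (tri_closed _ (tfun_tri G (tfun_tri H T))).
    apply tri_iso_heq; try reflexivity.
    rewrite fmap_comp, comp_assoc; reflexivity.
Defined.

Definition vproj_tri (D : tricat) (N : tsub D) : tri_functor D (verdier N).
Proof.
  refine (@TriFunctor D (verdier N) (vproj N) (fun X => @idm (verdier N) _) _ _ _).
  - intro X; apply (is_iso_id (C := verdier N)).
  - intros X Y f.
    etransitivity; [apply (comp_id_l (p := verdier N)) |].
    symmetry; apply (comp_id_r (p := verdier N)).
  - intros X Y Z f g h T; exists X, Y, Z, f, g, h; split; [exact T |].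
    apply tri_iso_heq; try reflexivity.
    apply (comp_id_l (p := verdier N)).
Defined.

(** * Triangulated categories *)

(* Verdier's axioms without the octahedral axiom. *)
Record pretriangulated (D : tricat) : Prop := {
  pt_zero : exists Z : D, is_zero Z;
  pt_full : full (@shift D);
  pt_faithful : faithful (@shift D);
  pt_surj : forall X : D, exists X' : D, isomorphic (shift X') X;
  pt_triv : forall Z W : D, is_zero Z ->
    tri (0 : hom Z W) (idm W) (0 : hom W (shift Z));
  pt_cone : forall (X Y : D) (f : hom X Y), exists (Z : D) (g : hom Y Z)
    (h : hom Z (shift X)), tri f g h;
  pt_rot : forall (X Y Z : D) (f : hom X Y) (g : hom Y Z) (h : hom Z (shift X)),
    tri f g h -> tri g h (- fmap shift f);
  pt_fill : forall (X Y Z : D) (f : hom X Y) (g : hom Y Z) (h : hom Z (shift X))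
      (X' Y' Z' : D) (f' : hom X' Y') (g' : hom Y' Z') (h' : hom Z' (shift X'))
      (a : hom X X') (b : hom Y Y'),
    tri f g h -> tri f' g' h' -> b o f == f' o a ->
    exists c : hom Z Z', c o g == g' o b /\ fmap shift a o h == h' o c
}.

Lemma full_faithful_iso (C D : preadditive) (F : functor C D) (X Y : C) (f : hom X Y) :
  full F -> faithful F -> is_iso (fmap F f) -> is_iso f.
Proof.
  intros HF HF' [g [H1 H2]]; destruct (HF _ _ g) as [g' E].
  exists g'; split; apply HF'; rewrite fmap_comp, E, fmap_id; assumption.
Qed.

Section Pretriangulated.
Variable D : tricat.
Hypothesis PT : pretriangulated D.
Implicit Types X Y Z W : D.

Lemma tri_id X : exists (Z : D) (g : hom X Z) (h : hom Z (shift X)),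
  is_zero Z /\ tri (idm X) g h.
Proof.
  destruct (pt_zero PT) as [Z HZ]; exists (shift Z), 0, (- fmap shift 0).
  split; [apply fmap_zero, HZ | apply (pt_rot PT), (pt_triv PT), HZ].
Qed.

(** The triangle on the identity of [X] maps to the given one by the identity and [f], and its third
    term is zero. *)
Lemma tri_comp0 X Y Z (f : hom X Y) (g : hom Y Z) (h : hom Z (shift X)) :
  tri f g h -> g o f == 0.
Proof.
  intro T; destruct (tri_id X) as (O & g0 & h0 & HO & T0).
  destruct (pt_fill PT (a := idm X) (b := f) T0 T) as (c & E & _); [reflexivity |].
  rewrite <- E, (zero_from c HO); apply comp_0l.
Qed.

Lemma tri_comp0' X Y Z (f : hom X Y) (g : hom Y Z) (h : hom Z (shift X)) :
  tri f g h -> h o g == 0.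
Proof. intro T; exact (tri_comp0 (pt_rot PT T)). Qed.

Lemma tri_comp0'' X Y Z (f : hom X Y) (g : hom Y Z) (h : hom Z (shift X)) :
  tri f g h -> fmap shift f o h == 0.
Proof.
  intro T; rewrite <- (hopp_opp (_ o _)), <- comp_opp_l.
  rewrite (tri_comp0' (pt_rot PT T)); apply hopp_0.
Qed.

Lemma tri_weak_coker X Y Z (f : hom X Y) (g : hom Y Z) (h : hom Z (shift X))
    W (t : hom Y W) :
  tri f g h -> t o f == 0 -> exists t' : hom Z W, t' o g == t.
Proof.
  intros T E; destruct (pt_zero PT) as [O HO].
  destruct (pt_fill PT (a := 0) (b := t) T (pt_triv PT W HO)) as (c & E1 & _).
  { rewrite E, comp_0r; reflexivity. }
  exists c; rewrite E1; apply comp_id_l.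
Qed.

Lemma tri_weak_coker' X Y Z (f : hom X Y) (g : hom Y Z) (h : hom Z (shift X))
    W (t : hom Z W) :
  tri f g h -> t o g == 0 -> exists t' : hom (shift X) W, t' o h == t.
Proof. intros T; exact (tri_weak_coker (pt_rot PT T)). Qed.

Lemma tri_weak_coker'' X Y Z (f : hom X Y) (g : hom Y Z) (h : hom Z (shift X))
    W (t : hom (shift X) W) :
  tri f g h -> t o h == 0 -> exists t' : hom (shift Y) W, t' o fmap shift f == t.
Proof.
  intros T E; destruct (tri_weak_coker' (pt_rot PT T) E) as [t' E'].
  exists (- t'); rewrite comp_opp_l, <- comp_opp_r; exact E'.
Qed.

(** Fillers exist only on the third term, so both triangles are rotated; the filler obtained is a
    map between translates and descends because the translation is full and faithful. *)
Lemma tri_weak_ker X Y Z (f : hom X Y) (g : hom Y Z) (h : hom Z (shift X))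
    W (t : hom W Y) :
  tri f g h -> g o t == 0 -> exists t' : hom W X, f o t' == t.
Proof.
  intros T E; destruct (tri_id W) as (O & g0 & h0 & HO & T0).
  destruct (pt_fill PT (a := t) (b := 0 : hom O Z) (pt_rot PT T0) (pt_rot PT T))
    as (c & _ & E2).
  { rewrite E; apply comp_0l. }
  destruct (pt_full PT c) as [t' Et]; exists t'; apply (pt_faithful PT).
  apply (iso_mono (is_iso_opp (is_iso_id _))).
  rewrite !comp_opp_l, !comp_id_l, fmap_comp, Et, <- comp_opp_l, <- E2.
  rewrite fmap_id, comp_opp_r, comp_id_r; reflexivity.
Qed.

Lemma tri_weak_ker' X Y Z (f : hom X Y) (g : hom Y Z) (h : hom Z (shift X))
    W (t : hom W Z) :
  tri f g h -> h o t == 0 -> exists t' : hom W Y, g o t' == t.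
Proof. intros T; exact (tri_weak_ker (pt_rot PT T)). Qed.

Lemma tri_weak_ker'' X Y Z (f : hom X Y) (g : hom Y Z) (h : hom Z (shift X))
    W (t : hom W (shift X)) :
  tri f g h -> fmap shift f o t == 0 -> exists t' : hom W Z, h o t' == t.
Proof.
  intros T E; apply (tri_weak_ker' (pt_rot PT T)).
  rewrite comp_opp_l, E; apply hopp_0.
Qed.

(* The difference [d - idm Z] factors as [Z -> shift X -> Z] through [h] and is
   killed by [h], hence has square zero. *)
Lemma tri_endo_iso X Y Z (f : hom X Y) (g : hom Y Z) (h : hom Z (shift X)) (d : hom Z Z) :
  tri f g h -> d o g == g -> h o d == h -> is_iso d.
Proof.
  intros T E1 E2.
  destruct (tri_weak_coker' (t := d + - idm Z) T) as [n En].
  { rewrite comp_hadd_l, E1, comp_opp_l, comp_id_l; apply hadd_opp. }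
  assert (N : (d + - idm Z) o (d + - idm Z) == 0).
  { rewrite <- En at 1; rewrite <- comp_assoc, comp_hadd_r, E2, comp_opp_r, comp_id_r.
    rewrite hadd_opp; apply comp_0r. }
  assert (N' : d o d == d + d + - idm Z).
  { expand_in N.
    apply (hadd_inj (h := - d + - (d + - idm Z))).
    transitivity (0 : hom Z Z); [rewrite <- N |]; abel. }
  (* With [d = 1 + n] and [n] of square zero, the inverse [1 - n] is [2 - d]. *)
  exists (idm Z + idm Z + - d); split; expand; rewrite N'; abel.
Qed.

(** A filler [d] for the inverse square need not be inverse to [c], but [d o c] and [c o d] are
    compatible with identities on the other two terms, hence invertible by [tri_endo_iso]. *)
Lemma tri_map_iso X Y Z (f : hom X Y) (g : hom Y Z) (h : hom Z (shift X))
    X' Y' Z' (f' : hom X' Y') (g' : hom Y' Z') (h' : hom Z' (shift X'))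
    (a : hom X X') (b : hom Y Y') (c : hom Z Z') :
  tri f g h -> tri f' g' h' -> b o f == f' o a -> c o g == g' o b ->
  fmap shift a o h == h' o c -> is_iso a -> is_iso b -> is_iso c.
Proof.
  intros T T' E1 E2 E3 [a' [Ha Ha']] [b' [Hb Hb']].
  destruct (pt_fill PT (a := a') (b := b') T' T) as (d & E4 & E5).
  { apply (iso_epi (e := a)); [exists a'; split; assumption |].
    rewrite <- !comp_assoc, Ha, <- E1, comp_assoc, Hb, comp_id_l, comp_id_r; reflexivity. }
  assert (H1 : is_iso (d o c)).
  { apply (tri_endo_iso T).
    - rewrite <- comp_assoc, E2, comp_assoc, E4, <- comp_assoc, Hb; apply comp_id_r.
    - rewrite comp_assoc, <- E5, <- comp_assoc, <- E3, comp_assoc, <- fmap_comp, Ha.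
      rewrite fmap_id; apply comp_id_l. }
  assert (H2 : is_iso (c o d)).
  { apply (tri_endo_iso T').
    - rewrite <- comp_assoc, E4, comp_assoc, E2, <- comp_assoc, Hb'; apply comp_id_r.
    - rewrite comp_assoc, <- E3, <- comp_assoc, <- E5, comp_assoc, <- fmap_comp, Ha'.
      rewrite fmap_id; apply comp_id_l. }
  destruct H1 as [u [U1 _]], H2 as [v [_ V2]].
  apply (is_iso_sides (g := u o d) (g' := d o v)).
  - rewrite <- comp_assoc; exact U1.
  - rewrite comp_assoc; exact V2.
Qed.

Lemma tri_unique X Y Z Z' (f : hom X Y) (g : hom Y Z) (h : hom Z (shift X))
    (g' : hom Y Z') (h' : hom Z' (shift X)) :
  tri f g h -> tri f g' h' -> exists c : hom Z Z', is_iso c /\ c o g == g' /\ h == h' o c.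
Proof.
  intros T T'.
  destruct (pt_fill PT (a := idm X) (b := idm Y) T T') as (c & E1 & E2).
  { rewrite comp_id_l, comp_id_r; reflexivity. }
  exists c; split; [| split].
  - refine (tri_map_iso T T' _ E1 E2 (is_iso_id _) (is_iso_id _)).
    rewrite comp_id_l, comp_id_r; reflexivity.
  - rewrite E1; apply comp_id_r.
  - rewrite <- E2, fmap_id, comp_id_l; reflexivity.
Qed.

Lemma tri_zero_iso X Y Z (f : hom X Y) (g : hom Y Z) (h : hom Z (shift X)) :
  tri f g h -> is_zero Z -> is_iso f.
Proof.
  intros T HZ.
  destruct (tri_weak_ker (t := idm Y) T) as [r Er].
  { apply zero_to, HZ. }
  exists r; split; [| exact Er].
  destruct (tri_weak_ker'' (t := fmap shift (r o f + - idm X)) T) as [t Et].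
  { rewrite <- fmap_comp, comp_hadd_r, comp_assoc, Er, comp_opp_r, comp_id_l, comp_id_r.
    rewrite hadd_opp; apply fmap_0. }
  assert (E : r o f + - idm X == 0).
  { apply (pt_faithful PT); rewrite <- Et, (zero_to t HZ), comp_0r, fmap_0; reflexivity. }
  apply (hadd_inj (h := - idm X)); rewrite E, hadd_opp; reflexivity.
Qed.

(** Rotation is given in one direction only. To undo it, a desuspension [w] of [- (h o e)] is
    completed to a triangle; after rotations this shares its first map with the rotated given
    triangle, and the comparison of third terms descends along the translation. *)
Lemma tri_unrot X Y Z (f : hom X Y) (g : hom Y Z) (h : hom Z (shift X)) Z'
    (e : hom (shift Z') Z) (e' : hom Z (shift Z')) :
  tri f g h -> is_inverse e e' -> exists w : hom Z' X,
    fmap shift w == - (h o e) /\ tri w f (e' o g).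
Proof.
  intros T [H1 H2].
  assert (T' : tri f (e' o g) (h o e)).
  { refine (tri_closed _ T).
    exists (idm X), (idm Y), e.
    do 2 (split; [apply is_iso_id |]).
    split; [exists e'; split; assumption |].
    rewrite comp_assoc, H2, fmap_id, !comp_id_l, !comp_id_r.
    repeat split; reflexivity. }
  destruct (pt_full PT (- (h o e))) as [w Ew].
  exists w; split; [exact Ew |].
  destruct (pt_cone PT w) as (C & a & b & TC).
  pose proof (pt_rot PT (pt_rot PT TC)) as TC2.
  assert (T2 : tri b (h o e) (- fmap shift a)).
  { refine (tri_closed _ TC2); apply tri_iso_heq; try reflexivity.
    rewrite Ew; symmetry; apply hopp_opp. }
  destruct (tri_unique (pt_rot PT T2) (pt_rot PT (pt_rot PT T'))) as (c & Hc & E1 & E2).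
  destruct (pt_full PT c) as [k Ek].
  assert (Hk : is_iso k).
  { apply (full_faithful_iso (pt_full PT) (pt_faithful PT)).
    exact (is_iso_heq (symmetry Ek) Hc). }
  assert (K1 : k o a == f).
  { apply (pt_faithful PT); rewrite fmap_comp, Ek.
    rewrite <- (hopp_opp (fmap shift f)), <- E1, comp_opp_r, hopp_opp; reflexivity. }
  assert (K2 : b == (e' o g) o k).
  { apply (pt_faithful PT); rewrite fmap_comp, Ek.
    rewrite <- (hopp_opp (fmap shift b)), E2, comp_opp_l, hopp_opp; reflexivity. }
  refine (tri_closed (tri_iso_sym _) TC).
  exists (idm _), (idm _), k.
  do 2 (split; [apply is_iso_id |]); split; [exact Hk |].
  rewrite fmap_id, !comp_id_l, !comp_id_r, K1, <- K2.
  repeat split; reflexivity.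
Qed.

Lemma pt_fill_mid X Y Z (f : hom X Y) (g : hom Y Z) (h : hom Z (shift X))
    X' Y' Z' (f' : hom X' Y') (g' : hom Y' Z') (h' : hom Z' (shift X'))
    (a : hom X X') (c : hom Z Z') :
  tri f g h -> tri f' g' h' -> fmap shift a o h == h' o c ->
  exists b : hom Y Y', b o f == f' o a /\ c o g == g' o b.
Proof.
  intros T T' E.
  destruct (pt_fill PT (a := c) (b := fmap shift a) (pt_rot PT (pt_rot PT T))
    (pt_rot PT (pt_rot PT T'))) as (k & E1 & E2); [exact E |].
  destruct (pt_full PT k) as [b Eb]; exists b; split; apply (pt_faithful PT);
    rewrite !fmap_comp, Eb.
  - rewrite <- (hopp_opp (k o _)), <- comp_opp_r, E1, comp_opp_l; apply hopp_opp.
  - rewrite <- (hopp_opp (_ o k)), <- comp_opp_l, <- E2, comp_opp_r, hopp_opp.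
    reflexivity.
Qed.

Lemma tri_mid_endo_iso X Y Z (f : hom X Y) (g : hom Y Z) (h : hom Z (shift X))
    (d : hom Y Y) :
  tri f g h -> d o f == f -> g o d == g -> is_iso d.
Proof.
  intros T E1 E2; apply (full_faithful_iso (pt_full PT) (pt_faithful PT)).
  apply (tri_endo_iso (pt_rot PT (pt_rot PT T))).
  - rewrite comp_opp_r, <- fmap_comp, E1; reflexivity.
  - rewrite comp_opp_l, <- fmap_comp, E2; reflexivity.
Qed.

Lemma tri_cocone X Y (g : hom X Y) : exists (U : D) (f : hom U X) (h : hom Y (shift U)),
  tri f g h.
Proof.
  destruct (pt_cone PT g) as (C & a & b & T).
  destruct (pt_surj PT C) as (U & e & e' & He).
  destruct (tri_unrot T He) as (w & _ & T').
  exists U, w, (e' o a); exact T'.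
Qed.

Lemma tri_third X Z (h : hom Z (shift X)) : exists (Y : D) (f : hom X Y) (g : hom Y Z),
  tri f g h.
Proof.
  destruct (tri_cocone h) as (Y & g & k & T).
  destruct (tri_unrot (e := idm _) (e' := idm _) T) as (f & _ & T').
  { split; apply comp_id_l. }
  exists Y, f, g; refine (tri_closed _ T').
  apply tri_iso_heq; try reflexivity; symmetry; apply comp_id_l.
Qed.

End Pretriangulated.

Section QuotientIso.
Variables (D : tricat) (PT : pretriangulated D) (N : tsub D).

Definition retract_of (C : preadditive) (X Y : C) :=
  exists (i : hom X Y) (p : hom Y X), p o i == idm X.

Lemma vproj_iso (X Y : D) (s : hom X Y) :
  cone_in N s -> is_iso (fmap (vproj N) s).
Proof. intro H; exists (vinv H); exact (vinv_inverse H). Qed.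

Lemma vproj_zero (X : D) : N X -> is_zero (vproj N X).
Proof.
  intro HX; destruct (pt_zero PT) as [O HO].
  apply (zero_iso (X := vproj N O)); [| apply fmap_zero, HO].
  exists (fmap (vproj N) (0 : hom O X)); apply vproj_iso.
  exists X, (idm X), 0; split; [apply (pt_triv PT), HO | exact HX].
Qed.

(* The cone is not assumed to lie in [N], as [N] need not be closed under direct
   summands. *)
Lemma vproj_iso_retract (X Y Z M : D) (f : hom X Y) (g : hom Y Z) (h : hom Z (shift X)) :
  tri f g h -> N M -> retract_of Z M -> is_iso (fmap (vproj N) f).
Proof.
  intros T HM (p & r & E).
  (* The triangle over [h o r] has third term [M], so [f1] becomes invertible. The lifts [x] and
     [x'] of [p] and [r] make [Y] a retract of [Y'] under [X], up to the automorphism [x' o x]. *)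
  destruct (tri_third PT (h o r)) as (Y' & f1 & g1 & T1).
  destruct (pt_fill_mid PT (a := idm X) (c := p) T T1) as (x & X1 & X2).
  { rewrite fmap_id, comp_id_l, <- comp_assoc, E; symmetry; apply comp_id_r. }
  destruct (pt_fill_mid PT (a := idm X) (c := r) T1 T) as (x' & X1' & X2').
  { rewrite fmap_id, comp_id_l; reflexivity. }
  rewrite comp_id_r in X1, X1'.
  assert (H : is_iso (x' o x)).
  { apply (tri_mid_endo_iso PT T).
    - rewrite <- comp_assoc, X1; exact X1'.
    - rewrite comp_assoc, <- X2', <- comp_assoc, <- X2, comp_assoc, E; apply comp_id_l. }
  destruct H as [u [_ U]].
  pose (F := vproj N).
  assert (H1 : is_iso (fmap F f1)) by (apply vproj_iso; exists M, g1, (h o r); auto).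
  destruct H1 as [v [V1 V2]].
  apply (is_iso_sides (g := v o fmap F x) (g' := v o fmap F x o fmap F u)); fold F.
  - rewrite <- comp_assoc, <- fmap_comp, X1; exact V1.
  - rewrite <- X1' at 1; rewrite fmap_comp; expand.
    rewrite <- (comp_assoc _ _ v), V2, comp_id_r, <- !fmap_comp, U; apply fmap_id.
Qed.
End QuotientIso.

Lemma pretriangulated_sub (D : tricat) (P : tsub D) :
  pretriangulated D ->
  (exists Z : D, is_zero Z /\ P Z) ->
  (forall X : D, P X -> exists X' : D, P X' /\ isomorphic (shift X') X) ->
  (forall (X Y : D) (f : hom X Y), P X -> P Y ->
     exists (Z : D) (g : hom Y Z) (h : hom Z (shift X)), P Z /\ tri f g h) ->
  pretriangulated (sub_tricat P).
Proof.
  intros PT (O & HO & PO) HS HC; split.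
  - exists (exist _ O PO); apply zero_id; exact (zero_to (idm O) HO).
  - intros X Y h; exact (pt_full PT h).
  - intros X Y f g; exact (@pt_faithful _ PT (proj1_sig X) (proj1_sig Y) f g).
  - intros [X HX]; destruct (HS X HX) as (X' & HX' & HI).
    exists (exist _ X' HX'); exact HI.
  - intros Z W HZ; apply (pt_triv PT (Z := proj1_sig Z) (proj1_sig W)).
    apply zero_id; exact (zero_to (idm Z) HZ).
  - intros [X HX] [Y HY] f; destruct (HC X Y f HX HY) as (Z & g & h & HZ & T).
    exists (exist _ Z HZ), g, h; exact T.
  - intros X Y Z f g h; exact (@pt_rot _ PT _ _ _ f g h).
  - intros X Y Z f g h X' Y' Z' f' g' h' a b; exact (@pt_fill _ PT _ _ _ f g h _ _ _ f' g' h' a b).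
Qed.

(** * Universal property of the Verdier quotient *)

Section VerdierExtension.
Variables (D : tricat) (N : tsub D).

Section Functor.
Variables (C : preadditive) (F : functor D C).
Hypothesis F_inv : forall (X Y : D) (s : hom X Y), cone_in N s -> is_iso (fmap F s).

Fixpoint vext_hom (X Y : D) (f : vhom N X Y) : hom (F X) (F Y) :=
  match f in vhom _ X Y return hom (F X) (F Y) with
  | vincl _ f => fmap F f
  | vinv Hs => iso_inv (F_inv Hs)
  | vcomp g f => vext_hom g o vext_hom f
  | vadd f g => vext_hom f + vext_hom g
  | vopp f => - vext_hom f
  end.

Lemma vext_heq (X Y : D) (f g : vhom N X Y) : veq f g -> vext_hom f == vext_hom g.
Proof.
  induction 1; simpl.
  - reflexivity.
  - symmetry; assumption.
  - etransitivity; eassumption.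
  - apply comp_heq; assumption.
  - apply hadd_heq; assumption.
  - rewrite fmap_id; apply comp_id_l.
  - rewrite fmap_id; apply comp_id_r.
  - apply comp_assoc.
  - apply hadd_assoc.
  - apply hadd_comm.
  - rewrite fmap_0; apply hadd_0.
  - rewrite fmap_0; apply hadd_opp.
  - apply comp_hadd_l.
  - apply comp_hadd_r.
  - apply fmap_heq; assumption.
  - apply fmap_comp.
  - apply fmap_add.
  - rewrite fmap_id; apply iso_inv_l.
  - rewrite fmap_id; apply iso_inv_r.
Qed.

Definition vext_functor : functor (vcat N) C.
Proof.
  refine {| fob := fun X : vcat N => F X; fmap := vext_hom |}.
  - exact vext_heq.
  - intro X; apply fmap_id.
  - reflexivity.
  - reflexivity.
Defined.
End Functor.

Section TriFunctor.
Variables (C : tricat) (F : tri_functor D C).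
Hypothesis F_inv : forall (X Y : D) (s : hom X Y), cone_in N s -> is_iso (fmap F s).

Definition vext : tri_functor (verdier N) C.
Proof.
  refine (@TriFunctor (verdier N) C (vext_functor F_inv) (tfun_shift F)
            (tfun_shift_iso F) _ _).
  - refine (@vcat_nat D N C (fcomp (vext_functor F_inv) (@shift (verdier N)))
              (fcomp (@shift C) (vext_functor F_inv)) (tfun_shift F) _).
    exact (@tfun_shift_nat _ _ F).
  - intros X Y Z f g h (X' & Y' & Z' & f' & g' & h' & T & HI).
    refine (tri_closed _ (tfun_tri F T)).
    refine (tri_iso_map (S := @shift (verdier N)) (T := @shift C)
              (F := vext_functor F_inv) (th := tfun_shift F) _ HI).
    refine (@vcat_nat D N C (fcomp (vext_functor F_inv) (@shift (verdier N)))
              (fcomp (@shift C) (vext_functor F_inv)) (tfun_shift F) _).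
    exact (@tfun_shift_nat _ _ F).
Defined.
End TriFunctor.
End VerdierExtension.

(** * Adjoints of triangle functors *)

Section Adjoints.
Variables (D E : tricat) (PD : pretriangulated D) (PE : pretriangulated E).
Variable G : tri_functor E D.

Definition tfun_unshift (A : E) : hom (shift (G A)) (G (shift A)) :=
  iso_inv (tfun_shift_iso G A).

Lemma tfun_unshift_l A : tfun_unshift A o tfun_shift G A == idm _.
Proof. apply iso_inv_l. Qed.
Lemma tfun_unshift_r A : tfun_shift G A o tfun_unshift A == idm _.
Proof. apply iso_inv_r. Qed.

Lemma tfun_unshift_nat (A B : E) (f : hom A B) :
  fmap G (fmap shift f) o tfun_unshift A == tfun_unshift B o fmap shift (fmap G f).
Proof.
  apply (iso_mono (tfun_shift_iso G B)).
  rewrite !comp_assoc, tfun_shift_nat, tfun_unshift_r, <- comp_assoc, tfun_unshift_r.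
  expand; reflexivity.
Qed.

Section LeftAdjoint.
Variables (R : D -> E) (eta : forall X : D, hom X (G (R X))).
Hypothesis R_ex : forall (X : D) (T : E) (t : hom X (G T)),
  exists t' : hom (R X) T, fmap G t' o eta X == t.
Hypothesis R_uniq : forall (X : D) (T : E) (s t : hom (R X) T),
  fmap G s o eta X == fmap G t o eta X -> s == t.

Definition lind (X : D) (T : E) (t : hom X (G T)) : hom (R X) T :=
  proj1_sig (constructive_indefinite_description _ (R_ex t)).
Lemma lindE (X : D) (T : E) (t : hom X (G T)) : fmap G (lind t) o eta X == t.
Proof. exact (proj2_sig (constructive_indefinite_description _ (R_ex t))). Qed.

Definition ladj_functor : functor D E.
Proof.
  refine {| fob := R; fmap X Y f := lind (eta Y o f) |}.
  - intros X Y f g H; apply R_uniq; rewrite !lindE, H; reflexivity.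
  - intro X; apply R_uniq; rewrite lindE, fmap_id, comp_id_l; apply comp_id_r.
  - intros X Y Z g f; apply R_uniq.
    rewrite lindE, fmap_comp, <- comp_assoc, lindE, !comp_assoc, lindE; reflexivity.
  - intros X Y f g; apply R_uniq.
    rewrite lindE, fmap_add, comp_hadd_l, !lindE; apply comp_hadd_r.
Defined.

Lemma ladj_eta (X Y : D) (f : hom X Y) :
  fmap G (fmap ladj_functor f) o eta X == eta Y o f.
Proof. apply lindE. Qed.

(** It makes [shift (R X)] universal for maps from [shift X] into the image of [G], hence comparable
    with [R (shift X)]. *)
Let Eta (X : D) : hom (shift X) (G (shift (R X))) :=
  tfun_unshift (R X) o fmap shift (eta X).

Lemma Eta_nat (X : D) (T : E) (f : hom (R X) T) :
  fmap G (fmap shift f) o Eta X == tfun_unshift T o fmap shift (fmap G f o eta X).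
Proof.
  unfold Eta; rewrite comp_assoc, tfun_unshift_nat, <- comp_assoc, <- fmap_comp.
  reflexivity.
Qed.

Lemma Eta_ex (X : D) (T : E) (t : hom (shift X) (G T)) :
  exists t' : hom (shift (R X)) T, fmap G t' o Eta X == t.
Proof.
  destruct (pt_surj PE T) as (T' & e & e' & H1 & H2).
  destruct (pt_full PD (tfun_shift G T' o fmap G e' o t)) as [t0 E0].
  exists (e o fmap shift (lind t0)).
  rewrite fmap_comp, <- comp_assoc, Eta_nat, lindE, E0.
  rewrite !comp_assoc, (rassoc (tfun_unshift_l T')), comp_id_r, <- fmap_comp, H2.
  rewrite fmap_id; apply comp_id_l.
Qed.

Lemma Eta_uniq (X : D) (T : E) (s t : hom (shift (R X)) T) :
  fmap G s o Eta X == fmap G t o Eta X -> s == t.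
Proof.
  intro H; destruct (pt_surj PE T) as (T' & e & e' & He).
  assert (He' : is_iso e') by (exact (is_iso_inv He)).
  apply (iso_mono He').
  destruct (pt_full PE (e' o s)) as [s0 Es], (pt_full PE (e' o t)) as [t0 Et].
  rewrite <- Es, <- Et; apply fmap_heq, R_uniq, (pt_faithful PD).
  apply (iso_mono (m := tfun_unshift T')).
  { eapply is_iso_inv; split; [apply tfun_unshift_l | apply tfun_unshift_r]. }
  rewrite <- !Eta_nat, Es, Et, !fmap_comp, <- !comp_assoc, H; reflexivity.
Qed.

Definition ladj_shift (X : D) : hom (R (shift X)) (shift (R X)) := lind (Eta X).

Lemma ladj_shift_iso (X : D) : is_iso (ladj_shift X).
Proof.
  destruct (Eta_ex (eta (shift X))) as [k Ek]; exists k; split.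
  - apply R_uniq; unfold ladj_shift.
    rewrite fmap_comp, <- comp_assoc, lindE, Ek, fmap_id; symmetry; apply comp_id_l.
  - apply Eta_uniq; unfold ladj_shift.
    rewrite fmap_comp, <- comp_assoc, Ek, lindE, fmap_id; symmetry; apply comp_id_l.
Qed.

Lemma ladj_shift_nat (X Y : D) (f : hom X Y) :
  ladj_shift Y o fmap ladj_functor (fmap shift f)
    == fmap shift (fmap ladj_functor f) o ladj_shift X.
Proof.
  apply R_uniq; unfold ladj_shift.
  rewrite !fmap_comp, <- !comp_assoc, ladj_eta, comp_assoc, !lindE, Eta_nat, ladj_eta.
  unfold Eta; rewrite fmap_comp; symmetry; apply comp_assoc.
Qed.

(** Complete the image of [f] to a triangle with third term [W]. The unit extends to a map of
    triangles into its image under [G], whose transpose [psi] goes from [R Z] to [W]. An inverse of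
    [psi] is constructed by hand, in place of a five lemma. *)
Lemma ladj_tri (X Y Z : D) (f : hom X Y) (g : hom Y Z) (h : hom Z (shift X)) :
  tri f g h ->
  tri (fmap ladj_functor f) (fmap ladj_functor g) (ladj_shift X o fmap ladj_functor h).
Proof.
  intro T; set (h' := ladj_shift X o fmap ladj_functor h).
  assert (Eh : fmap G h' o eta Z == Eta X o h).
  { unfold h', ladj_shift.
    rewrite fmap_comp, <- comp_assoc, ladj_eta, comp_assoc, lindE; reflexivity. }
  destruct (pt_cone PE (fmap ladj_functor f)) as (W & a & b & TW).
  destruct (pt_fill PD (a := eta X) (b := eta Y) T (tfun_tri G TW)) as (phi & F1 & F2).
  { symmetry; apply ladj_eta. }
  pose proof (lindE phi) as Ep; set (psi := lind phi) in Ep.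
  assert (E1 : psi o fmap ladj_functor g == a).
  { apply R_uniq.
    rewrite fmap_comp, <- comp_assoc, ladj_eta, comp_assoc, Ep; exact F1. }
  assert (E2 : h' == b o psi).
  { apply R_uniq.
    rewrite Eh, fmap_comp, <- comp_assoc, Ep; unfold Eta.
    rewrite <- comp_assoc, F2, !comp_assoc, tfun_unshift_l, comp_id_l; reflexivity. }
  destruct (tri_weak_coker PE (t := fmap ladj_functor g) TW) as [chi Ec].
  { rewrite <- fmap_comp, (tri_comp0 PD T); apply fmap_0. }
  assert (H1 : exists m : hom (shift (R X)) (R Z),
    chi o psi + - idm (R Z) == m o h').
  { destruct (tri_weak_coker' PD (t := fmap G (chi o psi + - idm (R Z)) o eta Z) T)
      as [m Em].
    { rewrite <- comp_assoc, <- ladj_eta, comp_assoc, <- fmap_comp.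
      rewrite comp_hadd_l, <- comp_assoc, E1, Ec, comp_opp_l, comp_id_l, hadd_opp.
      rewrite fmap_0; apply comp_0l. }
    destruct (Eta_ex m) as [m' Em']; exists m'; apply R_uniq.
    rewrite <- Em, fmap_comp, <- comp_assoc, Eh, comp_assoc, Em'; reflexivity. }
  (* The correction by [m o b] makes [k] a left inverse of [psi], and does not change the composite
     with [a] because [b o a] is zero. *)
  destruct H1 as [m Em]; pose (k := chi + - (m o b)).
  assert (K1 : k o psi == idm _).
  { unfold k; apply (hadd_inj (h := - idm (R Z))); rewrite hadd_opp.
    rewrite comp_hadd_l, comp_opp_l, <- comp_assoc, <- E2, <- Em; abel. }
  assert (K2 : k o a == fmap ladj_functor g).
  { unfold k; rewrite comp_hadd_l, comp_opp_l, <- comp_assoc, (tri_comp0' PE TW), Ec.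
    rewrite comp_0r, hopp_0; apply hadd_0. }
  assert (H2 : exists n, psi o k + - idm W == n o b).
  { destruct (tri_weak_coker' PE (t := psi o k + - idm W) TW) as [n En].
    - rewrite comp_hadd_l, <- comp_assoc, K2, E1, comp_opp_l, comp_id_l; apply hadd_opp.
    - exists n; symmetry; exact En. }
  destruct H2 as [n En].
  assert (N0 : n o h' == 0).
  { rewrite E2, comp_assoc, <- En, comp_hadd_l, <- comp_assoc, K1, comp_opp_l.
    rewrite comp_id_l, comp_id_r; apply hadd_opp. }
  (* As [n] kills [h'], it factors through the translate of the image of [f], and the latter is
     killed by composing with [b]; so the remaining error [n o b] is zero. *)
  destruct (tri_weak_coker'' PD (t := fmap G n o Eta X) T) as [c Hc].
  { rewrite <- comp_assoc, <- Eh, comp_assoc, <- fmap_comp, N0, fmap_0; apply comp_0l. }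
  destruct (Eta_ex c) as [c' Hc'].
  assert (N1 : n == c' o fmap shift (fmap ladj_functor f)).
  { apply Eta_uniq.
    rewrite <- Hc, <- Hc', fmap_comp, <- !comp_assoc, Eta_nat, ladj_eta.
    unfold Eta; rewrite fmap_comp, !comp_assoc; reflexivity. }
  assert (K3 : psi o k == idm W).
  { apply (hadd_inj (h := - idm W)); rewrite En, N1, <- comp_assoc.
    rewrite (tri_comp0'' PE TW), comp_0r, hadd_opp; reflexivity. }
  refine (tri_closed _ TW).
  exists (idm _), (idm _), psi.
  do 2 (split; [apply is_iso_id |]); split; [exists k; split; assumption |].
  rewrite fmap_id, !comp_id_l, !comp_id_r, E1; repeat split; try reflexivity; exact E2.
Qed.

Definition ladj : tri_functor D E :=
  {| tfun := ladj_functor; tfun_shift := ladj_shift; tfun_shift_iso := ladj_shift_iso;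
     tfun_shift_nat := ladj_shift_nat; tfun_tri := ladj_tri |}.
End LeftAdjoint.

Section RightAdjoint.
Variables (R : D -> E) (eps : forall X : D, hom (G (R X)) X).
Hypothesis R_ex : forall (X : D) (T : E) (t : hom (G T) X),
  exists t' : hom T (R X), eps X o fmap G t' == t.
Hypothesis R_uniq : forall (X : D) (T : E) (s t : hom T (R X)),
  eps X o fmap G s == eps X o fmap G t -> s == t.

Definition rind (X : D) (T : E) (t : hom (G T) X) : hom T (R X) :=
  proj1_sig (constructive_indefinite_description _ (R_ex t)).
Lemma rindE (X : D) (T : E) (t : hom (G T) X) : eps X o fmap G (rind t) == t.
Proof. exact (proj2_sig (constructive_indefinite_description _ (R_ex t))). Qed.

Definition radj_functor : functor D E.
Proof.
  refine {| fob := R; fmap X Y f := rind (f o eps X) |}.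
  - intros X Y f g H; apply R_uniq; rewrite !rindE, H; reflexivity.
  - intro X; apply R_uniq; rewrite rindE, fmap_id, comp_id_l, comp_id_r; reflexivity.
  - intros X Y Z g f; apply R_uniq.
    rewrite rindE, fmap_comp, comp_assoc, rindE, <- !comp_assoc, rindE; reflexivity.
  - intros X Y f g; apply R_uniq.
    rewrite rindE, fmap_add, comp_hadd_r, !rindE; apply comp_hadd_l.
Defined.

Lemma radj_eps (X Y : D) (f : hom X Y) :
  eps Y o fmap G (fmap radj_functor f) == f o eps X.
Proof. apply rindE. Qed.

Let Eps (X : D) : hom (G (shift (R X))) (shift X) :=
  fmap shift (eps X) o tfun_shift G (R X).

Lemma Eps_nat (X : D) (T : E) (f : hom T (R X)) :
  Eps X o fmap G (fmap shift f) == fmap shift (eps X o fmap G f) o tfun_shift G T.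
Proof.
  unfold Eps; rewrite <- comp_assoc, tfun_shift_nat, comp_assoc, <- fmap_comp.
  reflexivity.
Qed.

Lemma Eps_ex (X : D) (T : E) (t : hom (G T) (shift X)) :
  exists t' : hom T (shift (R X)), Eps X o fmap G t' == t.
Proof.
  destruct (pt_surj PE T) as (T' & e & e' & H1 & H2).
  destruct (pt_full PD (t o fmap G e o tfun_unshift T')) as [t0 E0].
  exists (fmap shift (rind t0) o e').
  rewrite fmap_comp, comp_assoc, Eps_nat, rindE, E0.
  rewrite (rassoc (tfun_unshift_l T')), comp_id_r, <- comp_assoc, <- fmap_comp, H2.
  rewrite fmap_id; apply comp_id_r.
Qed.

Lemma Eps_uniq (X : D) (T : E) (s t : hom T (shift (R X))) :
  Eps X o fmap G s == Eps X o fmap G t -> s == t.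
Proof.
  intro H; destruct (pt_surj PE T) as (T' & e & He).
  apply (iso_epi He).
  destruct (pt_full PE (s o e)) as [s0 Es], (pt_full PE (t o e)) as [t0 Et].
  rewrite <- Es, <- Et; apply fmap_heq, R_uniq, (pt_faithful PD).
  apply (iso_epi (tfun_shift_iso G T')).
  rewrite <- !Eps_nat, Es, Et, !fmap_comp, !comp_assoc, H; reflexivity.
Qed.

Lemma radj_shift_ex (X : D) : exists k : hom (R (shift X)) (shift (R X)),
  Eps X o fmap G k == eps (shift X).
Proof. apply Eps_ex. Qed.

Definition radj_shift (X : D) : hom (R (shift X)) (shift (R X)) :=
  proj1_sig (constructive_indefinite_description _ (radj_shift_ex X)).
Lemma radj_shiftE (X : D) : Eps X o fmap G (radj_shift X) == eps (shift X).
Proof. exact (proj2_sig (constructive_indefinite_description _ (radj_shift_ex X))). Qed.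

Lemma radj_shift_iso (X : D) : is_iso (radj_shift X).
Proof.
  exists (rind (Eps X)); split.
  - apply R_uniq.
    rewrite fmap_comp, comp_assoc, rindE, radj_shiftE, fmap_id; symmetry; apply comp_id_r.
  - apply Eps_uniq.
    rewrite fmap_comp, comp_assoc, radj_shiftE, rindE, fmap_id; symmetry; apply comp_id_r.
Qed.

Lemma radj_shift_nat (X Y : D) (f : hom X Y) :
  radj_shift Y o fmap radj_functor (fmap shift f)
    == fmap shift (fmap radj_functor f) o radj_shift X.
Proof.
  apply Eps_uniq.
  rewrite !fmap_comp, !comp_assoc, radj_shiftE, radj_eps, Eps_nat, radj_eps.
  rewrite fmap_comp, <- radj_shiftE; unfold Eps; rewrite !comp_assoc; reflexivity.
Qed.

Lemma radj_tri (X Y Z : D) (f : hom X Y) (g : hom Y Z) (h : hom Z (shift X)) :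
  tri f g h ->
  tri (fmap radj_functor f) (fmap radj_functor g) (radj_shift X o fmap radj_functor h).
Proof.
  intro T; set (h' := radj_shift X o fmap radj_functor h).
  assert (Eh : Eps X o fmap G h' == h o eps Z).
  { unfold h'; rewrite fmap_comp, comp_assoc, radj_shiftE; apply radj_eps. }
  destruct (pt_cone PE (fmap radj_functor f)) as (W & a & b & TW).
  destruct (pt_fill PD (a := eps X) (b := eps Y) (tfun_tri G TW) T) as (phi & F1 & F2).
  { apply radj_eps. }
  pose proof (rindE phi) as Ep; set (psi := rind phi) in Ep.
  assert (E1 : psi o a == fmap radj_functor g).
  { apply R_uniq; rewrite fmap_comp, comp_assoc, Ep, radj_eps; exact F1. }
  assert (E2 : h' o psi == b).
  { apply Eps_uniq; rewrite fmap_comp, comp_assoc, Eh, <- comp_assoc, Ep, <- F2.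
    unfold Eps; rewrite comp_assoc; reflexivity. }
  destruct (tri_weak_ker'' PE (t := h') TW) as [chi Ec].
  { unfold h'; rewrite comp_assoc, <- radj_shift_nat, <- comp_assoc, <- fmap_comp.
    rewrite (tri_comp0'' PD T), fmap_0; apply comp_0r. }
  assert (H1 : exists m : hom (R Z) (R Y),
    psi o chi + - idm (R Z) == fmap radj_functor g o m).
  { destruct (tri_weak_ker' PD (t := eps Z o fmap G (psi o chi + - idm (R Z))) T)
      as [m Em].
    { rewrite comp_assoc, <- Eh, <- comp_assoc, <- fmap_comp.
      rewrite comp_hadd_r, comp_assoc, E2, Ec, comp_opp_r, comp_id_r, hadd_opp.
      rewrite fmap_0; apply comp_0r. }
    exists (rind m); apply R_uniq.
    rewrite <- Em, fmap_comp, comp_assoc, radj_eps, <- comp_assoc, rindE; reflexivity. }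
  (* Dual correction: [k] becomes a right inverse of [psi], while [b o k] stays equal to [h'] since
     [b o a] is zero. *)
  destruct H1 as [m Em]; pose (k := chi + - (a o m)).
  assert (K1 : psi o k == idm _).
  { unfold k; apply (hadd_inj (h := - idm (R Z))); rewrite hadd_opp.
    rewrite comp_hadd_r, comp_opp_r, comp_assoc, E1, <- Em; abel. }
  assert (K2 : b o k == h').
  { unfold k; rewrite comp_hadd_r, comp_opp_r, comp_assoc, (tri_comp0' PE TW), Ec.
    rewrite comp_0l, hopp_0; apply hadd_0. }
  assert (H2 : exists n, k o psi + - idm W == a o n).
  { destruct (tri_weak_ker' PE (t := k o psi + - idm W) TW) as [n En].
    - rewrite comp_hadd_r, comp_assoc, K2, E2, comp_opp_r, comp_id_r; apply hadd_opp.
    - exists n; symmetry; exact En. }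
  destruct H2 as [n En].
  assert (N0 : fmap radj_functor g o n == 0).
  { rewrite <- E1, <- comp_assoc, <- En, comp_hadd_r, comp_assoc, K1, comp_opp_r.
    rewrite comp_id_l, comp_id_r; apply hadd_opp. }
  destruct (tri_weak_ker PD (t := eps Y o fmap G n) T) as [c Hc].
  { rewrite comp_assoc, <- radj_eps, <- comp_assoc, <- fmap_comp, N0, fmap_0.
    apply comp_0r. }
  assert (N1 : n == fmap radj_functor f o rind c).
  { apply R_uniq.
    rewrite <- Hc, fmap_comp, comp_assoc, radj_eps, <- comp_assoc, rindE; reflexivity. }
  assert (K3 : k o psi == idm W).
  { apply (hadd_inj (h := - idm W)); rewrite En, N1, comp_assoc.
    rewrite (tri_comp0 PE TW), comp_0l, hadd_opp; reflexivity. }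
  refine (tri_closed (tri_iso_sym _) TW).
  exists (idm _), (idm _), psi.
  do 2 (split; [apply is_iso_id |]); split; [exists k; split; assumption |].
  rewrite fmap_id, !comp_id_l, !comp_id_r, E1; repeat split; try reflexivity.
  symmetry; exact E2.
Qed.

Definition radj : tri_functor D E :=
  {| tfun := radj_functor; tfun_shift := radj_shift; tfun_shift_iso := radj_shift_iso;
     tfun_shift_nat := radj_shift_nat; tfun_tri := radj_tri |}.
End RightAdjoint.
End Adjoints.

(** * Families indexed by Z and transport between degrees *)

Lemma unshift_family (F : Z -> Type) (h : forall m, F (m + 1)%Z) :
  exists k : forall n, F n, forall m, k (m + 1)%Z = h m.
Proof.
  assert (e : forall n, (n - 1 + 1 = n)%Z) by (intro; lia).
  (* [n - 1 + 1] is not convertible to [n], so the value is transported; as equality on Z is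
     decidable, a transport along a loop is the identity. *)
  exists (fun n => eq_rect _ F (h (n - 1)%Z) n (e n)); intro m.
  generalize (e (m + 1)%Z); assert (E : (m + 1 - 1 = m)%Z) by lia; rewrite E.
  intro e'; rewrite (UIP_dec Z.eq_dec e' eq_refl); reflexivity.
Qed.

Lemma forall_shift (P : Z -> Prop) : (forall m, P (m + 1)%Z) -> forall n, P n.
Proof.
  intros H n; replace n with (n - 1 + 1)%Z by lia; apply H.
Qed.

(** An identity read as a morphism between propositionally equal degrees: transports become
    morphisms, and [cst_nat] moves them past differentials. *)
Definition cst (B : preadditive) (X : Z -> B) (a b : Z) (e : a = b) : hom (X a) (X b) :=
  match e in _ = b return hom (X a) (X b) with eq_refl => idm (X a) end.

Lemma cst_id (B : preadditive) (X : Z -> B) (a : Z) (e : a = a) : cst X e == idm _.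
Proof. rewrite (UIP_dec Z.eq_dec e eq_refl); reflexivity. Qed.

Lemma cst_comp (B : preadditive) (X : Z -> B) (a b c : Z) (e : a = b) (e' : b = c)
    (e'' : a = c) :
  cst X e' o cst X e == cst X e''.
Proof.
  destruct e'; rewrite (UIP_dec Z.eq_dec e'' e); apply comp_id_l.
Qed.

Lemma cst_nat (B : preadditive) (X Y : Z -> B) (k : Z)
    (f : forall n, hom (X n) (Y (n + k)%Z)) (a b : Z) (e : a = b)
    (e' : (a + k = b + k)%Z) :
  f b o cst X e == cst Y e' o f a.
Proof.
  destruct e; rewrite (cst_id Y e'); simpl; rewrite comp_id_r, comp_id_l; reflexivity.
Qed.

Section Biproducts.
Variable B : preadditive.
Variables (X Y S : B) (iX : hom X S) (iY : hom Y S) (pX : hom S X) (pY : hom S Y).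
Hypothesis H : is_biproduct iX iY pX pY.

Lemma bip_ext_from W (f g : hom S W) : f o iX == g o iX -> f o iY == g o iY -> f == g.
Proof.
  intros E1 E2; rewrite <- (comp_id_r f), <- (comp_id_r g), <- (bip_id H).
  rewrite !comp_hadd_r, !comp_assoc, E1, E2; reflexivity.
Qed.
Lemma bip_ext_to W (f g : hom W S) : pX o f == pX o g -> pY o f == pY o g -> f == g.
Proof.
  intros E1 E2; rewrite <- (comp_id_l f), <- (comp_id_l g), <- (bip_id H).
  rewrite !comp_hadd_l, <- !comp_assoc, E1, E2; reflexivity.
Qed.
End Biproducts.

Definition has_biproducts (C : preadditive) : Prop :=
  forall X Y : C, exists (S : C)
    (iX : hom X S) (iY : hom Y S) (pX : hom S X) (pY : hom S Y),
    is_biproduct iX iY pX pY.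

(** * The homotopy category *)

Section HomotopyCategory.
Variable B : preadditive.
Hypothesis B_zero : exists Z : B, is_zero Z.
Hypothesis B_bip : has_biproducts B.

Notation complex := (complex B).

Lemma comp_dif_dif (X : complex) (n : Z) W (k : hom (X (n + 1 + 1)%Z) W) :
  k o dif X (n + 1)%Z o dif X n == 0.
Proof. rewrite <- comp_assoc, dif_dif; apply comp_0r. Qed.

Lemma complex_iso (X Y : complex) (f : chain_map X Y) (g : forall n, hom (Y n) (X n)) :
  (forall n, is_inverse (f n) (g n)) -> is_iso (C := hcat B) f.
Proof.
  intro H.
  assert (G : forall n, g (n + 1)%Z o dif Y n == dif X n o g n).
  { intro n; destruct (H n) as [_ H1], (H (n + 1)%Z) as [H2 _].
    rewrite <- (comp_id_r (dif Y n)), <- H1, (comp_assoc (dif Y n)), <- cm_dif.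
    rewrite !comp_assoc, H2, comp_id_l; reflexivity. }
  exists (ChainMap G); split; apply homotopic_ext; intro n; apply H.
Qed.

Definition zero_complex (O : B) : complex := 
  @Complex B (fun _ => O) (fun _ => 0) (fun _ => comp_0r _ _).

Lemma zero_complex_zero (O : B) : is_zero O -> is_zero (zero_complex O : hcat B).
Proof.
  intro H; apply zero_id; apply homotopic_ext; intro n; cbn; apply zero_to, H.
Qed.

Section Unshift.
Variable X : complex.
Let U (n : Z) : B := X (n - 1)%Z.
Lemma unshift_index (n : Z) : (n - 1 + 1 = n + 1 - 1)%Z. Proof. lia. Qed.

Lemma unshift_dif_dif (n : Z) :
  (cst X (unshift_index (n + 1)) o - dif X (n + 1 - 1)%Z)
    o (cst X (unshift_index n) o - dif X (n - 1)%Z) == 0.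
Proof.
  assert (e : (n - 1 + 1 + 1 = n + 1 - 1 + 1)%Z) by lia.
  expand; rewrite <- (comp_assoc _ (dif X (n + 1 - 1)%Z)), (cst_nat (dif X) (unshift_index n) e).
  rewrite <- !comp_assoc, dif_dif, !comp_0r; reflexivity.
Qed.

Definition unshift_ob : complex :=
  {| cob n := X (n - 1)%Z;
     dif n := cst X (unshift_index n) o - dif X (n - 1)%Z;
     dif_dif := unshift_dif_dif |}.

Lemma unshift_iso : isomorphic (C := hcat B) (cshift_ob unshift_ob) X.
Proof.
  assert (e : forall n, (n + 1 - 1 = n)%Z) by (intro; lia).
  assert (F : forall n, cst X (e (n + 1)%Z) o dif (cshift_ob unshift_ob) n
            == dif X n o cst X (e n)).
  { intro n; cbn; assert (e' : (n + 1 - 1 + 1 = n + 1)%Z) by lia.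
    expand; rewrite (cst_comp _ _ _ e'); symmetry; apply cst_nat. }
  exists (ChainMap F); apply complex_iso with (g := fun n => cst X (eq_sym (e n))).
  intro n; cbn; split; rewrite (cst_comp _ _ _ eq_refl); reflexivity.
Qed.
End Unshift.

Lemma cshift_full : full (cshift B).
Proof.
  intros X Y h; cbn in X, Y, h.
  destruct (unshift_family (F := fun n => hom (X n) (Y n)) (cm h)) as [f Hf].
  assert (F : forall n, f (n + 1)%Z o dif X n == dif Y n o f n).
  { apply forall_shift; intro m; rewrite !Hf.
    pose proof (cm_dif h m) as E; cbn in E; rewrite comp_opp_l, comp_opp_r in E.
    rewrite <- (hopp_opp (_ o _)), E; apply hopp_opp. }
  exists (ChainMap F); apply homotopic_ext; intro n; cbn; rewrite Hf; reflexivity.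
Qed.

Lemma cshift_faithful : faithful (cshift B).
Proof.
  intros X Y f g [h H]; cbn in X, Y, f, g, h, H.
  destruct (unshift_family (F := fun n => hom (X (n + 1)%Z) (Y n)) h) as [k Hk].
  exists (fun n => - k n).
  apply (@forall_shift (fun n => f (n + 1)%Z == g (n + 1)%Z +
           (dif Y n o - k n + - k (n + 1)%Z o dif X (n + 1)%Z))).
  intro m; rewrite !Hk, H, !comp_opp_l, !comp_opp_r; reflexivity.
Qed.

Lemma cone_exists (X Y : complex) (u : chain_map X Y) :
  exists (C : complex) (i : chain_map Y C) (p : chain_map C (cshift_ob X)), is_cone u i p.
Proof.
  (* Biproducts merely exist; their data are packed in one type so that they can be chosen in all
     degrees at once. *)
  pose (P n (d : {S : B & (hom (X (n + 1)%Z) S * hom (Y n) S *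
                           (hom S (X (n + 1)%Z) * hom S (Y n)))%type}) :=
    is_biproduct (fst (fst (projT2 d))) (snd (fst (projT2 d)))
                 (fst (snd (projT2 d))) (snd (snd (projT2 d)))).
  assert (HP : forall n, exists d, P n d).
  { intro n; destruct (B_bip (X (n + 1)%Z) (Y n)) as (S & a & b & c & d & H).
    exists (existT _ S ((a, b), (c, d))); exact H. }
  pose (D n := proj1_sig (constructive_indefinite_description _ (HP n))).
  assert (HD : forall n, P n (D n))
    by (intro n; exact (proj2_sig (constructive_indefinite_description _ (HP n)))).
  pose (C n := projT1 (D n)).
  pose (iX n := fst (fst (projT2 (D n))) : hom (X (n + 1)%Z) (C n)).
  pose (i n := snd (fst (projT2 (D n))) : hom (Y n) (C n)).
  pose (p n := fst (snd (projT2 (D n))) : hom (C n) (X (n + 1)%Z)).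
  pose (pY n := snd (snd (projT2 (D n))) : hom (C n) (Y n)).
  assert (HB : forall n, is_biproduct (iX n) (i n) (p n) (pY n)) by exact HD.
  clearbody i iX p pY C; clear D HP HD P.
  pose (d n := iX (n + 1)%Z o - dif X (n + 1)%Z o p n + i (n + 1)%Z o u (n + 1)%Z o p n
               + i (n + 1)%Z o dif Y n o pY n).
  assert (DX : forall n, d n o iX n ==
       iX (n + 1)%Z o (- dif X (n + 1)%Z) + i (n + 1)%Z o u (n + 1)%Z).
  { intro n; unfold d; destruct (HB n) as [H1 H2 H3 H4 H5]; expand.
    repeat crw H1; repeat crw H3; expand; abel. }
  assert (DY : forall n, d n o i n == i (n + 1)%Z o dif Y n).
  { intro n; unfold d; destruct (HB n) as [H1 H2 H3 H4 H5]; expand.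
    repeat crw H4; repeat crw H2; expand; abel. }
  assert (DD : forall n, d (n + 1)%Z o d n == 0).
  { intro n; apply (bip_ext_from (HB n)); rewrite comp_0l, <- comp_assoc.
    - rewrite DX, comp_hadd_r, !comp_assoc, DX, DY; expand.
      rewrite <- (comp_assoc _ (u _)), cm_dif; expand.
      rewrite comp_dif_dif; abel.
    - rewrite DY, comp_assoc, DY, comp_dif_dif; reflexivity. }
  assert (PD : forall n, p (n + 1)%Z o d n == - dif X (n + 1)%Z o p n).
  { intro n; unfold d; destruct (HB (n + 1)%Z) as [H1 H2 H3 H4 H5].
    rewrite !comp_hadd_r, !comp_assoc, H1, H4; expand; abel. }
  exists (Complex DD).
  unshelve eexists; [exists i; intro n; cbn; symmetry; apply DY |].
  unshelve eexists; [exists p; exact PD |].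
  exists iX, pY; split; [exact HB | exact DX].
Qed.

Lemma semi_split_dif (X Y V : complex) (f : chain_map X Y) (g : chain_map Y V)
    (s : forall n, hom (V n) (Y n)) (r : forall n, hom (Y n) (X n)) (n : Z) :
  (forall n, is_biproduct (f n) (s n) (r n) (g n)) ->
  dif Y n o s n ==
    f (n + 1)%Z o r (n + 1)%Z o dif Y n o s n + s (n + 1)%Z o dif V n.
Proof.
  intro H; rewrite <- (comp_id_l (dif Y n)) at 1; rewrite <- (bip_id (H (n + 1)%Z)).
  expand; crw (cm_dif g n); expand; crw (bip_YY (H n)); expand; reflexivity.
Qed.

(* The cone of [f] retracts onto [V] because [f] is split in each degree. *)
Lemma semi_split_tri (X Y V : complex) (f : chain_map X Y) (g : chain_map Y V)
    (h : chain_map V (cshift_ob X))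
    (s : forall n, hom (V n) (Y n)) (r : forall n, hom (Y n) (X n)) :
  (forall n, is_biproduct (f n) (s n) (r n) (g n)) ->
  (forall n, h n == - (r (n + 1)%Z o dif Y n o s n)) ->
  tri (t := K B) (f : @hom (K B) X Y) (g : @hom (K B) Y V) h.
Proof.
  intros HB Hh; destruct (cone_exists f) as (C & i & p & iX & pY & HC & HD).
  exists X, Y, C, f, i, p; split; [exists iX, pY; auto |].
  assert (Ee : forall n, (i (n + 1)%Z o s (n + 1)%Z + iX (n + 1)%Z o h (n + 1)%Z) o dif V n
               == dif C n o (i n o s n + iX n o h n)).
  { intro n; expand; rewrite <- (cm_dif i n), HD; expand.
    rewrite <- (comp_assoc (i _) (dif Y n)), (semi_split_dif _ HB); expand.
    rewrite <- (comp_assoc (iX _) (h _)), (cm_dif h n); cbn; expand.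
    rewrite <- (comp_assoc (i _ o f _)), Hh; expand; abel. }
  assert (Ec : forall n, (g (n + 1)%Z o pY (n + 1)%Z) o dif C n == dif V n o (g n o pY n)).
  { intro n; apply (bip_ext_from (HC n)); rewrite <- !comp_assoc.
    - rewrite HD, (bip_XY (HC n)); expand.
      crw (bip_XY (HC (n + 1)%Z)); crw (bip_YY (HC (n + 1)%Z)); expand.
      rewrite (bip_XY (HB (n + 1)%Z)); expand; abel.
    - rewrite <- (cm_dif i n), (bip_YY (HC n)); expand.
      crw (bip_YY (HC (n + 1)%Z)); expand; apply cm_dif. }
  pose (e := ChainMap Ee); pose (c := ChainMap Ec).
  assert (H1 : homotopic (cm_comp c e) (cm_id V)).
  { apply homotopic_ext; intro n; cbn; expand.
    crw (bip_YY (HC n)); crw (bip_XY (HC n)); expand; rewrite (bip_YY (HB n)); abel. }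
  assert (H2 : homotopic (cm_id C) (cm_comp e c)).
  (* The homotopy sends the component in Y^(n+1) to X^(n+1) by the degreewise retraction of [f],
     viewed as a summand of C^n. *)
  { exists (fun n => iX n o r (n + 1)%Z o pY (n + 1)%Z); intro n.
    apply (bip_ext_from (HC (n + 1)%Z)); cbn.
    - expand.
      repeat crw (bip_XY (HC (n + 1)%Z)); expand.
      rewrite <- (comp_assoc (_ o pY _)), HD; expand.
      repeat crw (bip_XY (HC (n + 1 + 1)%Z)); repeat crw (bip_YY (HC (n + 1 + 1)%Z)); expand.
      crw (bip_XX (HB (n + 1 + 1)%Z)); expand; abel.
    - expand.
      repeat crw (bip_YY (HC (n + 1)%Z)); expand.
      rewrite HD. rewrite <- (comp_assoc (_ o pY _)), <- (cm_dif i (n + 1)%Z); expand.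
      repeat crw (bip_YY (HC (n + 1 + 1)%Z)); expand.
      rewrite Hh, <- (comp_id_r (i (n + 1)%Z)) at 1; rewrite <- (bip_id (HB (n + 1)%Z)).
      rewrite <- (comp_id_r (dif Y (n + 1)%Z)) at 2.
      rewrite <- (bip_id (HB (n + 1)%Z)); expand.
      rewrite <- (comp_assoc _ (dif Y _) (f _)), <- cm_dif; expand.
      crw (bip_XX (HB (n + 1 + 1)%Z)); expand; abel. }
  exists (idm (X : hcat B)), (idm (Y : hcat B)), (e : @hom (hcat B) V C).
  do 2 (split; [apply is_iso_id |]).
  split; [exists c; split; [exact H1 | symmetry; exact H2] |].
  split; [rewrite comp_id_l, comp_id_r; reflexivity |].
  split.
  - rewrite comp_id_r, <- (comp_id_l (i : @hom (hcat B) Y C)).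
    transitivity ((e : @hom (hcat B) V C) o ((c : @hom (hcat B) C V) o (i : @hom (hcat B) Y C))).
    + apply comp_heq; [reflexivity |]; apply homotopic_ext; intro n; cbn.
      rewrite <- comp_assoc, (bip_YY (HC n)); symmetry; apply comp_id_r.
    + rewrite comp_assoc; apply comp_heq; [symmetry; exact H2 | reflexivity].
  - rewrite fmap_id, comp_id_l; apply homotopic_ext; intro n; cbn.
    expand; rewrite (bip_YX (HC n)), (bip_XX (HC n)); expand; abel.
Qed.

Lemma cone_tri (X Y C : complex) (u : chain_map X Y) (i : chain_map Y C)
    (p : chain_map C (cshift_ob X)) :
  is_cone u i p -> tri (t := K B) (u : @hom (K B) X Y) (i : @hom (K B) Y C) p.
Proof.
  intro H; exists X, Y, C, u, i, p; split; [exact H |].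
  apply tri_iso_heq; reflexivity.
Qed.

(** The sequence Y -> C -> X[1] is split in each degree by [pY] and [iX], and its connecting map
    -(pY d iX) is -u. *)
Lemma cone_rot (X Y C : complex) (u : chain_map X Y) (i : chain_map Y C)
    (p : chain_map C (cshift_ob X)) :
  is_cone u i p ->
  tri (t := K B) (i : @hom (K B) Y C) (p : @hom (K B) C (cshift_ob X))
      (cm_opp (cshift_map u)).
Proof.
  intros (iX & pY & HC & HD); apply (@semi_split_tri Y C (cshift_ob X) i p (cm_opp (cshift_map u)) iX pY).
  - intro n; destruct (HC n) as [H1 H2 H3 H4 H5]; split; try assumption.
    rewrite hadd_comm; exact H5.
  - intro n; cbn; rewrite <- comp_assoc, HD; expand.
    crw (bip_XY (HC (n + 1)%Z)); rewrite (bip_YY (HC (n + 1)%Z)); expand; abel.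
Qed.

(** The homotopy [s] between the two composites of the square provides the off-diagonal entry
    [i' s p] of the map of cones. *)
Lemma cone_fill (X Y C : complex) (u : chain_map X Y) (i : chain_map Y C)
    (p : chain_map C (cshift_ob X))
    (X' Y' C' : complex) (u' : chain_map X' Y') (i' : chain_map Y' C')
    (p' : chain_map C' (cshift_ob X')) (a : chain_map X X') (b : chain_map Y Y') :
  is_cone u i p -> is_cone u' i' p' -> homotopic (cm_comp b u) (cm_comp u' a) ->
  exists c : chain_map C C', homotopic (cm_comp c i) (cm_comp i' b) /\
    homotopic (cm_comp (cshift_map a) p) (cm_comp p' c).
Proof.
  intros (iX & pY & HC & HD) (iX' & pY' & HC' & HD') [s Hs]; cbn in Hs.
  pose (c n := iX' n o a (n + 1)%Z o p n + i' n o b n o pY n + i' n o s n o p n).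
  assert (CX : forall n, c n o iX n == iX' n o a (n + 1)%Z + i' n o s n).
  { intro n; unfold c; expand.
    repeat crw (bip_XX (HC n)); repeat crw (bip_XY (HC n)); expand; abel. }
  assert (CY : forall n, c n o i n == i' n o b n).
  { intro n; unfold c; expand.
    repeat crw (bip_YX (HC n)); repeat crw (bip_YY (HC n)); expand; abel. }
  assert (Hc : forall n, c (n + 1)%Z o dif C n == dif C' n o c n).
  { intro n; apply (bip_ext_from (HC n)); rewrite <- !comp_assoc.
    - rewrite HD, CX; expand; rewrite CX, CY; expand.
      rewrite HD', <- (cm_dif i' n); expand.
      rewrite <- (comp_assoc (i' _) (b _)), Hs; expand.
      rewrite <- (comp_assoc (iX' _)), cm_dif; expand; abel.
    - rewrite CY, <- (cm_dif i n); expand.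
      rewrite CY, <- (cm_dif i' n), <- !comp_assoc, cm_dif; reflexivity. }
  exists (ChainMap Hc); split; apply homotopic_ext; intro n; cbn.
  - apply CY.
  - unfold c; expand.
    rewrite (bip_XX (HC' n)), (bip_YX (HC' n)); expand; abel.
Qed.

Lemma K_pretriangulated : pretriangulated (K B).
Proof.
  destruct B_zero as [O HO]; split.
  - exists (zero_complex O); apply zero_complex_zero, HO.
  - exact cshift_full.
  - exact cshift_faithful.
  - intro X; exists (unshift_ob X); apply unshift_iso.
  - intros Z W HZ; pose (O' := zero_complex O).
    assert (T : tri (t := K B) (cm_zero O' W : @hom (K B) O' W) (idm (W : K B))
                    (cm_zero W (cshift_ob O'))).
    { apply (semi_split_tri (s := fun n => idm (W n)) (r := fun n => 0)); intro n; cbn.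
      - split; expand; try reflexivity.
        + symmetry; apply zero_to, HO.
        + apply hadd_0l.
      - symmetry; apply zero_to, HO. }
    refine (tri_closed (t := K B) _ T).
    exists (0 : @hom (K B) Z O'), (idm _), (idm _).
    split; [exists 0; split; [rewrite comp_0l; symmetry; apply zero_from, HZ |] |].
    { rewrite comp_0l; symmetry; apply zero_from, zero_complex_zero, HO. }
    do 2 (split; [apply is_iso_id |]).
    split; [etransitivity; [| symmetry]; apply zero_from, HZ |].
    split; [reflexivity | rewrite comp_0r; symmetry; exact (comp_0l _ (idm _))].
  - intros X Y f; destruct (cone_exists f) as (C & i & p & H).
    exists C, i, p; apply cone_tri, H.
  - intros X Y Z f g h (X' & Y' & C & u & i & p & HC & (a & b & c & Ha & Hb & Hc & E1 & E2 & E3)).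
    refine (tri_closed (t := K B) _ (cone_rot HC)).
    exists b, c, (fmap (cshift B) a).
    do 2 (split; [assumption |]); split; [exact (fmap_iso (cshift B) Ha) |].
    split; [exact E2 | split; [exact E3 |]].
    transitivity (- fmap (cshift B) u o fmap (cshift B) a); [| reflexivity].
    rewrite comp_opp_l, comp_opp_r; cbn [shift K]; rewrite <- !fmap_comp, E1.
    reflexivity.
  - intros X Y Z f g h X' Y' Z' f' g' h' a b
      (X1 & Y1 & C1 & u1 & i1 & p1 & HC1 & (a1 & b1 & c1 & Ha1 & Hb1 & Hc1 & E1 & E2 & E3))
      (X2 & Y2 & C2 & u2 & i2 & p2 & HC2 & (a2 & b2 & c2 & Ha2 & Hb2 & Hc2 & F1 & F2 & F3)) E.
    (* Conjugating [a] and [b] by the given isomorphisms reduces filling to genuine mapping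
       cones. *)
    destruct (@cone_fill _ _ _ u1 i1 p1 _ _ _ u2 i2 p2 (a2 o a o iso_inv Ha1)
      (b2 o b o iso_inv Hb1) HC1 HC2) as (c & G1 & G2).
    { change ((b2 o b o iso_inv Hb1) o u1 == u2 o (a2 o a o iso_inv Ha1)).
      apply (iso_epi Ha1); rewrite <- !comp_assoc, iso_inv_l, <- E1, comp_id_r.
      rewrite (comp_assoc _ b1), iso_inv_l, comp_id_l, E, !comp_assoc, F1; reflexivity. }
    pose (c' := c : @hom (hcat B) C1 C2).
    change (c' o i1 == i2 o (b2 o b o iso_inv Hb1)) in G1.
    change (fmap (cshift B) (a2 o a o iso_inv Ha1) o p1 == p2 o c') in G2.
    exists (iso_inv Hc2 o c' o c1); split; [apply (iso_mono Hc2) | apply (iso_mono (fmap_iso (cshift B) Ha2))].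
    + rewrite !comp_assoc, iso_inv_r, comp_id_l, <- comp_assoc, E2, comp_assoc, G1.
      rewrite <- !comp_assoc, iso_inv_l, comp_id_r, !comp_assoc, F2; reflexivity.
    + cbn [shift K]; rewrite !comp_assoc, F3.
      rewrite <- (comp_assoc p2 c2), iso_inv_r, comp_id_r.
      rewrite <- G2, !fmap_comp, <- !comp_assoc, <- E3.
      rewrite (comp_assoc (fmap _ (iso_inv Ha1))), <- fmap_comp, iso_inv_l, fmap_id, comp_id_l.
      reflexivity.
Qed.
End HomotopyCategory.

(** * Brutal truncations *)

Section Windows.
Variables (B : preadditive) (O : B).
Hypothesis HO : is_zero O.
Hypothesis B_bip : has_biproducts B.
Notation complex := (complex B).

(** Matching on both booleans lets source and target reduce to [X], [Y] or [O] once membership in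
    the windows is decided; facts about truncations are then proved by cases. *)
Definition cut (b c : bool) (X Y : B) (f : hom X Y) :
  hom (if b then X else O) (if c then Y else O) :=
  match b as b return hom (if b then X else O) (if c then Y else O) with
  | true => match c as c return hom X (if c then Y else O) with
            | true => f
            | false => 0
            end
  | false => 0
  end.

Lemma zero_zero (f g : hom O O) : f == g.
Proof. etransitivity; [| symmetry]; apply zero_to, HO. Qed.

(* The truncation of [X] to the degrees in [p]; its differential is that of [X]
   between adjacent degrees in [p]. *)
Definition win (p : Z -> bool) (X : complex) : complex.
Proof.
  refine (@Complex B (fun n => if p n then X n else O)
            (fun n => cut (p n) (p (n + 1)%Z) (dif X n)) _).
  intro n; destruct (p n), (p (n + 1)%Z), (p (n + 1 + 1)%Z); simpl;
    rewrite ?comp_0l, ?comp_0r; try reflexivity; apply dif_dif.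
Defined.

Definition win_fam (p q : Z -> bool) (X Y : complex) (f : forall n, hom (X n) (Y n)) n :
  hom (win p X n) (win q Y n) := cut (p n) (q n) (f n).

(** The square in degree [n] is at risk only if its corners X^n and Y^(n+1) both survive; then
    X^(n+1) and Y^n must survive or be cut together. *)
Definition win_map (p q : Z -> bool) (X Y : complex) (f : chain_map X Y)
  (H : forall n, p n = true -> q (n + 1)%Z = true -> p (n + 1)%Z = q n) :
  chain_map (win p X) (win q Y).
Proof.
  refine (@ChainMap B (win p X) (win q Y) (win_fam p q f) _).
  intro n; unfold win_fam; simpl.
  specialize (H n); pose proof (cm_dif f n) as E.
  destruct (p n), (p (n + 1)%Z), (q n), (q (n + 1)%Z); simpl in *;
    rewrite ?comp_0l, ?comp_0r; try reflexivity; try exact E;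
    discriminate (H eq_refl eq_refl).
Defined.

Lemma compat_refl (p : Z -> bool) n :
  p n = true -> p (n + 1)%Z = true -> p (n + 1)%Z = p n.
Proof. congruence. Qed.

Definition win_cm (p : Z -> bool) (X Y : complex) (f : chain_map X Y) :
  chain_map (win p X) (win p Y) := win_map f (@compat_refl p).

Definition win_in (p : Z -> bool) (X : complex)
  (H : forall n, p n = true -> p (n + 1)%Z = true) : chain_map (win p X) X.
Proof.
  refine (@ChainMap B (win p X) X (fun n => cut (p n) true (idm (X n))) _).
  intro n; specialize (H n); simpl.
  destruct (p n), (p (n + 1)%Z); simpl in *; try discriminate (H eq_refl);
    rewrite ?comp_0l, ?comp_0r, ?comp_id_l, ?comp_id_r; reflexivity.
Defined.

Definition win_out (p : Z -> bool) (X : complex)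
  (H : forall n, p (n + 1)%Z = true -> p n = true) : chain_map X (win p X).
Proof.
  refine (@ChainMap B X (win p X) (fun n => cut true (p n) (idm (X n))) _).
  intro n; specialize (H n); simpl.
  destruct (p n), (p (n + 1)%Z); simpl in *; try discriminate (H eq_refl);
    rewrite ?comp_0l, ?comp_0r, ?comp_id_l, ?comp_id_r; reflexivity.
Defined.

(** Complementary windows split [X] in each degree; the connecting map is minus the differential
    crossing the cut. *)
Lemma win_tri (p q : Z -> bool) (X : complex)
  (Hp : forall n, p n = true -> p (n + 1)%Z = true)
  (Hq : forall n, q (n + 1)%Z = true -> q n = true) :
  (forall n, q n = negb (p n)) ->
  exists h, tri (t := K B) (win_in X Hp : @hom (K B) _ X) (win_out X Hq) h.
Proof.
  intro E.
  assert (Hh : forall n, cut (q (n + 1)%Z) (p (n + 1 + 1)%Z) (- dif X (n + 1)%Z)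
                o dif (win q X) n
              == dif (cshift_ob (win p X)) n
                o cut (q n) (p (n + 1)%Z) (- dif X n)).
  { intro n; simpl; rewrite !E.
    destruct (p n), (p (n + 1)%Z), (p (n + 1 + 1)%Z); simpl; expand; try reflexivity;
      rewrite dif_dif; expand; reflexivity. }
  exists (@ChainMap B (win q X) (cshift_ob (win p X)) _ Hh).
  apply (@semi_split_tri B B_bip (win p X) X (win q X) (win_in X Hp) (win_out X Hq) _
          (fun n => cut (q n) true (idm (X n))) (fun n => cut true (p n) (idm (X n)))).
  - intro n; simpl; rewrite E; destruct (p n); simpl; split; expand;
      try reflexivity; try apply zero_zero; apply hadd_0 || apply hadd_0l.
  - intro n; simpl; rewrite E; destruct (p n), (p (n + 1)%Z); simpl; expand;
      reflexivity.
Qed.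

Section Shifted.
Variables p p' : Z -> bool.
Hypothesis Hp' : forall n, p' (n + 1)%Z = p n.

Lemma compat_shift n : p' n = true -> p (n + 1)%Z = true -> p' (n + 1)%Z = p n.
Proof. intros _ _; apply Hp'. Qed.

(** Truncating X[1] to [p] amounts to shifting the truncation of [X] to [p']. This map, the identity
    where the windows meet, measures how far that is from shifting [win p X]. *)
Definition win_j (X : complex) : chain_map (win p' X) (win p X) :=
  win_map (cm_id X) compat_shift.

(* In degree [n] a cone of [X -> Y] involves [X] in degree [n + 1], hence its
   truncation to [p] is a cone of the truncations of [X] to [p'] and of [Y] to [p]. *)
Lemma win_cone (X Y C : complex) (u : chain_map X Y) (i : chain_map Y C)
    (q : chain_map C (cshift_ob X)) :
  is_cone u i q -> exists q' : chain_map (win p C) (cshift_ob (win p' X)),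
    (forall n, q' n == cut (p n) (p' (n + 1)%Z) (q n)) /\
    is_cone (win_map u compat_shift) (win_cm p i) q'.
Proof.
  intros (iX & pY & HC & HD).
  assert (Hq : forall n, cut (p (n + 1)%Z) (p' (n + 1 + 1)%Z) (q (n + 1)%Z)
                o dif (win p C) n
              == dif (cshift_ob (win p' X)) n
                o cut (p n) (p' (n + 1)%Z) (q n)).
  { intro n; simpl; rewrite !Hp'; pose proof (cm_dif q n) as E; simpl in E.
    destruct (p n), (p (n + 1)%Z); simpl; expand; try reflexivity.
    rewrite comp_opp_l in E; exact E. }
  exists (@ChainMap B (win p C) (cshift_ob (win p' X)) _ Hq).
  split; [intro n; reflexivity |].
  exists (fun n => cut (p' (n + 1)%Z) (p n) (iX n)), (fun n => cut (p n) (p n) (pY n)).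
  split; intro n; simpl; unfold win_fam; simpl; rewrite ?Hp'.
  - destruct (p n); simpl; [apply HC |].
    split; try apply zero_zero.
  - destruct (p n), (p (n + 1)%Z); simpl; expand; try reflexivity;
      try (symmetry; apply hadd_0).
    rewrite HD; expand; reflexivity.
Qed.

Lemma win_shift_dif (X : complex) n :
  cut (p (n + 1)%Z) (p' (n + 1 + 1)%Z) (idm (X (n + 1 + 1)%Z))
    o dif (win p (cshift_ob X)) n
  == dif (cshift_ob (win p' X)) n o cut (p n) (p' (n + 1)%Z) (idm (X (n + 1)%Z)).
Proof.
  simpl; rewrite !Hp'; destruct (p n), (p (n + 1)%Z); simpl; expand; reflexivity.
Qed.
Definition win_shift (X : complex) :
  chain_map (win p (cshift_ob X)) (cshift_ob (win p' X)) :=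
  @ChainMap B (win p (cshift_ob X)) (cshift_ob (win p' X)) _ (@win_shift_dif X).

Lemma win_shift_iso (X : complex) : is_iso (C := hcat B) (win_shift X).
Proof.
  apply complex_iso with
    (g := fun n => cut (p' (n + 1)%Z) (p n) (idm (X (n + 1)%Z))).
  intro n; simpl; rewrite Hp'; destruct (p n); simpl; split; expand;
    try reflexivity; apply zero_zero.
Qed.
End Shifted.

Lemma cut_comp (b c d : bool) (X Y V : B) (g : hom Y V) (f : hom X Y) :
  (b = true -> d = true -> c = true) ->
  cut c d g o cut b c f == cut b d (g o f).
Proof.
  intro H; destruct b, c, d; simpl; expand; try reflexivity;
    discriminate (H eq_refl eq_refl).
Qed.
Lemma cut_heq (b c : bool) (X Y : B) (f g : hom X Y) : f == g -> cut b c f == cut b c g.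
Proof. intro E; destruct b, c; simpl; try reflexivity; exact E. Qed.
Lemma cut_add (b c : bool) (X Y : B) (f g : hom X Y) :
  cut b c (f + g) == cut b c f + cut b c g.
Proof. destruct b, c; simpl; expand; try rewrite hadd_0; reflexivity. Qed.
Lemma cut_id (b : bool) (X : B) : cut b b (idm X) == idm _.
Proof. destruct b; simpl; [reflexivity | apply zero_zero]. Qed.

Definition ge (m n : Z) : bool := Z.leb m n.
Definition le (m n : Z) : bool := Z.leb n m.

Lemma ge_up m n : ge m n = true -> ge m (n + 1) = true.
Proof. unfold ge; lia. Qed.
Lemma le_down m n : le m (n + 1) = true -> le m n = true.
Proof. unfold le; lia. Qed.
Lemma le_ge m n : le m n = negb (ge (m + 1) n).
Proof. unfold le, ge; lia. Qed.
Lemma ge_shift m n : ge (m + 1) (n + 1) = ge m n.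
Proof. unfold ge; lia. Qed.
Lemma le_shift m n : le (m + 1) (n + 1) = le m n.
Proof. unfold le; lia. Qed.

Lemma factor_le (X Y : complex) (e : chain_map X Y) m :
  (forall n, (m < n)%Z -> e n == 0) ->
  exists e' : chain_map (win (le m) X) Y,
    homotopic e (cm_comp e' (win_out X (@le_down m))).
Proof.
  intro H.
  assert (E : forall n, cut (le m (n + 1)) true (e (n + 1)%Z) o dif (win (le m) X) n
                == dif Y n o cut (le m n) true (e n)).
  { intro n; simpl; pose proof (@le_down m n) as L.
    destruct (le m n) eqn:E1, (le m (n + 1)) eqn:E2; simpl; expand;
      try reflexivity; try discriminate (L eq_refl); [apply cm_dif |].
    rewrite <- (cm_dif e n), H; [symmetry; apply comp_0l | unfold le in *; lia]. }
  exists (@ChainMap B (win (le m) X) Y _ E); apply homotopic_ext; intro n; simpl.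
  destruct (le m n) eqn:E1; simpl; expand; [reflexivity |].
  apply H; unfold le in E1; lia.
Qed.

Lemma factor_ge (X Y : complex) (e : chain_map X Y) m :
  (forall n, (n < m)%Z -> e n == 0) ->
  exists e' : chain_map X (win (ge m) Y),
    homotopic e (cm_comp (win_in Y (@ge_up m)) e').
Proof.
  intro H.
  assert (E : forall n, cut true (ge m (n + 1)) (e (n + 1)%Z) o dif X n
                == dif (win (ge m) Y) n o cut true (ge m n) (e n)).
  { intro n; simpl; pose proof (@ge_up m n) as L.
    destruct (ge m n) eqn:E1, (ge m (n + 1)) eqn:E2; simpl; expand;
      try reflexivity; try discriminate (L eq_refl); [apply cm_dif |].
    rewrite (cm_dif e n), H; [apply comp_0r | unfold ge in *; lia]. }
  exists (@ChainMap B X (win (ge m) Y) _ E); apply homotopic_ext; intro n; simpl.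
  destruct (ge m n) eqn:E1; simpl; expand; [reflexivity |].
  apply H; unfold ge in E1; lia.
Qed.

(* Truncating a homotopy leaves an error in the extremal degree only. *)
Lemma homotopic_ge (X Y : complex) (f g : chain_map X Y) m :
  homotopic f g -> exists e : chain_map (win (ge m) X) (win (ge m) Y),
    homotopic (win_cm (ge m) f) (cm_add (win_cm (ge m) g) e) /\
    forall n, (m < n)%Z -> e n == 0.
Proof.
  intros [h H].
  pose (k n := cut (ge m (n + 1)) (ge m n) (h n)).
  (* In degree [m] the truncated homotopy loses the term [d h] that passes through degree [m - 1];
     this term is the error. *)
  pose (e0 := unshift_family (F := fun n => hom (win (ge m) X n) (win (ge m) Y n))
     (fun n => cut (ge m (n + 1)) (ge m (n + 1)) (if ge m n then 0 else dif Y n o h n))).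
  destruct e0 as [e He].
  assert (E : forall n, win_cm (ge m) f (n + 1)%Z == win_cm (ge m) g (n + 1)%Z + e (n + 1)%Z
      + (dif (win (ge m) Y) n o k n + k (n + 1)%Z o dif (win (ge m) X) (n + 1)%Z)).
  { intro n; rewrite He; unfold k; simpl; unfold win_fam.
    pose proof (@ge_up m n) as L1; pose proof (@ge_up m (n + 1)%Z) as L2.
    destruct (ge m n), (ge m (n + 1)), (ge m (n + 1 + 1)); simpl;
      try discriminate (L1 eq_refl); try discriminate (L2 eq_refl);
      try rewrite H; expand; abel. }
  assert (De : forall n, e (n + 1)%Z o dif (win (ge m) X) n == dif (win (ge m) Y) n o e n).
  { apply forall_shift; intro n.
    apply (hadd_inj (h := win_cm (ge m) g (n + 1 + 1)%Z o dif (win (ge m) X) (n + 1)%Z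
      + dif (win (ge m) Y) (n + 1)%Z o k (n + 1)%Z o dif (win (ge m) X) (n + 1)%Z)).
    transitivity (win_cm (ge m) f (n + 1 + 1)%Z o dif (win (ge m) X) (n + 1)%Z).
    - rewrite E; expand.
      rewrite <- (comp_assoc _ (dif _ (n + 1 + 1)) (dif _ (n + 1))), dif_dif.
      expand; abel.
    - rewrite cm_dif, E, (cm_dif (win_cm (ge m) g) (n + 1)%Z); expand.
      rewrite dif_dif; expand; abel. }
  exists (ChainMap De); split.
  - exists k; exact E.
  - apply (@forall_shift (fun n => (m < n)%Z -> ChainMap De n == 0)); intros n Hn; simpl.
    rewrite He; replace (ge m n) with true by (unfold ge; lia).
    destruct (ge m (n + 1)); simpl; reflexivity.
Qed.

Lemma homotopic_le (X Y : complex) (f g : chain_map X Y) m :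
  homotopic f g -> exists e : chain_map (win (le m) X) (win (le m) Y),
    homotopic (win_cm (le m) f) (cm_add (win_cm (le m) g) e) /\
    forall n, (n < m)%Z -> e n == 0.
Proof.
  intros [h H].
  pose (k n := cut (le m (n + 1)) (le m n) (h n)).
  (* Here the term lost in degree [m] is [h d], which passes through degree [m + 1]. *)
  pose (e0 := unshift_family (F := fun n => hom (win (le m) X n) (win (le m) Y n))
     (fun n => cut (le m (n + 1)) (le m (n + 1))
        (if le m (n + 1 + 1) then 0 else h (n + 1)%Z o dif X (n + 1)%Z))).
  destruct e0 as [e He].
  assert (E : forall n, win_cm (le m) f (n + 1)%Z == win_cm (le m) g (n + 1)%Z + e (n + 1)%Z
      + (dif (win (le m) Y) n o k n + k (n + 1)%Z o dif (win (le m) X) (n + 1)%Z)).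
  { intro n; rewrite He; unfold k; simpl; unfold win_fam.
    pose proof (@le_down m n) as L1; pose proof (@le_down m (n + 1)%Z) as L2.
    destruct (le m n), (le m (n + 1)), (le m (n + 1 + 1)); simpl;
      try discriminate (L1 eq_refl); try discriminate (L2 eq_refl);
      try rewrite H; expand; abel. }
  assert (De : forall n, e (n + 1)%Z o dif (win (le m) X) n == dif (win (le m) Y) n o e n).
  { apply forall_shift; intro n.
    apply (hadd_inj (h := win_cm (le m) g (n + 1 + 1)%Z o dif (win (le m) X) (n + 1)%Z
      + dif (win (le m) Y) (n + 1)%Z o k (n + 1)%Z o dif (win (le m) X) (n + 1)%Z)).
    transitivity (win_cm (le m) f (n + 1 + 1)%Z o dif (win (le m) X) (n + 1)%Z).
    - rewrite E; expand.
      rewrite <- (comp_assoc _ (dif _ (n + 1 + 1)) (dif _ (n + 1))), dif_dif.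
      expand; abel.
    - rewrite cm_dif, E, (cm_dif (win_cm (le m) g) (n + 1)%Z); expand.
      rewrite dif_dif; expand; abel. }
  exists (ChainMap De); split.
  - exists k; exact E.
  - apply (@forall_shift (fun n => (n < m)%Z -> ChainMap De n == 0)); intros n Hn; simpl.
    rewrite He; replace (le m (n + 1 + 1)) with true by (unfold le; lia).
    destruct (le m (n + 1)); simpl; reflexivity.
Qed.
End Windows.

(** * Complexes near an end of Z *)

Section Germs.
Variable B : preadditive.
Notation complex := (complex B).

(* [ev] is a filter of properties holding in almost all degrees near an end of Z.
   Chain maps up to homotopy, near that end, form a quotient of K(B) in which the
   maps with bounded cone are invertible; it detects the objects which vanish in
   K^{+,b}/K^b or K^{-,b}/K^b without a calculus of fractions. *)
Variable ev : (Z -> Prop) -> Prop.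
Hypothesis ev_all : forall P : Z -> Prop, (forall n, P n) -> ev P.
Hypothesis ev_and : forall P Q R : Z -> Prop,
  (forall n, P n -> Q n -> R n) -> ev P -> ev Q -> ev R.
Hypothesis ev_shift : forall P : Z -> Prop, ev P -> ev (fun n => P (n + 1)%Z).

Lemma ev_map (P Q : Z -> Prop) : (forall n, P n -> Q n) -> ev P -> ev Q.
Proof. intros H HP; exact (ev_and (fun n HP _ => H n HP) HP HP). Qed.

Record germ (X Y : complex) := Germ {
  gm :> forall n, hom (X n) (Y n);
  gm_dif : ev (fun n => gm (n + 1)%Z o dif X n == dif Y n o gm n)
}.

Definition germ_eq (X Y : complex) (f g : germ X Y) : Prop :=
  exists h : forall n, hom (X (n + 1)%Z) (Y n), ev (fun n => f (n + 1)%Z ==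
    g (n + 1)%Z + (dif Y n o h n + h (n + 1)%Z o dif X (n + 1)%Z)).

Definition germ_of (X Y : complex) (f : chain_map X Y) : germ X Y :=
  Germ (ev_all (cm_dif f)).

Lemma germ_ext (X Y : complex) (f g : germ X Y) :
  ev (fun n => f n == g n) -> germ_eq f g.
Proof.
  intro H; exists (fun n => 0); refine (ev_map _ (ev_shift H)).
  intros n E; rewrite E; expand; abel.
Qed.

Definition germ_comp (X Y V : complex) (g : germ Y V) (f : germ X Y) : germ X V.
Proof.
  refine (@Germ X V (fun n => g n o f n) _).
  refine (ev_and _ (gm_dif g) (gm_dif f)); intros n E1 E2.
  expand; crw E2; expand; rewrite E1; reflexivity.
Defined.
Definition germ_add (X Y : complex) (f g : germ X Y) : germ X Y.
Proof.
  refine (@Germ X Y (fun n => f n + g n) _).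
  refine (ev_and _ (gm_dif f) (gm_dif g)); intros n E1 E2.
  expand; rewrite E1, E2; reflexivity.
Defined.
Definition germ_opp (X Y : complex) (f : germ X Y) : germ X Y.
Proof.
  refine (@Germ X Y (fun n => - f n) _).
  refine (ev_map _ (gm_dif f)); intros n E1; expand; rewrite E1; reflexivity.
Defined.

Lemma germ_equiv (X Y : complex) : Equivalence (@germ_eq X Y).
Proof.
  split.
  - intro f; apply germ_ext, ev_all; reflexivity.
  - intros f g [h H]; exists (fun n => - h n); refine (ev_map _ H).
    intros n E; rewrite E; expand; abel.
  - intros f g k [h H] [h' H']; exists (fun n => h n + h' n); refine (ev_and _ H H').
    intros n E E'; rewrite E, E'; expand; abel.
Qed.

Lemma germ_comp_eq (X Y V : complex) (g g' : germ Y V) (f f' : germ X Y) :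
  germ_eq g g' -> germ_eq f f' -> germ_eq (germ_comp g f) (germ_comp g' f').
Proof.
  intros [k K] [h H].
  exists (fun n => g n o h n + k n o f' (n + 1)%Z).
  assert (H1 := ev_and (fun n a b => conj a b) H K).
  assert (H2 := ev_and (fun n a b => conj a b) (gm_dif g) (ev_shift (gm_dif f'))).
  refine (ev_and _ H1 H2); intros n [E1 E2] [E3 E4]; simpl.
  rewrite E1; expand; rewrite <- E3.
  rewrite <- (comp_assoc _ (f' _)), E4, E2; expand; abel.
Qed.

Lemma germ_add_eq (X Y : complex) (f f' g g' : germ X Y) :
  germ_eq f f' -> germ_eq g g' -> germ_eq (germ_add f g) (germ_add f' g').
Proof.
  intros [h H] [k K]; exists (fun n => h n + k n); refine (ev_and _ H K).
  intros n E1 E2; simpl; rewrite E1, E2; expand; abel.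
Qed.

Definition germ_cat : preadditive.
Proof.
  refine {| ob := complex; hom := germ; heq := germ_eq;
    idm X := germ_of (cm_id X); comp := germ_comp;
    hzero X Y := germ_of (cm_zero X Y); hadd := germ_add; hopp := germ_opp;
    heq_equiv := germ_equiv; comp_heq := germ_comp_eq; hadd_heq := germ_add_eq |};
  intros; apply germ_ext, ev_all; intro; cbn; expand; try reflexivity; abel.
Defined.

Definition germ_functor : functor (hcat B) germ_cat.
Proof.
  refine (@Functor (hcat B) germ_cat (fun X => X) germ_of _ _ _ _);
    intros; try (apply germ_ext, ev_all; intro; cbn; reflexivity).
  match goal with H : _ == _ |- _ => destruct H as [h H] end.
  exists h; apply ev_all; exact H.
Defined.

(** Where [X] vanishes, the cone is [Y] and the projection [pY] commutes with the differentials; it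
    is thus inverse to [i] as a germ. *)
Lemma germ_cone_iso (X Y C : complex) (w : chain_map X Y) (i : chain_map Y C)
    (p : chain_map C (cshift_ob X)) :
  is_cone w i p -> ev (fun n => is_zero (X n)) -> is_iso (C := germ_cat) (germ_of i).
Proof.
  intros (iX & pY & HC & HD) HX.
  assert (D : ev (fun n => pY (n + 1)%Z o dif C n == dif Y n o pY n)).
  { refine (ev_map _ (ev_shift HX)); intros n Hn.
    apply (bip_ext_from (HC n)).
    - etransitivity; [| symmetry]; apply zero_from, Hn.
    - expand; rewrite <- (comp_assoc _ (dif C n)), <- (cm_dif i n).
      crw (bip_YY (HC n)); expand; rewrite (bip_YY (HC (n + 1)%Z)); expand; reflexivity. }
  exists (Germ D); split; apply germ_ext; cbn.
  - apply ev_all; intro n; apply (bip_YY (HC n)).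
  - refine (ev_map _ (ev_shift HX)); intros n Hn.
    rewrite <- (bip_id (HC n)), (zero_to (p n) Hn); expand; abel.
Qed.
End Germs.

Definition ev_above (P : Z -> Prop) : Prop := exists m, forall n, (m <= n)%Z -> P n.
Definition ev_below (P : Z -> Prop) : Prop := exists m, forall n, (n <= m)%Z -> P n.

Lemma ev_above_all (P : Z -> Prop) : (forall n, P n) -> ev_above P.
Proof. intro H; exists 0%Z; auto. Qed.
Lemma ev_below_all (P : Z -> Prop) : (forall n, P n) -> ev_below P.
Proof. intro H; exists 0%Z; auto. Qed.
Lemma ev_above_and (P Q R : Z -> Prop) :
  (forall n, P n -> Q n -> R n) -> ev_above P -> ev_above Q -> ev_above R.
Proof.
  intros H [m HP] [k HQ]; exists (Z.max m k); intros n Hn.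
  apply H; [apply HP | apply HQ]; lia.
Qed.
Lemma ev_below_and (P Q R : Z -> Prop) :
  (forall n, P n -> Q n -> R n) -> ev_below P -> ev_below Q -> ev_below R.
Proof.
  intros H [m HP] [k HQ]; exists (Z.min m k); intros n Hn.
  apply H; [apply HP | apply HQ]; lia.
Qed.
Lemma ev_above_shift (P : Z -> Prop) : ev_above P -> ev_above (fun n => P (n + 1)%Z).
Proof. intros [m H]; exists m; intros n Hn; apply H; lia. Qed.
Lemma ev_below_shift (P : Z -> Prop) : ev_below P -> ev_below (fun n => P (n + 1)%Z).
Proof. intros [m H]; exists (m - 1)%Z; intros n Hn; apply H; lia. Qed.

(** * Complexes contractible near an end *)

Section Contraction.
Variables (B : preadditive) (O : B).
Hypothesis HO : is_zero O.
Hypothesis B_bip : has_biproducts B.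
Notation complex := (complex B).

(** The contraction makes the inclusion of the part in degrees above [m] null-homotopic, so in the
    truncation triangle the identity of [X] factors through the part in degrees at most [m]. *)
Lemma contraction_ge (X : complex) (h : forall n, hom (X (n + 1)%Z) (X n)) m :
  (forall n, (m <= n)%Z -> idm (X (n + 1)%Z) ==
     dif X n o h n + h (n + 1)%Z o dif X (n + 1)%Z) ->
  retract_of (C := hcat B) X (win O (le m) X).
Proof.
  intro H.
  destruct (@win_tri B O HO B_bip (ge (m + 1)) (le m) X (@ge_up (m + 1)) (@le_down m)
    (le_ge m)) as [k T].
  assert (E : homotopic (win_in O X (@ge_up (m + 1))) (cm_zero (win O (ge (m + 1)) X) X)).
  (* Only the source of the homotopy is truncated: it takes values in [X] itself, so no term is lost
     at the cut. *)
  { exists (fun n => cut O (ge (m + 1) (n + 1)) true (h n)); intro n; simpl.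
    pose proof (@ge_up (m + 1) (n + 1)%Z) as L.
    destruct (ge (m + 1) (n + 1)) eqn:E1, (ge (m + 1) (n + 1 + 1)); simpl;
      try discriminate (L eq_refl); expand; try abel.
    rewrite H; [abel | unfold ge in E1; lia]. }
  destruct (tri_weak_coker (K_pretriangulated (ex_intro _ O HO) B_bip)
    (t := idm (X : K B)) T) as [r Hr].
  { rewrite comp_id_l; exact E. }
  exists (win_out O X (@le_down m) : @hom (hcat B) X _), r; exact Hr.
Qed.

Lemma contraction_le (X : complex) (h : forall n, hom (X (n + 1)%Z) (X n)) m :
  (forall n, (n <= m)%Z -> idm (X (n + 1)%Z) ==
     dif X n o h n + h (n + 1)%Z o dif X (n + 1)%Z) ->
  retract_of (C := hcat B) X (win O (ge (m + 1)) X).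
Proof.
  intro H.
  destruct (@win_tri B O HO B_bip (ge (m + 1)) (le m) X (@ge_up (m + 1)) (@le_down m)
    (le_ge m)) as [k T].
  assert (E : homotopic (win_out O X (@le_down m)) (cm_zero X (win O (le m) X))).
  { exists (fun n => cut O true (le m n) (h n)); intro n; simpl.
    pose proof (@le_down m n) as L.
    destruct (le m (n + 1)) eqn:E1, (le m n); simpl;
      try discriminate (L eq_refl); expand; try abel.
    rewrite H; [abel | unfold le in E1; lia]. }
  destruct (tri_weak_ker (K_pretriangulated (ex_intro _ O HO) B_bip)
    (t := idm (X : K B)) T) as [r Hr].
  { rewrite comp_id_r; exact E. }
  exists r, (win_in O X (@ge_up (m + 1)) : @hom (hcat B) _ X); exact Hr.
Qed.
End Contraction.

Lemma zero_full_sub (A : preadditive) (B : A -> Prop) (X : full_sub B) :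
  is_zero X <-> is_zero (proj1_sig X).
Proof.
  split; intro H; apply zero_id.
  - exact (zero_to (idm X) H).
  - exact (zero_to (idm (proj1_sig X)) H).
Qed.

(* The exactness of a complex over [full_sub B], expressed inside [full_sub B]. *)
Record exactness (A : preadditive) (B : A -> Prop)
    (ex : forall X Y V : full_sub B, hom X Y -> hom Y V -> Prop) : Prop := {
  ex_spec : forall (X : complex (full_sub B)) n,
    H_vanishes (underlying X) n <-> ex _ _ _ (dif X n) (dif X (n + 1)%Z);
  ex_zero : forall (X Y V : full_sub B) (f : hom X Y) (g : hom Y V),
    is_zero Y -> ex _ _ _ f g;
  ex_iso : forall (X Y V X' Y' V' : full_sub B) (f : hom X Y) (g : hom Y V)
    (f' : hom X' Y') (g' : hom Y' V') (a : hom X X') (b : hom Y Y') (c : hom V V'),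
    is_iso a -> is_iso b -> is_iso c -> b o f == f' o a -> c o g == g' o b ->
    ex _ _ _ f g -> ex _ _ _ f' g';
  ex_cone : forall (X Y C : complex (full_sub B)) (u : chain_map X Y)
    (i : chain_map Y C) (p : chain_map C (cshift_ob X)) n,
    is_cone u i p ->
    ex _ _ _ (dif X (n + 1)%Z) (dif X (n + 1 + 1)%Z) ->
    ex _ _ _ (dif Y n) (dif Y (n + 1)%Z) ->
    ex _ _ _ (dif C n) (dif C (n + 1)%Z)
}.

(** * Functors into a Verdier quotient *)

Section VerdierEquations.
Variables (D : tricat) (N : tsub D).
Lemma vproj_heq (X Y : D) (f g : hom X Y) :
  f == g -> @heq (vcat N) X Y (vincl N f) (vincl N g).
Proof. apply veq_vincl. Qed.
Lemma vproj_comp (X Y V : D) (g : hom Y V) (f : hom X Y) (k : hom X V) :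
  g o f == k -> @heq (vcat N) X V (@comp (vcat N) X Y V (vincl N g) (vincl N f)) (vincl N k).
Proof. intro E; etransitivity; [symmetry; apply veq_vincl_comp | apply veq_vincl, E]. Qed.
Lemma vproj_square (X Y Y' V : D) (g : hom Y V) (f : hom X Y) (g' : hom Y' V)
    (f' : hom X Y') :
  g o f == g' o f' ->
  @heq (vcat N) X V (@comp (vcat N) X Y V (vincl N g) (vincl N f))
                    (@comp (vcat N) X Y' V (vincl N g') (vincl N f')).
Proof.
  intro E; etransitivity; [apply vproj_comp, E | apply veq_vincl_comp].
Qed.
Lemma vproj_precomp (W V X Y : D) (t : hom X Y) (k : hom W X) (h : hom V X) (d : hom W V) :
  @heq (vcat N) W X (@comp (vcat N) W V X (vincl N h) (vincl N d)) (vincl N k) ->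
  @heq (vcat N) W Y (@comp (vcat N) W X Y (vincl N t) (vincl N k))
                    (@comp (vcat N) W V Y (vincl N (t o h)) (vincl N d)).
Proof.
  intro E; rewrite <- (vproj_comp (reflexivity (t o h))).
  rewrite <- comp_assoc, E; reflexivity.
Qed.
Lemma vproj_add (X Y : D) (f g h : hom X Y) :
  f + g == h -> @heq (vcat N) X Y (@hadd (vcat N) X Y (vincl N f) (vincl N g)) (vincl N h).
Proof. intro E; etransitivity; [symmetry; apply veq_vincl_add | apply veq_vincl, E]. Qed.
Lemma vincl_iso (X Y : D) (s : hom X Y) :
  cone_in N s -> @is_iso (vcat N) X Y (vincl N s).
Proof. apply vproj_iso. Qed.
Lemma vincl_iso' (X Y : D) (s : hom X Y) :
  is_iso s -> @is_iso (vcat N) X Y (vincl N s).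
Proof. exact (fmap_iso (vproj N) (f := s)). Qed.

Section FunctorToQuotient.
Variables (T : tricat) (w : T -> D) (wmap : forall X Y : T, hom X Y -> hom (w X) (w Y)).
Variable th : forall X : T, hom (w (shift X)) (shift (w X)).
Hypothesis w_heq : forall (X Y : T) (f g : hom X Y), f == g ->
  @heq (vcat N) (w X) (w Y) (vincl N (wmap f)) (vincl N (wmap g)).
Hypothesis w_id : forall X : T, wmap (idm X) == idm (w X).
Hypothesis w_comp : forall (X Y V : T) (g : hom Y V) (f : hom X Y),
  wmap g o wmap f == wmap (g o f).
Hypothesis w_add : forall (X Y : T) (f g : hom X Y), wmap f + wmap g == wmap (f + g).
Hypothesis th_iso : forall X, @is_iso (vcat N) _ _ (vincl N (th X)).
Hypothesis th_nat : forall (X Y : T) (f : hom X Y),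
  th Y o wmap (fmap shift f) == fmap shift (wmap f) o th X.
Hypothesis PT : pretriangulated T.
Hypothesis w_cone : forall (X Y : T) (f : hom X Y),
  exists (V : T) (i : hom Y V) (q : hom V (shift X)), tri f i q /\
  exists (X' : D) (j : hom X' (w X)) (f' : hom X' (w Y)) (q' : hom (w V) (shift X')),
    tri f' (wmap i) q' /\ cone_in N j /\ wmap f o j == f' /\
    fmap shift j o q' == th X o wmap q.

Definition functor_to_quotient : functor T (vcat N) :=
  @Functor T (vcat N) w (fun X Y f => vincl N (wmap f)) w_heq
    (fun X => vproj_heq (w_id X))
    (fun X Y V g f => symmetry (vproj_comp (w_comp g f)))
    (fun X Y f g => symmetry (vproj_add (w_add f g))).

(** Cones are unique, so one triangle on each [f] suffices. By [w_cone] the image of that one is a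
    triangle once its source [w X] is replaced by [X'], and [j] becomes invertible in the
    quotient. *)
Lemma tri_to_quotient (X Y V : T) (f : hom X Y) (g : hom Y V) (h : hom V (shift X)) :
  tri f g h -> @tri (verdier N) (w X) (w Y) (w V) (vincl N (wmap f)) (vincl N (wmap g))
    (vincl N (th X o wmap h)).
Proof.
  intro H.
  destruct (w_cone f) as (V0 & i & q & H0 & X' & j & f' & q' & H' & Hj & E1 & E2).
  destruct (tri_unique PT H0 H) as (c & Hc & E3 & E4).
  exists X', (w Y), (w V0), f', (wmap i), q'; split; [exact H' |].
  apply tri_iso_sym; exists (vincl N j), (vincl N (idm (w Y))), (vincl N (wmap c)).
  split; [apply vproj_iso, Hj |].
  split; [apply vincl_iso', is_iso_id |].
  split; [exact (fmap_iso functor_to_quotient Hc) |].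
  split; [| split].
  - apply vproj_square; rewrite comp_id_l; symmetry; exact E1.
  - etransitivity; [apply vproj_comp, w_comp |].
    etransitivity; [apply w_heq, E3 | symmetry; apply vproj_comp, comp_id_r].
  - etransitivity; [exact (vproj_square E2) | apply vproj_precomp].
    etransitivity; [apply vproj_comp, w_comp | apply w_heq; symmetry; exact E4].
Qed.

Definition tri_functor_to_quotient : tri_functor T (verdier N).
Proof.
  refine (@TriFunctor T (verdier N) functor_to_quotient (fun X => vincl N (th X))
    th_iso (fun X Y f => vproj_square (th_nat f)) _).
  intros X Y V f g h H; refine (tri_closed _ (tri_to_quotient H)).
  apply tri_iso_heq; try reflexivity; apply vproj_comp; reflexivity.
Defined.
End FunctorToQuotient.
End VerdierEquations.

(** * Closure properties of the classes of complexes *)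

Section Classes.
Variables (A : preadditive) (B : A -> Prop).
Notation C := (full_sub B).
Notation complex := (complex C).
Variable O : C.
Hypothesis HO : is_zero O.
Hypothesis C_bip : has_biproducts C.
Variable ex : forall X Y V : C, hom X Y -> hom Y V -> Prop.
Hypothesis EX : exactness ex.

Lemma PK : pretriangulated (K C).
Proof. exact (K_pretriangulated (ex_intro _ O HO) C_bip). Qed.

Record good (Q : tsub (K C)) : Prop := {
  good_zero : Q (zero_complex O);
  good_unshift : forall X, Q X -> Q (unshift_ob X);
  good_cone : forall (X Y V : complex) (u : chain_map X Y) (i : chain_map Y V)
    (p : chain_map V (cshift_ob X)), is_cone u i p -> Q X -> Q Y -> Q V
}.

Lemma good_pretriangulated (Q : tsub (K C)) : good Q -> pretriangulated (sub_tricat Q).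
Proof.
  intros [H1 H2 H3]; apply pretriangulated_sub.
  - exact PK.
  - exists (zero_complex O); split; [apply zero_complex_zero, HO | exact H1].
  - intros X HX; exists (unshift_ob X); split; [apply H2, HX | apply unshift_iso].
  - intros X Y f HX HY; destruct (cone_exists C_bip f) as (V & i & p & H).
    exists V, i, p; split; [exact (H3 _ _ _ _ _ _ H HX HY) | apply cone_tri, H].
Qed.

Lemma H_vanishes_zero (X : complex) n :
  is_zero (X (n + 1)%Z) -> H_vanishes (underlying X) n.
Proof. intro H; apply (ex_spec EX), (ex_zero EX), H. Qed.

Lemma H_vanishes_unshift (X : complex) n :
  H_vanishes (underlying X) n -> H_vanishes (underlying (unshift_ob X)) (n + 1)%Z.
Proof.
  rewrite !(ex_spec EX).
  assert (e0 : (n = n + 1 - 1)%Z) by lia.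
  assert (e1 : (n + 1 = n + 1 + 1 - 1)%Z) by lia.
  assert (e2 : (n + 1 + 1 = n + 1 + 1 + 1 - 1)%Z) by lia.
  assert (e3 : (n + 1 = n + 1 - 1 + 1)%Z) by lia.
  assert (e4 : (n + 1 + 1 = n + 1 + 1 - 1 + 1)%Z) by lia.
  assert (I : forall a b (e : a = b), is_iso (cst X e)) by (intros a b []; apply is_iso_id).
  (* The differential of [unshift_ob] carries a sign; a sign on the middle isomorphism makes both
     squares commute. *)
  apply (ex_iso EX (a := cst X e0) (b := - cst X e1) (c := cst X e2));
    [apply I | apply is_iso_opp, I | apply I | |]; simpl; expand.
  - rewrite <- (comp_assoc _ (dif X _)), (cst_nat (dif X) e0 e3); expand.
    rewrite (cst_comp _ _ _ e1); reflexivity.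
  - rewrite <- (comp_assoc _ (dif X _)), (cst_nat (dif X) e1 e4); expand.
    rewrite (cst_comp _ _ _ e2); reflexivity.
Qed.

Lemma H_vanishes_cone (X Y V : complex) (u : chain_map X Y) (i : chain_map Y V)
    (p : chain_map V (cshift_ob X)) n :
  is_cone u i p -> H_vanishes (underlying X) (n + 1)%Z -> H_vanishes (underlying Y) n ->
  H_vanishes (underlying V) n.
Proof. rewrite !(ex_spec EX); apply (ex_cone EX). Qed.

Lemma cone_zero (X Y V : complex) (u : chain_map X Y) (i : chain_map Y V)
    (p : chain_map V (cshift_ob X)) n :
  is_cone u i p -> is_zero (X (n + 1)%Z) -> is_zero (Y n) -> is_zero (V n).
Proof.
  intros (iX & pY & HC & HD) H1 H2; apply zero_id.
  rewrite <- (bip_id (HC n)), (zero_to (p n) H1), (zero_to (pY n) H2), !comp_0r.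
  apply hadd_0.
Qed.

Lemma bounded_below_iff (X : complex) :
  bounded_below X <-> exists m, forall n, (n < m)%Z -> is_zero (X n).
Proof. split; intros [m H]; exists m; intros n Hn; apply zero_full_sub, H, Hn. Qed.
Lemma bounded_above_iff (X : complex) :
  bounded_above X <-> exists m, forall n, (m < n)%Z -> is_zero (X n).
Proof. split; intros [m H]; exists m; intros n Hn; apply zero_full_sub, H, Hn. Qed.

Definition closed_unshift (P : complex -> Prop) := forall X, P X -> P (unshift_ob X).
Definition closed_cone (P : complex -> Prop) :=
  forall (X Y V : complex) (u : chain_map X Y) (i : chain_map Y V)
    (p : chain_map V (cshift_ob X)), is_cone u i p -> P X -> P Y -> P V.

Lemma bounded_below_unshift : closed_unshift (@bounded_below A B).
Proof. intros X [m H]; exists (m + 1)%Z; intros n Hn; apply H; lia. Qed.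
Lemma bounded_above_unshift : closed_unshift (@bounded_above A B).
Proof. intros X [m H]; exists (m + 1)%Z; intros n Hn; apply H; lia. Qed.
Lemma bounded_homology_unshift : closed_unshift (@bounded_homology A B).
Proof.
  intros X [m H]; exists (m + 1)%Z.
  apply (@forall_shift (fun n => (m + 1 < Z.abs (n + 1))%Z -> H_vanishes _ n)).
  intros n Hn; apply H_vanishes_unshift, H; lia.
Qed.
Lemma acyclic_unshift : closed_unshift (@acyclic A B).
Proof.
  intros X H; refine (@forall_shift (H_vanishes (underlying (unshift_ob X))) _).
  intros n; apply H_vanishes_unshift, H.
Qed.

Lemma bounded_below_cone : closed_cone (@bounded_below A B).
Proof.
  intros X Y V u i p H; rewrite !bounded_below_iff; intros [m H1] [k H2].
  exists (Z.min (m - 1) k); intros n Hn.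
  apply (cone_zero H); [apply H1 | apply H2]; lia.
Qed.
Lemma bounded_above_cone : closed_cone (@bounded_above A B).
Proof.
  intros X Y V u i p H; rewrite !bounded_above_iff; intros [m H1] [k H2].
  exists (Z.max m k); intros n Hn.
  apply (cone_zero H); [apply H1 | apply H2]; lia.
Qed.
Lemma bounded_homology_cone : closed_cone (@bounded_homology A B).
Proof.
  intros X Y V u i p H [m H1] [k H2]; exists (Z.max (m + 1) k); intros n Hn.
  apply (H_vanishes_cone H); [apply H1 | apply H2]; lia.
Qed.
Lemma acyclic_cone : closed_cone (@acyclic A B).
Proof. intros X Y V u i p H H1 H2 n; apply (H_vanishes_cone H); auto. Qed.

Lemma zero_bounded_below : bounded_below (zero_complex O : complex).
Proof. exists 0%Z; intros n _; apply zero_full_sub, HO. Qed.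
Lemma zero_bounded_above : bounded_above (zero_complex O : complex).
Proof. exists 0%Z; intros n _; apply zero_full_sub, HO. Qed.
Lemma zero_acyclic : acyclic (zero_complex O : complex).
Proof. intro n; apply H_vanishes_zero, HO. Qed.
Lemma acyclic_bounded_homology (X : complex) : acyclic X -> bounded_homology X.
Proof. intro H; exists 0%Z; intros n _; apply H. Qed.

Lemma good_Kib : good (Kib B).
Proof.
  split; [apply acyclic_bounded_homology, zero_acyclic | exact bounded_homology_unshift |].
  exact bounded_homology_cone.
Qed.
Lemma good_Kac : good (Kac B).
Proof. split; [exact zero_acyclic | exact acyclic_unshift | exact acyclic_cone]. Qed.
Lemma good_Kpb : good (Kpb B).
Proof.
  split.
  - exact (conj zero_bounded_below (good_zero good_Kib)).
  - intros X [H1 H2]; exact (conj (bounded_below_unshift H1) (bounded_homology_unshift H2)).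
  - intros X Y V u i p H [H1 H2] [H3 H4].
    exact (conj (bounded_below_cone H H1 H3) (bounded_homology_cone H H2 H4)).
Qed.
Lemma good_Kmb : good (Kmb B).
Proof.
  split.
  - exact (conj zero_bounded_above (good_zero good_Kib)).
  - intros X [H1 H2]; exact (conj (bounded_above_unshift H1) (bounded_homology_unshift H2)).
  - intros X Y V u i p H [H1 H2] [H3 H4].
    exact (conj (bounded_above_cone H H1 H3) (bounded_homology_cone H H2 H4)).
Qed.
Lemma good_Kb : good (Kb B).
Proof.
  split.
  - exact (conj zero_bounded_below zero_bounded_above).
  - intros X [H1 H2]; exact (conj (bounded_below_unshift H1) (bounded_above_unshift H2)).
  - intros X Y V u i p H [H1 H2] [H3 H4].
    exact (conj (bounded_below_cone H H1 H3) (bounded_above_cone H H2 H4)).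
Qed.

Lemma Kb_homology (X : complex) : Kb B X -> bounded_homology X.
Proof.
  intros [H1 H2]; rewrite bounded_below_iff in H1; rewrite bounded_above_iff in H2.
  destruct H1 as [m H1], H2 as [k H2]; exists (Z.max (- m) k); intros n Hn.
  apply H_vanishes_zero.
  destruct (Z_lt_le_dec (n + 1) m); [apply H1 | apply H2]; lia.
Qed.

Notation win := (win O).

Lemma win_homology_ge (X : complex) m : bounded_homology X -> bounded_homology (win (ge m) X).
Proof.
  (* Beyond [|m| + 1] the cut is out of reach: either the middle term is zero, or all three terms
     and both differentials are those of [X]. *)
  intros [k H]; exists (Z.max k (Z.abs m + 1)); intros n Hn.
  apply (ex_spec EX); simpl.
  destruct (ge m (n + 1)) eqn:E1; [| apply (ex_zero EX), HO].
  destruct (ge m n) eqn:E0; [| unfold ge in *; lia].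
  destruct (ge m (n + 1 + 1)) eqn:E2; [| unfold ge in *; lia].
  simpl; apply (ex_spec EX), H; lia.
Qed.
Lemma win_homology_le (X : complex) m : bounded_homology X -> bounded_homology (win (le m) X).
Proof.
  intros [k H]; exists (Z.max k (Z.abs m + 1)); intros n Hn.
  apply (ex_spec EX); simpl.
  destruct (le m (n + 1)) eqn:E1; [| apply (ex_zero EX), HO].
  destruct (le m n) eqn:E0; [| unfold le in *; lia].
  destruct (le m (n + 1 + 1)) eqn:E2; [| unfold le in *; lia].
  simpl; apply (ex_spec EX), H; lia.
Qed.

Lemma win_zero (p : Z -> bool) (X : complex) n : p n = false -> is_zero (win p X n).
Proof. intro E; simpl; rewrite E; exact HO. Qed.
Lemma win_zero' (p : Z -> bool) (X : complex) n : is_zero (X n) -> is_zero (win p X n).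
Proof. intro H; simpl; destruct (p n); [exact H | exact HO]. Qed.

Lemma win_ge_Kpb (X : complex) m : Kib B X -> Kpb B (win (ge m) X).
Proof.
  intro H; split; [| apply win_homology_ge, H].
  apply bounded_below_iff; exists m; intros n Hn; apply win_zero; unfold ge; lia.
Qed.
Lemma win_le_Kmb (X : complex) m : Kib B X -> Kmb B (win (le m) X).
Proof.
  intro H; split; [| apply win_homology_le, H].
  apply bounded_above_iff; exists m; intros n Hn; apply win_zero; unfold le; lia.
Qed.
Lemma win_ge_Kb (X : complex) m : bounded_above X -> Kb B (win (ge m) X).
Proof.
  intro H; split.
  - apply bounded_below_iff; exists m; intros n Hn; apply win_zero; unfold ge; lia.
  - rewrite bounded_above_iff in H |- *; destruct H as [k H].
    exists k; intros n Hn; apply win_zero', H, Hn.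
Qed.
Lemma win_le_Kb (X : complex) m : bounded_below X -> Kb B (win (le m) X).
Proof.
  intro H; split.
  - rewrite bounded_below_iff in H |- *; destruct H as [k H].
    exists k; intros n Hn; apply win_zero', H, Hn.
  - apply bounded_above_iff; exists m; intros n Hn; apply win_zero; unfold le; lia.
Qed.

(* A morphism with cone in [M] is, up to an isomorphism, the inclusion into the cone
   of a morphism with source in [M]. *)
Lemma cone_in_form (Q M : tsub (K C)) (X Y : sub_tricat Q) (s : hom X Y) :
  good Q -> (forall V, Q V -> M V -> M (unshift_ob V)) ->
  cone_in (tsub_restrict Q M) s ->
  exists (W : complex) (w : chain_map W (proj1_sig X)) (V : complex)
    (i : chain_map (proj1_sig X) V) (p : chain_map V (cshift_ob W)) (QV : Q V)
    (e : @hom (sub_tricat Q) (exist _ V QV) Y),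
    Q W /\ M W /\ is_cone w i p /\ is_iso e /\
    e o (i : @hom (sub_tricat Q) X (exist _ V QV)) == s.
Proof.
  intros GQ GM (V & g & h & T & HV).
  pose proof (good_pretriangulated GQ) as PQ.
  pose (QW := good_unshift GQ (proj2_sig V)).
  pose (W := exist Q (unshift_ob (proj1_sig V)) QW : sub_tricat Q).
  assert (HI : isomorphic (C := sub_tricat Q) (shift W) V)
    by exact (unshift_iso (proj1_sig V)).
  destruct HI as (e & e' & He).
  destruct (tri_unrot PQ T He) as (w & _ & T').
  destruct (cone_exists C_bip (w : chain_map (proj1_sig W) (proj1_sig X)))
    as (V' & i & p & HC).
  pose proof (good_cone GQ HC QW (proj2_sig X)) as QV.
  assert (T2 : @tri (sub_tricat Q) W X (exist _ V' QV) w i p) by exact (cone_tri HC).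
  destruct (tri_unique PQ T2 T') as (c & Hc & E & _).
  exists (unshift_ob (proj1_sig V)), w, V', i, p, QV, c.
  split; [exact QW |]; split; [apply GM; [exact (proj2_sig V) | exact HV] |].
  split; [exact HC |]; split; [exact Hc | exact E].
Qed.

Section Truncation.
Variables (p p' : Z -> bool) (Q : tsub (K C)).
Hypothesis Hp' : forall n, p' (n + 1)%Z = p n.
Hypothesis GQ : good Q.
Hypothesis Qp : forall X, Kib B X -> Q (win p X).
Hypothesis Qp' : forall X, Kib B X -> Q (win p' X).
Notation N := (tsub_restrict Q (Kb B)).
Notation E := (Kquot Q (Kb B)).
Notation K0 := (sub_tricat (Kib B)).

Definition wob (X : K0) : sub_tricat Q := exist Q (win p (proj1_sig X)) (Qp (proj2_sig X)).
Definition wob' (X : K0) : sub_tricat Q :=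
  exist Q (win p' (proj1_sig X)) (Qp' (proj2_sig X)).
Definition wmap (X Y : K0) (f : hom X Y) : hom (wob X) (wob Y) :=
  win_cm O p (f : chain_map (proj1_sig X) (proj1_sig Y)).
Definition wj (X : K0) : hom (wob' X) (wob X) := win_j O Hp' (proj1_sig X).

Hypothesis w_heq : forall (X Y : K0) (f g : hom X Y), f == g ->
  @heq (vcat N) (wob X) (wob Y) (vincl N (wmap f)) (vincl N (wmap g)).
Hypothesis j_iso : forall X : K0, cone_in N (wj X).

Lemma wmap_id (X : K0) : wmap (idm X) == idm (wob X).
Proof. apply homotopic_ext; intro n; apply cut_id, HO. Qed.
Lemma wmap_comp (X Y V : K0) (g : hom Y V) (f : hom X Y) :
  wmap g o wmap f == wmap (g o f).
Proof. apply homotopic_ext; intro n; apply cut_comp; auto. Qed.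
Lemma wmap_add (X Y : K0) (f g : hom X Y) : wmap f + wmap g == wmap (f + g).
Proof. apply homotopic_ext; intro n; symmetry; apply cut_add. Qed.

Definition wshift (X : K0) : hom (wob (shift X)) (shift (wob' X)) :=
  win_shift O Hp' (proj1_sig X).
(** The truncation of X[1] is the shift of the truncation to [p'], from which [wj] leads to the
    shift of the truncation to [p]; only this second map needs the quotient to be invertible. *)
Definition wtheta (X : K0) : hom (wob (shift X)) (shift (wob X)) :=
  fmap shift (wj X) o wshift X.
Lemma wtheta_iso (X : K0) : @is_iso (vcat N) _ _ (vincl N (wtheta X)).
Proof.
  apply (is_iso_heq (vproj_comp N (reflexivity (wtheta X)))).
  apply is_iso_comp.
  - apply vincl_iso, cone_in_shift, j_iso.
  - apply vincl_iso', (win_shift_iso HO Hp').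
Qed.

Lemma wtheta_nat (X Y : K0) (f : hom X Y) :
  wtheta Y o wmap (fmap shift f) == fmap shift (wmap f) o wtheta X.
Proof.
  apply homotopic_ext; intro n; simpl; unfold win_fam; rewrite !Hp'.
  destruct (p n), (p (n + 1)%Z); simpl; expand; reflexivity.
Qed.

Lemma wmap_cone (X Y : K0) (f : hom X Y) :
  exists (V : K0) (i : hom Y V) (q : hom V (shift X)), tri f i q /\
  exists (X' : sub_tricat Q) (j : hom X' (wob X)) (f' : hom X' (wob Y))
    (q' : hom (wob V) (shift X')),
    tri f' (wmap i) q' /\ cone_in N j /\ wmap f o j == f' /\
    fmap shift j o q' == wtheta X o wmap q.
Proof.
  destruct (cone_exists C_bip (f : chain_map (proj1_sig X) (proj1_sig Y)))
    as (V' & i & q & HC).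
  destruct (win_cone HO Hp' HC) as (q' & Hq' & HC').
  exists (exist _ V' (good_cone good_Kib HC (proj2_sig X) (proj2_sig Y))), i, q.
  split; [exact (cone_tri HC) |].
  exists (wob' X), (wj X), (win_map O f (compat_shift Hp')), q'.
  split; [exact (cone_tri HC') |].
  split; [apply j_iso |].
  split; apply homotopic_ext; intro n.
  - etransitivity; [apply cut_comp; auto | apply cut_heq, comp_id_r].
  - simpl; rewrite Hq'; unfold win_fam; rewrite Hp'.
    destruct (p n), (p (n + 1)%Z); simpl; expand; reflexivity.
Qed.

Definition trunc : tri_functor K0 E :=
  tri_functor_to_quotient w_heq wmap_id wmap_comp wmap_add wtheta_iso wtheta_nat
    (good_pretriangulated good_Kib) wmap_cone.

(** Up to isomorphism [s] is the inclusion into the cone of a map with source [W] in [M]. Its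
    truncation has as cone the shift of the truncation of [W] to [p'], which is bounded by
    hypothesis. *)
Lemma trunc_inverts (M : tsub (K C)) (X Y : K0) (s : hom X Y) :
  (forall V, M V -> M (unshift_ob V)) ->
  (forall V, M V -> Kb B (win p' V)) ->
  cone_in (tsub_restrict (Kib B) M) s -> is_iso (fmap trunc s).
Proof.
  intros GM HM HS.
  destruct (cone_in_form good_Kib (fun V _ => GM V) HS)
    as (W & w & V & i & q & QV & e & QW & MW & HC & He & Es).
  pose (V0 := exist _ V QV : K0).
  pose (i0 := i : @hom K0 X V0).
  apply (is_iso_heq (f := fmap trunc e o fmap trunc i0)).
  { etransitivity; [symmetry; apply fmap_comp | apply fmap_heq, Es]. }
  apply is_iso_comp; [apply fmap_iso, He |].
  destruct (win_cone HO Hp' HC) as (q' & Hq' & HC').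
  apply vincl_iso.
  exists (shift (exist Q (win p' W) (Qp' QW) : sub_tricat Q)), q',
    (cm_opp (cshift_map (win_map O w (compat_shift Hp')))).
  split; [exact (cone_rot C_bip HC') |].
  exact (@tmem_shift _ (Kb B) _ (HM W MW)).
Qed.
End Truncation.
End Classes.

(** * Adjoints and recollements on Verdier quotients *)

Section QuotientFunctor.
Variables (T : tricat) (N P : tsub T).
Hypothesis NP : forall X, N X -> P X.

Lemma cone_in_mono (X Y : T) (s : hom X Y) : cone_in N s -> cone_in P s.
Proof.
  intros (Z & g & h & H & HZ); exists Z, g, h; split; [exact H | apply NP, HZ].
Qed.

Definition quot0 : functor (vcat N) (vcat P) :=
  @vlift T N T P (fid T) cone_in_mono.

Variables (C : preadditive) (F : functor T C).
Hypothesis F_N : forall (X Y : T) (s : hom X Y), cone_in N s -> is_iso (fmap F s).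
Hypothesis F_P : forall (X Y : T) (s : hom X Y), cone_in P s -> is_iso (fmap F s).

Lemma vext_quot0 (X Y : vcat N) (f : hom X Y) :
  fmap (vext_functor F_P) (fmap quot0 f) == fmap (vext_functor F_N) f.
Proof.
  rewrite <- (comp_id_l (fmap (vext_functor F_P) _)), <- (comp_id_r (fmap (vext_functor F_N) f)).
  apply (@vcat_nat T N C (fcomp (vext_functor F_P) quot0) (vext_functor F_N)
           (fun X => idm (F X))).
  clear X Y f; intros X Y f; etransitivity; [apply comp_id_l | symmetry; apply comp_id_r].
Qed.
End QuotientFunctor.

Section Reflections.
Variables (T : tricat) (N : tsub T).
Notation D := (verdier N).

(** A fully faithful [e] with right adjoint [l], described before the quotient: [l] is defined on
    [T] and extended by [cr_inv], and naturality of the counit is required only for morphisms of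
    [T], since it propagates to formal inverses. *)
Record coreflection (U : tricat) (e : tri_functor U D) (l : tri_functor T U) := {
  cr_inv : forall (X Y : T) (s : hom X Y), cone_in N s -> is_iso (fmap l s);
  cr_eps : forall X : T, @hom D (e (l X)) X;
  cr_nat : forall (X Y : T) (f : hom X Y),
    @comp D _ _ _ (vincl N f) (cr_eps X) == cr_eps Y o fmap e (fmap l f);
  cr_mu : forall A : U, hom (vext cr_inv (e A)) A;
  cr_mu_nat : forall (A B : U) (f : hom A B),
    f o cr_mu A == cr_mu B o fmap (vext cr_inv) (fmap e f);
  cr_mu_iso : forall A, is_iso (cr_mu A);
  cr_e_mu : forall A, fmap e (cr_mu A) == cr_eps (e A);
  cr_l_eps : forall X : T, fmap (vext cr_inv) (cr_eps X) == cr_mu (l X)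
}.

Record reflection (V : tricat) (i : tri_functor V D) (q : tri_functor T V) := {
  rf_inv : forall (X Y : T) (s : hom X Y), cone_in N s -> is_iso (fmap q s);
  rf_eta : forall X : T, @hom D X (i (q X));
  rf_nat : forall (X Y : T) (f : hom X Y),
    @comp D _ _ _ (rf_eta Y) (vincl N f) == fmap i (fmap q f) o rf_eta X;
  rf_lam : forall A : V, hom A (vext rf_inv (i A));
  rf_lam_nat : forall (A B : V) (f : hom A B),
    rf_lam B o f == fmap (vext rf_inv) (fmap i f) o rf_lam A;
  rf_lam_iso : forall A, is_iso (rf_lam A);
  rf_i_lam : forall A, fmap i (rf_lam A) == rf_eta (i A);
  rf_q_eta : forall X : T, fmap (vext rf_inv) (rf_eta X) == rf_lam (q X)
}.

Section Coreflective.
Variables (U : tricat) (e : tri_functor U D) (l : tri_functor T U).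
Variable c : coreflection e l.
Notation lN := (vext (cr_inv c)).

Lemma cr_eps_nat (X Y : D) (f : hom X Y) :
  f o cr_eps c X == cr_eps c Y o fmap e (fmap lN f).
Proof.
  symmetry.
  apply (@vcat_nat T N D (fcomp e lN) (fid D) (cr_eps c)).
  clear X Y f; intros X Y f; symmetry; exact (cr_nat c f).
Qed.

Definition cr_adjunction : adjunction e lN :=
  @coreflection_adjunction U D e lN (cr_eps c) (cr_mu c) cr_eps_nat (cr_mu_nat c)
    (cr_mu_iso c) (cr_e_mu c) (cr_l_eps c).

Lemma cr_ff : fully_faithful e.
Proof.
  exact (@coreflection_ff U D e lN (cr_eps c) (cr_mu c) cr_eps_nat (cr_mu_nat c)
    (cr_mu_iso c) (cr_e_mu c)).
Qed.

Lemma cr_mono (A : U) (X : D) (f g : hom (e A) (e (l X))) :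
  cr_eps c X o f == cr_eps c X o g -> f == g.
Proof.
  destruct (proj1 cr_ff _ _ f) as [f' Ef], (proj1 cr_ff _ _ g) as [g' Eg].
  intro E; rewrite <- Ef, <- Eg in *; apply fmap_heq.
  assert (E' : fmap lN (cr_eps c X o fmap e f') == fmap lN (cr_eps c X o fmap e g'))
    by (rewrite E; reflexivity).
  rewrite !fmap_comp, (cr_l_eps c X), <- !cr_mu_nat in E'.
  exact (iso_epi (cr_mu_iso c A) E').
Qed.

Variable P : tsub T.
Hypothesis NP : forall X, N X -> P X.
Hypothesis l_inv : forall (X Y : T) (s : hom X Y), cone_in P s -> is_iso (fmap l s).
Hypothesis eps_iso : forall X : T, is_iso (fmap (quot0 NP) (cr_eps c X)).
Notation lP := (vext l_inv).
Notation j0 := (quot0 NP).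

Lemma cr_lP (X Y : D) (f : hom X Y) : fmap lP (fmap j0 f) == fmap lN f.
Proof. apply (@vext_quot0 T N P NP U l (cr_inv c) l_inv). Qed.

Lemma cr_quot_nat (X Y : vcat P) (f : hom X Y) :
  f o fmap j0 (cr_eps c X) == fmap j0 (cr_eps c Y) o fmap j0 (fmap e (fmap lP f)).
Proof.
  symmetry.
  apply (@vcat_nat T P (vcat P) (fcomp (fcomp j0 e) lP) (fid (vcat P))
    (fun X => fmap j0 (cr_eps c X))).
  clear X Y f; intros X Y f.
  transitivity (fmap j0 (cr_eps c Y o fmap e (fmap l f)));
    [symmetry; exact (fmap_comp j0 (cr_eps c Y) (fmap e (fmap l f))) |].
  rewrite <- cr_nat; exact (fmap_comp j0 (vincl N f : @hom D X Y) (cr_eps c X)).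
Qed.

(** When [l] inverts the maps with cone in [P] and the counits become invertible modulo [P], this
    composite is left adjoint to the projection to [T / P], with the same counit [cr_eps]. It is the
    functor j_! and has the essential image of [e]. *)
Definition cr_shriek : tri_functor (verdier P) D := tcomp e lP.

Lemma cr_shriek_mu (Y : vcat P) :
  fmap cr_shriek (fmap j0 (cr_eps c Y)) == cr_eps c (cr_shriek Y).
Proof.
  transitivity (fmap e (cr_mu c (l Y))); [| exact (cr_e_mu c (l Y))].
  change (fmap e (fmap lP (fmap j0 (cr_eps c Y))) == fmap e (cr_mu c (l Y))).
  rewrite cr_lP, cr_l_eps; reflexivity.
Qed.

Lemma cr_shriek_nat (X Y : D) (f : hom X Y) :
  f o cr_eps c X == cr_eps c Y o fmap cr_shriek (fmap j0 f).
Proof.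
  rewrite cr_eps_nat; apply comp_heq; [reflexivity |].
  change (fmap e (fmap lN f) == fmap e (fmap lP (fmap j0 f))).
  rewrite cr_lP; reflexivity.
Qed.

Definition cr_shriek_adjunction : adjunction cr_shriek j0 :=
  @coreflection_adjunction (vcat P) D cr_shriek j0 (cr_eps c)
    (fun Y => fmap j0 (cr_eps c Y)) cr_shriek_nat cr_quot_nat eps_iso cr_shriek_mu
    (fun X => reflexivity _).

Lemma cr_shriek_ff : fully_faithful cr_shriek.
Proof.
  exact (@coreflection_ff (vcat P) D cr_shriek j0 (cr_eps c)
    (fun Y => fmap j0 (cr_eps c Y)) cr_shriek_nat cr_quot_nat eps_iso cr_shriek_mu).
Qed.

Lemma cr_shriek_image (X : D) : ess_image cr_shriek X <-> ess_image e X.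
Proof.
  split.
  - intros [Y H]; exists (l Y); exact H.
  - intros [A H]; exists (e A : verdier P); refine (isomorphic_trans _ H).
    exists (fmap e (cr_mu c A)); exact (fmap_iso e (cr_mu_iso c A)).
Qed.
End Coreflective.

Section Reflective.
Variables (V : tricat) (i : tri_functor V D) (q : tri_functor T V).
Variable r : reflection i q.
Notation qN := (vext (rf_inv r)).

Lemma rf_eta_nat (X Y : D) (f : hom X Y) :
  rf_eta r Y o f == fmap i (fmap qN f) o rf_eta r X.
Proof.
  apply (@vcat_nat T N D (fid D) (fcomp i qN) (rf_eta r)).
  clear X Y f; intros X Y f; exact (rf_nat r f).
Qed.

Definition rf_adjunction : adjunction qN i :=
  @reflection_adjunction V D qN i (rf_eta r) (rf_lam r) rf_eta_nat (rf_lam_nat r)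
    (rf_lam_iso r) (rf_i_lam r) (rf_q_eta r).

Lemma rf_ff : fully_faithful i.
Proof.
  exact (@reflection_ff V D qN i (rf_eta r) (rf_lam r) rf_eta_nat (rf_lam_nat r)
    (rf_lam_iso r) (rf_i_lam r)).
Qed.

Variable P : tsub T.
Hypothesis NP : forall X, N X -> P X.
Hypothesis q_inv : forall (X Y : T) (s : hom X Y), cone_in P s -> is_iso (fmap q s).
Hypothesis eta_iso : forall X : T, is_iso (fmap (quot0 NP) (rf_eta r X)).
Notation qP := (vext q_inv).
Notation j0 := (quot0 NP).

Lemma rf_qP (X Y : D) (f : hom X Y) : fmap qP (fmap j0 f) == fmap qN f.
Proof. apply (@vext_quot0 T N P NP V q (rf_inv r) q_inv). Qed.

Lemma rf_quot_nat (X Y : vcat P) (f : hom X Y) :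
  fmap j0 (rf_eta r Y) o f == fmap j0 (fmap i (fmap qP f)) o fmap j0 (rf_eta r X).
Proof.
  apply (@vcat_nat T P (vcat P) (fid (vcat P)) (fcomp (fcomp j0 i) qP)
    (fun X => fmap j0 (rf_eta r X))).
  clear X Y f; intros X Y f.
  transitivity (fmap j0 (fmap i (fmap q f) o rf_eta r X));
    [| exact (fmap_comp j0 (fmap i (fmap q f)) (rf_eta r X))].
  rewrite <- rf_nat; symmetry.
  exact (fmap_comp j0 (rf_eta r Y) (vincl N f : @hom D X Y)).
Qed.

Definition rf_star : tri_functor (verdier P) D := tcomp i qP.

Lemma rf_star_lam (Y : vcat P) :
  fmap rf_star (fmap j0 (rf_eta r Y)) == rf_eta r (rf_star Y).
Proof.
  transitivity (fmap i (rf_lam r (q Y))); [| exact (rf_i_lam r (q Y))].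
  change (fmap i (fmap qP (fmap j0 (rf_eta r Y))) == fmap i (rf_lam r (q Y))).
  rewrite rf_qP, rf_q_eta; reflexivity.
Qed.

Lemma rf_star_nat (X Y : D) (f : hom X Y) :
  rf_eta r Y o f == fmap rf_star (fmap j0 f) o rf_eta r X.
Proof.
  rewrite rf_eta_nat; apply comp_heq; [| reflexivity].
  change (fmap i (fmap qN f) == fmap i (fmap qP (fmap j0 f))).
  rewrite rf_qP; reflexivity.
Qed.

Definition rf_star_adjunction : adjunction j0 rf_star :=
  @reflection_adjunction (vcat P) D j0 rf_star (rf_eta r)
    (fun Y => fmap j0 (rf_eta r Y)) rf_star_nat rf_quot_nat eta_iso rf_star_lam
    (fun X => reflexivity _).

Lemma rf_star_ff : fully_faithful rf_star.
Proof.
  exact (@reflection_ff (vcat P) D j0 rf_star (rf_eta r)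
    (fun Y => fmap j0 (rf_eta r Y)) rf_star_nat rf_quot_nat eta_iso rf_star_lam).
Qed.

Lemma rf_star_image (X : D) : ess_image rf_star X <-> ess_image i X.
Proof.
  split.
  - intros [Y H]; exists (q Y); exact H.
  - intros [A H]; exists (i A : verdier P); refine (isomorphic_trans _ H).
    apply isomorphic_sym.
    exists (fmap i (rf_lam r A)); exact (fmap_iso i (rf_lam_iso r A)).
Qed.
End Reflective.

Lemma ess_image_shift (U : tricat) (e : tri_functor U D) :
  (forall A : U, exists A', isomorphic (shift A') A) ->
  forall X : D, ess_image e X <-> exists X', ess_image e X' /\ isomorphic (shift X') X.
Proof.
  intros HU X; split.
  - intros [A HA]; destruct (HU A) as (A' & f & Hf).
    exists (e A'); split; [exists A', (idm _); apply is_iso_id |].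
    refine (isomorphic_trans _ HA).
    refine (isomorphic_trans (isomorphic_sym _) (ex_intro _ (fmap e f) (fmap_iso e Hf))).
    exists (tfun_shift e A'); apply tfun_shift_iso.
  - intros (X' & (A & f & Hf) & HI); exists (shift A).
    refine (isomorphic_trans _ HI).
    exists (fmap shift f o tfun_shift e A).
    apply is_iso_comp; [apply fmap_iso, Hf | apply tfun_shift_iso].
Qed.

Section StableTStructure.
Variables (U V : tricat) (e : tri_functor U D) (i : tri_functor V D).
Variables (l : tri_functor T U) (q : tri_functor T V).
Variables (c : coreflection e l) (r : reflection i q).
Hypothesis U_surj : forall A : U, exists A', isomorphic (shift A') A.
Hypothesis V_surj : forall A : V, exists A', isomorphic (shift A') A.
Hypothesis q_e : forall A : U, is_zero (q (e A)).
Hypothesis c_tri : forall X : T, exists w, @tri D _ _ _ (cr_eps c X) (rf_eta r X) w.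
Hypothesis eps_detect : forall X : T, is_zero (q X) -> is_iso (cr_eps c X).
Hypothesis eta_detect : forall X : T, is_zero (l X) -> is_iso (rf_eta r X).

(** The unit is invertible on the image of [i], and by its naturality [f] followed by the unit
    factors through the image of [q (e A)], which is zero. *)
Lemma e_i_zero (A : U) (B : V) (f : @hom D (e A) (i B)) : f == 0.
Proof.
  assert (H : is_iso (rf_eta r (i B)))
    by (apply (is_iso_heq (rf_i_lam r B)), fmap_iso, rf_lam_iso).
  apply (iso_mono H); rewrite (rf_eta_nat r f).
  assert (E : fmap (vext (rf_inv r)) f == 0) by apply zero_from, q_e.
  rewrite E, fmap_0, comp_0l, comp_0r; reflexivity.
Qed.

Lemma coreflection_stable : stable_t_structure (ess_image e) (ess_image i).
Proof.
  split.
  - apply ess_image_shift, U_surj.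
  - apply ess_image_shift, V_surj.
  - intros X Y [A (a & Ha)] [B (b & Hb)] f.
    apply (iso_epi Ha); destruct Hb as [b' [Hb1 Hb2]].
    apply (iso_mono (m := b')); [exact (ex_intro _ b (conj Hb2 Hb1)) |].
    rewrite !comp_0l, comp_0r; apply e_i_zero.
  - intro X; destruct (c_tri X) as [w H].
    exists (e (l X)), (i (q X)), (cr_eps c X), (rf_eta r X), w.
    split; [exists (l X), (idm _); apply is_iso_id |].
    split; [exists (q X), (idm _); apply is_iso_id | exact H].
Qed.

Lemma ess_image_e_iff (X : D) : ess_image e X <-> ker_functor (vext (rf_inv r)) X.
Proof.
  split.
  - intros [A (a & Ha)].
    refine (zero_iso _ (q_e A)).
    exists (fmap (vext (rf_inv r)) a); exact (fmap_iso (vext (rf_inv r)) Ha).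
  - intro H; exists (l X), (cr_eps c X); apply eps_detect, H.
Qed.

Lemma ess_image_i_iff (X : D) : ess_image i X <-> ker_functor (vext (cr_inv c)) X.
Proof.
  split.
  - intros [B (b & Hb)].
    refine (zero_iso (X := l (i B)) _ _).
    + exists (fmap (vext (cr_inv c)) b); exact (fmap_iso (vext (cr_inv c)) Hb).
    (* Orthogonality kills the counit at [i B], which is left cancellable by [cr_mono]; hence the
       identity of [e (l (i B))] is zero, and [e] is faithful. *)
    + assert (E : cr_eps c (i B) == 0).
      { apply e_i_zero. }
      assert (E' : fmap e (idm (l (i B))) == 0).
      { rewrite fmap_id; apply (cr_mono (c := c)).
        rewrite E, !comp_0l; reflexivity. }
      apply zero_id, (proj2 (cr_ff c)); rewrite E', fmap_0; reflexivity.
  - intro H; exists (q X); apply isomorphic_sym; exists (rf_eta r X); apply eta_detect, H.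
Qed.
End StableTStructure.

(* [quot_pb] and [quot_mb] rebuild the underlying pairs of their arguments, so they
   are isomorphic to [quot0] without being convertible to it. *)
Section QuotientIso.
Variables (P : tsub T) (NP : forall X, N X -> P X).
Variables (J : tri_functor T T) (HJ : forall X, N X -> P (J X)).
Variable k : forall X : T, hom (J X) X.
Hypothesis k_iso : forall X, is_iso (k X).
Hypothesis k_nat : forall (X Y : T) (f : hom X Y), k Y o fmap J f == f o k X.
Notation j := (@verdier_map T T N P J HJ).
Notation j0 := (quot0 NP).

Definition quot_k (X : D) : @hom (vcat P) (j X) (j0 X) := vincl P (k X).

Lemma quot_k_iso X : is_iso (quot_k X).
Proof. apply (fmap_iso (vproj P)), k_iso. Qed.

Lemma quot_k_nat (X Y : D) (f : hom X Y) :
  quot_k Y o fmap j f == fmap j0 f o quot_k X.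
Proof.
  apply (@vcat_nat T N (vcat P) j j0 quot_k).
  clear X Y f; intros X Y f.
  etransitivity; [symmetry; apply (veq_vincl_comp P (k Y) (fmap J f)) |].
  etransitivity; [apply (veq_vincl P (k_nat f)) | apply (veq_vincl_comp P f (k X))].
Qed.

Definition quot_k_inv (X : D) : @hom (vcat P) (j0 X) (j X) := iso_inv (quot_k_iso X).

Lemma quot_k_inv_nat (X Y : D) (f : hom X Y) :
  quot_k_inv Y o fmap j0 f == fmap j f o quot_k_inv X.
Proof.
  apply (iso_mono (quot_k_iso Y)); unfold quot_k_inv.
  rewrite !comp_assoc, iso_inv_r, comp_id_l, quot_k_nat, <- comp_assoc, iso_inv_r.
  symmetry; apply comp_id_r.
Qed.

Definition left_adjoint_transfer (F : functor (verdier P) D) (a : adjunction F j0) :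
  adjunction F j.
Proof.
  refine (@Build_adjunction (verdier P) D F j
    (fun X Y f => quot_k_inv Y o adj a f) (fun X Y f => adj_inv a (quot_k Y o f)) _ _ _ _ _).
  - intros X Y f g E; rewrite (adj_heq a E); reflexivity.
  - intros X Y f g E; apply adj_inv_heq; rewrite E; reflexivity.
  - intros X Y f; etransitivity; [| apply (adjK a)]; apply adj_inv_heq.
    unfold quot_k_inv; rewrite comp_assoc, iso_inv_r; apply comp_id_l.
  - intros X Y f; unfold quot_k_inv.
    etransitivity; [apply comp_heq; [reflexivity | apply adj_invK] |].
    rewrite comp_assoc, iso_inv_l; apply comp_id_l.
  - intros X X' Y Y' s f t; etransitivity; [apply comp_heq; [reflexivity | apply adj_nat] |].
    rewrite !comp_assoc, quot_k_inv_nat; reflexivity.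
Defined.

Definition right_adjoint_transfer (F : functor (verdier P) D) (a : adjunction j0 F) :
  adjunction j F.
Proof.
  refine (@Build_adjunction D (verdier P) j F
    (fun X Y f => adj a (f o quot_k_inv X)) (fun X Y f => adj_inv a f o quot_k X) _ _ _ _ _).
  - intros X Y f g E; apply adj_heq; rewrite E; reflexivity.
  - intros X Y f g E; rewrite (adj_inv_heq a E); reflexivity.
  - intros X Y f.
    etransitivity; [apply comp_heq; [apply adjK | reflexivity] |]; unfold quot_k_inv.
    rewrite <- comp_assoc, iso_inv_l; apply comp_id_r.
  - intros X Y f; etransitivity; [| apply (adj_invK a)]; apply adj_heq.
    unfold quot_k_inv; rewrite <- comp_assoc, iso_inv_r; apply comp_id_r.
  - intros X X' Y Y' s f t; etransitivity; [| apply adj_nat]; apply adj_heq.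
    rewrite <- !comp_assoc, quot_k_inv_nat; reflexivity.
Defined.

Lemma quot_zero (X : D) : is_zero (j X) <-> is_zero (j0 X).
Proof.
  split; apply zero_iso; [| apply isomorphic_sym]; exists (quot_k X); apply quot_k_iso.
Qed.
End QuotientIso.
End Reflections.

(** * Reflections onto subcategories and their quotients *)

Section SubcategoryReflections.
Variables (T : tricat) (N : tsub T) (T1 : tricat) (I : tri_functor T1 T).
Hypothesis I_faithful : faithful I.

Section Quotient.
Variable N1 : tsub T1.
Hypothesis HI : forall A : T1, N1 A -> N (I A).
Notation e := (@verdier_map T1 T N1 N I HI).
Variable w : tri_functor T (verdier N1).
Hypothesis w_inv : forall (X Y : T) (s : hom X Y), cone_in N s -> is_iso (fmap w s).
Variable wmap : forall X Y : T, hom X Y -> @hom T1 (w X) (w Y).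
Hypothesis w_eq : forall (X Y : T) (f : hom X Y),
  @heq (vcat N1) (w X) (w Y) (fmap w f) (vincl N1 (wmap f)).

Section Right.
Variable eps : forall X : T, hom (I (w X)) X.
Hypothesis eps_nat : forall (X Y : T) (f : hom X Y),
  f o eps X == eps Y o fmap I (wmap f).
Variable mu : forall A : T1, @hom T1 (w (I A)) A.
Hypothesis I_mu : forall A, fmap I (mu A) == eps (I A).
Hypothesis mu_iso : forall A, @is_iso (vcat N1) _ _ (vincl N1 (mu A)).
Hypothesis w_eps : forall X : T, @heq (vcat N1) (w (I (w X))) (w X)
  (vincl N1 (wmap (eps X))) (vincl N1 (mu (w X))).

Lemma mu_nat0 (A B : T1) (f : hom A B) : f o mu A == mu B o wmap (fmap I f).
Proof.
  apply I_faithful; rewrite !fmap_comp, !I_mu; apply eps_nat.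
Qed.

(** Since [w] is represented by morphisms [wmap] of [T1], most identities are checked before the
    quotient; the naturality of [mu] follows from that of [eps] by faithfulness of [I]. *)
Definition sub_coreflection : coreflection e w.
Proof.
  refine (@Build_coreflection T N (verdier N1) e w w_inv (fun X => vincl N (eps X)) _
    (fun A => vincl N1 (mu A)) _ mu_iso _ _).
  - intros X Y f.
    etransitivity; [symmetry; apply veq_vincl_comp |].
    etransitivity; [apply veq_vincl, eps_nat |].
    etransitivity; [apply veq_vincl_comp |].
    apply (comp_heq (p := vcat N)); [apply veq_refl |].
    symmetry; exact (fmap_heq e (w_eq f)).
  - intros A B f; symmetry.
    apply (@vcat_nat T1 N1 (vcat N1) (fcomp (vext w_inv) e) (fid (vcat N1))
      (fun A => vincl N1 (mu A))).
    clear A B f; intros A B f.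
    transitivity (@comp (vcat N1) _ _ _ (vincl N1 (mu B)) (vincl N1 (wmap (fmap I f)))).
    { apply comp_heq; [reflexivity | exact (w_eq (fmap I f))]. }
    etransitivity; [symmetry; apply veq_vincl_comp |].
    etransitivity; [apply veq_vincl; symmetry; apply mu_nat0 | apply veq_vincl_comp].
  - intro A; apply veq_vincl, I_mu.
  - intro X; etransitivity; [exact (w_eq (eps X)) | apply w_eps].
Defined.
End Right.

Section Left.
Variable eta : forall X : T, hom X (I (w X)).
Hypothesis eta_nat : forall (X Y : T) (f : hom X Y),
  eta Y o f == fmap I (wmap f) o eta X.
Variable lam : forall A : T1, @hom T1 A (w (I A)).
Hypothesis I_lam : forall A, fmap I (lam A) == eta (I A).
Hypothesis lam_iso : forall A, @is_iso (vcat N1) _ _ (vincl N1 (lam A)).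
Hypothesis w_eta : forall X : T, @heq (vcat N1) (w X) (w (I (w X)))
  (vincl N1 (wmap (eta X))) (vincl N1 (lam (w X))).

Lemma lam_nat0 (A B : T1) (f : hom A B) : lam B o f == wmap (fmap I f) o lam A.
Proof.
  apply I_faithful; rewrite !fmap_comp, !I_lam; apply eta_nat.
Qed.

Definition sub_reflection : reflection e w.
Proof.
  refine (@Build_reflection T N (verdier N1) e w w_inv (fun X => vincl N (eta X)) _
    (fun A => vincl N1 (lam A)) _ lam_iso _ _).
  - intros X Y f.
    etransitivity; [symmetry; apply veq_vincl_comp |].
    etransitivity; [exact (veq_vincl N (eta_nat f)) |].
    etransitivity; [exact (veq_vincl_comp N (fmap I (wmap f)) (eta X)) |].
    refine (@comp_heq (vcat N) _ _ _ _ _ _ _ _ (reflexivity _)).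
    symmetry; exact (fmap_heq e (w_eq f)).
  - intros A B f.
    apply (@vcat_nat T1 N1 (vcat N1) (fid (vcat N1)) (fcomp (vext w_inv) e)
      (fun A => vincl N1 (lam A))).
    clear A B f; intros A B f.
    transitivity (@comp (vcat N1) _ _ _ (vincl N1 (wmap (fmap I f))) (vincl N1 (lam A))).
    { etransitivity; [symmetry; apply veq_vincl_comp |].
      etransitivity; [apply veq_vincl, lam_nat0 | apply veq_vincl_comp]. }
    apply comp_heq; [symmetry; exact (w_eq (fmap I f)) | reflexivity].
  - intro A; apply veq_vincl, I_lam.
  - intro X; etransitivity; [exact (w_eq (eta X)) | apply w_eta].
Defined.
End Left.
End Quotient.

Section NoQuotient.
Notation e := (tcomp (vproj_tri N) I).
Variable w : tri_functor T T1.
Hypothesis w_inv : forall (X Y : T) (s : hom X Y), cone_in N s -> is_iso (fmap w s).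

Section Right.
Variable eps : forall X : T, hom (I (w X)) X.
Hypothesis eps_nat : forall (X Y : T) (f : hom X Y),
  f o eps X == eps Y o fmap I (fmap w f).
Variable mu : forall A : T1, hom (w (I A)) A.
Hypothesis I_mu : forall A, fmap I (mu A) == eps (I A).
Hypothesis mu_iso : forall A, is_iso (mu A).
Hypothesis w_eps : forall X : T, fmap w (eps X) == mu (w X).

(** The variant for a subcategory that embeds in [T / N] without being divided itself, as the
    acyclic complexes do. *)
Definition full_coreflection : coreflection e w.
Proof.
  refine (@Build_coreflection T N T1 e w w_inv (fun X => vincl N (eps X)) _
    mu _ mu_iso _ _).
  - intros X Y f.
    etransitivity; [symmetry; apply veq_vincl_comp |].
    etransitivity; [apply veq_vincl, eps_nat | apply veq_vincl_comp].
  - intros A B f; change (f o mu A == mu B o fmap w (fmap I f)).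
    apply I_faithful; rewrite !fmap_comp, !I_mu; apply eps_nat.
  - intro A; apply veq_vincl, I_mu.
  - intro X; apply w_eps.
Defined.
End Right.

Section Left.
Variable eta : forall X : T, hom X (I (w X)).
Hypothesis eta_nat : forall (X Y : T) (f : hom X Y),
  eta Y o f == fmap I (fmap w f) o eta X.
Variable lam : forall A : T1, hom A (w (I A)).
Hypothesis I_lam : forall A, fmap I (lam A) == eta (I A).
Hypothesis lam_iso : forall A, is_iso (lam A).
Hypothesis w_eta : forall X : T, fmap w (eta X) == lam (w X).

Definition full_reflection : reflection e w.
Proof.
  refine (@Build_reflection T N T1 e w w_inv (fun X => vincl N (eta X)) _
    lam _ lam_iso _ _).
  - intros X Y f.
    etransitivity; [symmetry; apply veq_vincl_comp |].
    etransitivity; [exact (veq_vincl N (eta_nat f)) |].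
    exact (veq_vincl_comp N (fmap I (fmap w f)) (eta X)).
  - intros A B f; change (lam B o f == fmap w (fmap I f) o lam A).
    apply I_faithful; rewrite !fmap_comp, !I_lam; apply eta_nat.
  - intro A; apply veq_vincl, I_lam.
  - intro X; apply w_eta.
Defined.
End Left.
End NoQuotient.
End SubcategoryReflections.

(** * Gluing two t-structures into a recollement *)

Section Recollement.
Variables (T : tricat) (N P : tsub T) (NP : forall X, N X -> P X).
Variables (J : tri_functor T T) (HJ : forall X, N X -> P (J X)).
Variable k : forall X : T, hom (J X) X.
Hypothesis k_iso : forall X, is_iso (k X).
Hypothesis k_nat : forall (X Y : T) (f : hom X Y), k Y o fmap J f == f o k X.
Notation D := (verdier N).
Notation j := (@verdier_map T T N P J HJ).
Notation j0 := (quot0 NP).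
Variables (U V W : tricat).
Variables (eU : tri_functor U D) (i : tri_functor V D) (eW : tri_functor W D).
Variables (l : tri_functor T U) (q q' : tri_functor T V) (w : tri_functor T W).
Variables (cU : coreflection eU l) (rV : reflection i q).
Variables (cV : coreflection i q') (rW : reflection eW w).
Hypothesis l_inv : forall (X Y : T) (s : hom X Y), cone_in P s -> is_iso (fmap l s).
Hypothesis w_inv : forall (X Y : T) (s : hom X Y), cone_in P s -> is_iso (fmap w s).
Hypothesis eps_iso : forall X : T, is_iso (fmap j0 (cr_eps cU X)).
Hypothesis eta_iso : forall X : T, is_iso (fmap j0 (rf_eta rW X)).
Hypothesis im_U : forall X : D, ess_image eU X <-> ker_functor (vext (rf_inv rV)) X.
Hypothesis im_W : forall X : D, ess_image eW X <-> ker_functor (vext (cr_inv cV)) X.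
Hypothesis im_V : forall X : D, ess_image i X <-> ker_functor j X.

(** In the order U, V, W the images are consecutive terms of two t-structures with common term V.
    The reflection onto V is i^*, the coreflection is i^!, and U and W, both equivalent to the
    quotient by V, give j_! and j_*. *)
Lemma recollement_of : exists r : recollement i j,
  (forall X, ess_image (rec_j_lower_shriek r) X <-> ess_image eU X) /\
  (forall X, ess_image (rec_j_lower_star r) X <-> ess_image eW X).
Proof.
  unshelve eexists.
  - refine (@Build_recollement V D (verdier P) i j (vext (rf_inv rV)) (vext (cr_inv cV))
      (cr_shriek eU l_inv) (rf_star eW w_inv)
      (cr_ff cV) (cr_shriek_ff l_inv eps_iso) (rf_star_ff w_inv eta_iso)
      (rf_adjunction rV) (cr_adjunction cV)
      (left_adjoint_transfer HJ k_iso k_nat (cr_shriek_adjunction l_inv eps_iso))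
      (right_adjoint_transfer HJ k_iso k_nat (rf_star_adjunction w_inv eta_iso)) _ im_V _).
    + intro X; etransitivity; [apply (cr_shriek_image cU l_inv) | apply im_U].
    + intro X; etransitivity; [apply (rf_star_image rW w_inv) | apply im_W].
  - split; intro X; [apply (cr_shriek_image cU l_inv) | apply (rf_star_image rW w_inv)].
Qed.
End Recollement.

(** * Vanishing and isomorphism modulo a subcategory *)

Section AbstractFacts.
Variables (T : tricat) (PT : pretriangulated T) (N : tsub T).

Lemma cone_in_iso (X X' Y Y' : T) (s : hom X Y) (s' : hom X' Y') (a : hom X X') (b : hom Y Y') :
  cone_in N s -> is_iso a -> is_iso b -> b o s == s' o a -> cone_in N s'.
Proof.
  intros (Z & g & h & H & HZ) Ha Hb E.
  exists Z, (g o iso_inv Hb), (fmap shift a o h); split; [| exact HZ].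
  refine (tri_closed (tri_iso_sym _) H).
  exists a, b, (idm Z); split; [exact Ha |]; split; [exact Hb |].
  split; [apply is_iso_id |]; split; [exact E |]; split.
  - rewrite <- comp_assoc, iso_inv_l, comp_id_l, comp_id_r; reflexivity.
  - rewrite comp_id_r; reflexivity.
Qed.

Lemma vincl_through (X M Y : T) (g : hom M Y) (f : hom X M) (e : hom X Y) :
  N M -> e == g o f -> @heq (vcat N) X Y (vincl N e) 0.
Proof.
  intros HM E; transitivity (@comp (vcat N) X M Y (vincl N g) (vincl N f)).
  - etransitivity; [apply veq_vincl, E | apply veq_vincl_comp].
  - rewrite (zero_to (C := vcat N) (vincl N f : @hom (vcat N) X M) (vproj_zero PT HM)).
    apply (comp_0r (C := vcat N)).
Qed.

Lemma vincl_error (X Y : T) (f g e : hom X Y) :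
  f == g + e -> @heq (vcat N) X Y (vincl N e) 0 ->
  @heq (vcat N) X Y (vincl N f) (vincl N g).
Proof.
  intros E E0; etransitivity; [apply veq_vincl, E |].
  etransitivity; [apply veq_vincl_add |].
  etransitivity; [refine (@hadd_heq (vcat N) X Y _ _ _ _ (reflexivity _) E0) |].
  apply (hadd_0 (p := vcat N)).
Qed.

Lemma verdier_surj : (forall X : T, exists X', isomorphic (shift X') X) ->
  forall X : verdier N, exists X' : verdier N, isomorphic (shift X') X.
Proof.
  intros H X; destruct (H X) as (X' & f & Hf); exists X'.
  exists (vincl N f); exact (vincl_iso' N Hf).
Qed.
End AbstractFacts.

(** * Truncation functors modulo bounded complexes *)

Section Classes.
Variables (A : preadditive) (B : A -> Prop).
Notation C := (full_sub B).
Notation complex := (complex C).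
Variable O : C.
Hypothesis HO : is_zero O.
Hypothesis C_bip : has_biproducts C.
Variable ex : forall X Y V : C, hom X Y -> hom Y V -> Prop.
Hypothesis EX : exactness ex.
Notation win := (win O).
Notation K0 := (sub_tricat (Kib B)).
Notation N0 := (tsub_restrict (Kib B) (Kb B)).
Notation gKib := (good_Kib HO EX).
Notation gKpb := (good_Kpb HO EX).
Notation gKmb := (good_Kmb HO EX).
Notation gKb := (good_Kb HO).
Notation P0 := (good_pretriangulated HO C_bip gKib).

Lemma win_win_iso (p q : Z -> bool) (X : complex) :
  (forall n, p n = true -> q n = true) ->
  exists a : chain_map (win p X) (win p (win q X)),
    is_iso (C := hcat C) a /\
    forall n, a n == cut O (p n) (p n) (cut O true (q n) (idm (X n))).
Proof.
  intro H.
  assert (E : forall n, cut O (p (n + 1)%Z) (p (n + 1)%Z) (cut O true (q (n + 1)%Z) (idm (X (n + 1)%Z)))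
                o dif (win p X) n
              == dif (win p (win q X)) n o cut O (p n) (p n) (cut O true (q n) (idm (X n)))).
  { intro n; simpl; pose proof (H n) as H1; pose proof (H (n + 1)%Z) as H2.
    destruct (p n), (p (n + 1)%Z); simpl; rewrite ?(H1 eq_refl), ?(H2 eq_refl); simpl;
      expand; reflexivity. }
  exists (@ChainMap C (win p X) (win p (win q X)) _ E); split; [| intro; reflexivity].
  apply complex_iso with (g := fun n => cut O (p n) (p n) (cut O (q n) true (idm (X n)))).
  intro n; simpl; pose proof (H n) as H1.
  destruct (p n); simpl; rewrite ?(H1 eq_refl); simpl; split; expand;
    try reflexivity; apply (zero_zero HO).
Qed.

(** The cut lies between degrees 0 and 1. This choice is arbitrary: truncations at two different
    cuts differ by a bounded complex. *)
Notation pge := (ge (0 + 1)).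
Notation pge' := (ge (0 + 1 + 1)).
Notation ple := (le 0).
Notation ple' := (le (0 + 1)).
Lemma Hge n : pge' (n + 1)%Z = pge n. Proof. apply ge_shift. Qed.
Lemma Hle n : ple' (n + 1)%Z = ple n. Proof. apply le_shift. Qed.
Lemma Qge m (X : K C) : Kib B X -> Kpb B (win (ge m) X).
Proof. apply (win_ge_Kpb HO EX). Qed.
Lemma Qle m (X : K C) : Kib B X -> Kmb B (win (le m) X).
Proof. apply (win_le_Kmb HO EX). Qed.

Lemma wmap_heq_ge (X Y : K0) (f g : hom X Y) : f == g ->
  @heq (vcat (tsub_restrict (Kpb B) (Kb B))) (wob (@Qge (0 + 1)) X) (wob (@Qge (0 + 1)) Y)
    (vincl _ (wmap (@Qge (0 + 1)) f)) (vincl _ (wmap (@Qge (0 + 1)) g)).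
Proof.
  intro E; destruct (homotopic_ge O (0 + 1) E) as (e & E1 & E2).
  refine (@vincl_error (sub_tricat (Kpb B)) _ (wob (@Qge (0 + 1)) X)
    (wob (@Qge (0 + 1)) Y) _ _ e E1 _).
  (* The error vanishes above degree 1, so it factors through the part of its source in degrees at
     most 1; this part is bounded because the source is bounded below. *)
  destruct (@factor_le _ O _ _ e (0 + 1) E2) as [e' He'].
  pose (b := win_le_Kb HO (0 + 1) (proj1 (proj2_sig (wob (@Qge (0 + 1)) X)))).
  pose (M := exist (Kpb B) _ (conj (proj1 b) (Kb_homology EX b)) : sub_tricat (Kpb B)).
  exact (@vincl_through (sub_tricat (Kpb B)) (good_pretriangulated HO C_bip gKpb)
    (tsub_restrict (Kpb B) (Kb B))
    (wob (@Qge (0 + 1)) X) M (wob (@Qge (0 + 1)) Y) e' _ e b He').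
Qed.

Lemma wmap_heq_le (X Y : K0) (f g : hom X Y) : f == g ->
  @heq (vcat (tsub_restrict (Kmb B) (Kb B))) (wob (@Qle (0)) X) (wob (@Qle (0)) Y)
    (vincl _ (wmap (@Qle (0)) f)) (vincl _ (wmap (@Qle (0)) g)).
Proof.
  intro E; destruct (homotopic_le O 0 E) as (e & E1 & E2).
  refine (@vincl_error (sub_tricat (Kmb B)) _ (wob (@Qle (0)) X)
    (wob (@Qle (0)) Y) _ _ e E1 _).
  (* The error vanishes in negative degrees, so it factors through the part of its target in degrees
     at least 0, bounded because the target is bounded above. *)
  destruct (@factor_ge _ O _ _ e 0 E2) as [e' He'].
  pose (b := win_ge_Kb HO 0 (proj1 (proj2_sig (wob (@Qle (0)) Y)))).
  pose (M := exist (Kmb B) _ (conj (proj2 b) (Kb_homology EX b)) : sub_tricat (Kmb B)).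
  exact (@vincl_through (sub_tricat (Kmb B)) (good_pretriangulated HO C_bip gKmb)
    (tsub_restrict (Kmb B) (Kb B))
    (wob (@Qle (0)) X) M (wob (@Qle (0)) Y) _ e' e b He').
Qed.

Lemma cone_in_win_in (Q : tsub (K C)) (M : tsub (K C)) m (X : complex) (QX : Q X)
    (Q1 : Q (win (ge (m + 1)) X)) :
  Q (win (le m) X) -> M (win (le m) X) ->
  cone_in (tsub_restrict Q M)
    (win_in O X (@ge_up (m + 1)) : @hom (sub_tricat Q) (exist _ _ Q1) (exist _ X QX)).
Proof.
  intros H1 H2.
  destruct (@win_tri C O HO C_bip _ _ X (@ge_up (m + 1)) (@le_down m) (le_ge m)) as [h H].
  exists (exist _ _ H1), (win_out O X (@le_down m)), h; split; [exact H | exact H2].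
Qed.

Lemma cone_in_win_out (Q : tsub (K C)) (M : tsub (K C)) m (X : complex) (QX : Q X)
    (Q1 : Q (win (le m) X)) :
  Q (win (ge (m + 1)) X) -> M (win (ge (m + 1)) X) ->
  cone_in (tsub_restrict Q M)
    (win_out O X (@le_down m) : @hom (sub_tricat Q) (exist _ X QX) (exist _ _ Q1)).
Proof.
  intros H1 H2.
  destruct (@win_tri C O HO C_bip _ _ X (@ge_up (m + 1)) (@le_down m) (le_ge m)) as [h H].
  exists (exist _ (cshift_ob (win (ge (m + 1)) X)) (tmem_shift H1)), h,
    (cm_opp (cshift_map (win_in O X (@ge_up (m + 1))))).
  split; [exact (pt_rot (PK HO C_bip) H) | exact (tmem_shift H2)].
Qed.

(** Truncating to degrees at least 2 can be done after truncating to degrees at least 1; up to this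
    identification [wj] is the inclusion into a bounded below complex of one of its truncations,
    with bounded cone. *)
Lemma j_iso_ge (X : K0) :
  cone_in (tsub_restrict (Kpb B) (Kb B))
    (wj (p := pge) (p' := pge') Hge (@Qge (0 + 1)) (@Qge (0 + 1 + 1)) X).
Proof.
  pose (Y := win pge (proj1_sig X)).
  pose (QY := Qge (0 + 1) (proj2_sig X)).
  assert (Q1 : Kpb B (win pge' Y)) by (apply Qge; exact (proj2 QY)).
  pose proof (win_le_Kb HO (0 + 1) (proj1 QY)) as b.
  pose proof (@cone_in_win_in (Kpb B) (Kb B) (0 + 1) Y QY Q1
    (conj (proj1 b) (Kb_homology EX b)) b) as H.
  destruct (@win_win_iso pge' pge (proj1_sig X)) as (a & Ha & Ea).
  { unfold ge; intro n; lia. }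
  destruct Ha as [a' Ha'].
  refine (@cone_in_iso (sub_tricat (Kpb B)) _ (exist _ _ Q1) (wob' (@Qge (0 + 1 + 1)) X)
    (exist _ _ QY) (wob (@Qge (0 + 1)) X) _ _ a' (@idm (sub_tricat (Kpb B)) (exist _ _ QY))
    H _ _ _).
  - exists a; split; apply Ha'.
  - exact (is_iso_id (C := sub_tricat (Kpb B)) (exist _ _ QY)).
  - apply (iso_epi (C := hcat C) (e := a)); [exists a'; exact Ha' |].
    etransitivity; [apply (comp_heq (p := hcat C)); [apply (comp_id_l (p := hcat C)) | reflexivity] |].
    etransitivity; [| apply (comp_assoc (p := hcat C))].
    etransitivity; [| symmetry; apply (comp_heq (p := hcat C)); [reflexivity | apply Ha']].
    etransitivity; [| symmetry; apply (comp_id_r (p := hcat C))].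
    apply homotopic_ext; intro n.
    etransitivity; [apply comp_heq; [reflexivity | apply Ea] |].
    simpl; unfold win_fam; simpl.
    assert (L : ge 2 n = true -> ge 1 n = true) by (unfold ge; lia).
    destruct (ge 2 n); simpl; rewrite ?(L eq_refl); simpl; expand; reflexivity.
Qed.

Lemma j_iso_le (X : K0) :
  cone_in (tsub_restrict (Kmb B) (Kb B))
    (wj (p := ple) (p' := ple') Hle (@Qle (0)) (@Qle (0 + 1)) X).
Proof.
  pose (Y := win ple' (proj1_sig X)).
  pose (QY := Qle (0 + 1) (proj2_sig X)).
  assert (Q1 : Kmb B (win ple Y)) by (apply Qle; exact (proj2 QY)).
  pose proof (win_ge_Kb HO (0 + 1) (proj1 QY)) as b.
  pose proof (@cone_in_win_out (Kmb B) (Kb B) 0 Y QY Q1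
    (conj (proj2 b) (Kb_homology EX b)) b) as H.
  destruct (@win_win_iso ple ple' (proj1_sig X)) as (a & Ha & Ea).
  { unfold le; intro n; lia. }
  destruct Ha as [a' Ha'].
  refine (@cone_in_iso (sub_tricat (Kmb B)) _ (exist _ _ QY) (wob' (@Qle (0 + 1)) X)
    (exist _ _ Q1) (wob (@Qle 0) X) _ _ (@idm (sub_tricat (Kmb B)) (exist _ _ QY)) a'
    H _ _ _).
  - exact (is_iso_id (C := sub_tricat (Kmb B)) (exist _ _ QY)).
  - exists a; split; apply Ha'.
  - apply (iso_mono (C := hcat C) (m := a)); [exists a'; exact Ha' |].
    etransitivity; [apply (comp_assoc (p := hcat C)) |].
    etransitivity; [apply (comp_heq (p := hcat C)); [apply Ha' | reflexivity] |].
    etransitivity; [apply (comp_id_l (p := hcat C)) |].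
    etransitivity; [| symmetry; apply (comp_heq (p := hcat C)); [reflexivity | apply (comp_id_r (p := hcat C))]].
    apply homotopic_ext; intro n; symmetry.
    etransitivity; [apply comp_heq; [apply Ea | reflexivity] |].
    simpl; unfold win_fam; simpl.
    assert (L : le 0 n = true -> le 1 n = true) by (unfold le; lia).
    destruct (le 0 n); simpl; rewrite ?(L eq_refl); simpl; expand; reflexivity.
Qed.

Definition trunc_ge : tri_functor K0 (Kquot (Kpb B) (Kb B)) :=
  trunc HO C_bip EX wmap_heq_ge j_iso_ge.
Definition trunc_le : tri_functor K0 (Kquot (Kmb B) (Kb B)) :=
  trunc HO C_bip EX wmap_heq_le j_iso_le.

(** Truncation makes complexes bounded at the other end bounded, so it descends even to the quotient
    by all of these. This stronger descent gives the adjoints of the projections to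
    K^{infty,b}/K^{-,b} and K^{infty,b}/K^{+,b}. *)
Lemma trunc_ge_Kmb (X Y : K0) (s : hom X Y) :
  cone_in (tsub_restrict (Kib B) (Kmb B)) s -> is_iso (fmap trunc_ge s).
Proof.
  apply trunc_inverts; [exact (good_unshift gKmb) |].
  intros V [HV _]; apply (win_ge_Kb HO), HV.
Qed.
Lemma trunc_ge_Kb (X Y : K0) (s : hom X Y) : cone_in N0 s -> is_iso (fmap trunc_ge s).
Proof.
  apply trunc_inverts; [exact (good_unshift gKb) |].
  intros V [_ HV]; apply (win_ge_Kb HO), HV.
Qed.
Lemma trunc_le_Kpb (X Y : K0) (s : hom X Y) :
  cone_in (tsub_restrict (Kib B) (Kpb B)) s -> is_iso (fmap trunc_le s).
Proof.
  apply trunc_inverts; [exact (good_unshift gKpb) |].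
  intros V [HV _]; apply (win_le_Kb HO), HV.
Qed.
Lemma trunc_le_Kb (X Y : K0) (s : hom X Y) : cone_in N0 s -> is_iso (fmap trunc_le s).
Proof.
  apply trunc_inverts; [exact (good_unshift gKb) |].
  intros V [HV _]; apply (win_le_Kb HO), HV.
Qed.
End Classes.

(** * Detection of zero objects, and the truncation adjunctions *)

Section Classes.
Variables (A : preadditive) (B : A -> Prop).
Notation C := (full_sub B).
Notation complex := (complex C).
Variable O : C.
Hypothesis HO : is_zero O.
Hypothesis C_bip : has_biproducts C.
Variable ex : forall X Y V : C, hom X Y -> hom Y V -> Prop.
Hypothesis EX : exactness ex.
Notation win := (win O).
Notation K0 := (sub_tricat (Kib B)).
Notation N0 := (tsub_restrict (Kib B) (Kb B)).
Notation gKib := (good_Kib HO EX).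
Notation gKpb := (good_Kpb HO EX).
Notation gKmb := (good_Kmb HO EX).
Notation gKb := (good_Kb HO).
Notation P0 := (good_pretriangulated HO C_bip gKib).
Notation trunc_ge := (trunc_ge HO C_bip EX).
Notation trunc_le := (trunc_le HO C_bip EX).
Notation pge := (ge (0 + 1)).
Notation ple := (le 0).

Section Germs.
Variable ev : (Z -> Prop) -> Prop.
Hypothesis ev_all : forall P : Z -> Prop, (forall n, P n) -> ev P.
Hypothesis ev_and : forall P Q R : Z -> Prop,
  (forall n, P n -> Q n -> R n) -> ev P -> ev Q -> ev R.
Hypothesis ev_shift : forall P : Z -> Prop, ev P -> ev (fun n => P (n + 1)%Z).
Notation G := (germ_functor C ev_all ev_and ev_shift).
Variable Q : tsub (K C).
Hypothesis gQ : good O Q.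
Hypothesis ev_Kb : forall X : complex, Kb B X -> ev (fun n => is_zero (X n)).

Definition sub_germ : functor (sub_tricat Q) (germ_cat C ev_all ev_and ev_shift) :=
  @Functor (sub_tricat Q) (germ_cat C ev_all ev_and ev_shift) (fun X => proj1_sig X)
    (fun X Y f => fmap G f) (fun X Y f g E => fmap_heq G E) (fun X => fmap_id G _)
    (fun X Y V g f => fmap_comp G _ _) (fun X Y f g => fmap_add G _ _).

Lemma sub_germ_inv (X Y : sub_tricat Q) (s : hom X Y) :
  cone_in (tsub_restrict Q (Kb B)) s -> is_iso (fmap sub_germ s).
Proof.
  intro H.
  destruct (cone_in_form HO C_bip gQ (fun V _ => good_unshift gKb (X := V)) H)
    as (W & w & V & i & p & QV & e & QW & MW & HC & He & Es).
  refine (is_iso_heq (fmap_heq sub_germ Es) _).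
  refine (is_iso_heq (symmetry (fmap_comp sub_germ e
    (i : @hom (sub_tricat Q) X (exist _ V QV)))) _).
  apply is_iso_comp; [exact (fmap_iso sub_germ He) |].
  exact (germ_cone_iso ev_all ev_and ev_shift HC (ev_Kb MW)).
Qed.

(** Passage to germs inverts the maps with cone in K^b, so it extends to the quotient and carries
    the zero object [X] to a zero object; the null-homotopy of its identity is a contraction near
    the end. *)
Lemma zero_germ (X : sub_tricat Q) :
  is_zero (X : verdier (tsub_restrict Q (Kb B))) ->
  exists h : forall n, hom (proj1_sig X (n + 1)%Z) (proj1_sig X n),
  ev (fun n => idm (proj1_sig X (n + 1)%Z) ==
    dif (proj1_sig X) n o h n + h (n + 1)%Z o dif (proj1_sig X) (n + 1)%Z).
Proof.
  intro H.
  pose proof (fmap_zero (vext_functor sub_germ_inv) H) as H'.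
  destruct (zero_to (idm _) H') as [h Hh].
  exists h; refine (ev_map ev_and _ Hh); intros n E.
  etransitivity; [exact E | apply hadd_0l].
Qed.
End Germs.

(** The germs are taken at plus infinity, where bounded complexes vanish. A contraction there makes
    [X] a retract of a truncation to degrees at most [m], which is bounded since [X] is bounded
    below. *)
Lemma zero_detect_pb (X : sub_tricat (Kpb B)) :
  is_zero (X : verdier (tsub_restrict (Kpb B) (Kb B))) ->
  exists M : complex, Kb B M /\ retract_of (C := hcat C) (proj1_sig X) M.
Proof.
  intro H.
  destruct (@zero_germ _ ev_above_all ev_above_and ev_above_shift _ gKpb) with (X := X)
    as (h & m & Hh); [| exact H |].
  { intros V [_ HV]; rewrite bounded_above_iff in HV; destruct HV as [m HV].
    exists (m + 1)%Z; intros n Hn; apply HV; lia. }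
  exists (win (le m) (proj1_sig X)); split.
  - apply (win_le_Kb HO), (proj1 (proj2_sig X)).
  - exact (contraction_ge HO C_bip Hh).
Qed.

Lemma zero_detect_mb (X : sub_tricat (Kmb B)) :
  is_zero (X : verdier (tsub_restrict (Kmb B) (Kb B))) ->
  exists M : complex, Kb B M /\ retract_of (C := hcat C) (proj1_sig X) M.
Proof.
  intro H.
  destruct (@zero_germ _ ev_below_all ev_below_and ev_below_shift _ gKmb) with (X := X)
    as (h & m & Hh); [| exact H |].
  { intros V [HV _]; rewrite bounded_below_iff in HV; destruct HV as [m HV].
    exists (m - 1)%Z; intros n Hn; apply HV; lia. }
  exists (win (ge (m + 1)) (proj1_sig X)); split.
  - apply (win_ge_Kb HO), (proj1 (proj2_sig X)).
  - exact (contraction_le HO C_bip Hh).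
Qed.

Lemma detect_iso (X Y V : K0) (M : complex) (f : hom X Y) (g : hom Y V)
    (h : hom V (shift X)) :
  tri f g h -> Kb B M -> retract_of (C := hcat C) (proj1_sig V) M ->
  @is_iso (vcat N0) X Y (vincl N0 f).
Proof.
  intros H HM HR.
  exact (@vproj_iso_retract K0 P0 N0 X Y V (exist _ M (Kb_homology EX HM)) f g h H HM HR).
Qed.

Lemma retract_shift (X M : complex) :
  retract_of (C := hcat C) X M -> retract_of (C := hcat C) (cshift_ob X) (cshift_ob M).
Proof.
  intros (s & r & E); exists (fmap (cshift C) s), (fmap (cshift C) r).
  etransitivity; [symmetry; apply (fmap_comp (cshift C)) |].
  etransitivity; [apply (fmap_heq (cshift C) E) | apply (fmap_id (cshift C))].
Qed.

Definition eps_ge (X : complex) : chain_map (win pge X) X := win_in O X (@ge_up (0 + 1)).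
Definition eta_le (X : complex) : chain_map X (win ple X) := win_out O X (@le_down 0).

Lemma eps_ge_nat (X Y : complex) (f : chain_map X Y) :
  homotopic (cm_comp f (eps_ge X)) (cm_comp (eps_ge Y) (win_cm O pge f)).
Proof.
  apply homotopic_ext; intro n; simpl; unfold win_fam; simpl.
  destruct (ge 1 n); simpl; expand; reflexivity.
Qed.
Lemma eta_le_nat (X Y : complex) (f : chain_map X Y) :
  homotopic (cm_comp (eta_le Y) f) (cm_comp (win_cm O ple f) (eta_le X)).
Proof.
  apply homotopic_ext; intro n; simpl; unfold win_fam; simpl.
  destruct (le 0 n); simpl; expand; reflexivity.
Qed.
Lemma win_eps_ge (X : complex) :
  homotopic (win_cm O pge (eps_ge X)) (eps_ge (win pge X)).
Proof.
  apply homotopic_ext; intro n; simpl; unfold win_fam; simpl.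
  destruct (ge 1 n); simpl; reflexivity.
Qed.
Lemma win_eta_le (X : complex) :
  homotopic (win_cm O ple (eta_le X)) (eta_le (win ple X)).
Proof.
  apply homotopic_ext; intro n; simpl; unfold win_fam; simpl.
  destruct (le 0 n); simpl; reflexivity.
Qed.

Definition Ipb : tri_functor (sub_tricat (Kpb B)) K0 := sub_incl (@Kpb_Kib A B).
Definition Imb : tri_functor (sub_tricat (Kmb B)) K0 := sub_incl (@Kmb_Kib A B).
Definition Iac : tri_functor (sub_tricat (Kac B)) K0 := sub_incl (@Kac_Kib A B).

Lemma eps_ge_iso (X : sub_tricat (Kpb B)) :
  cone_in (tsub_restrict (Kpb B) (Kb B))
    (eps_ge (proj1_sig X) : @hom (sub_tricat (Kpb B)) (wob (Qge HO EX (0 + 1)) (Ipb X)) X).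
Proof.
  destruct X as [X HX].
  pose proof (win_le_Kb HO 0 (proj1 HX)) as b.
  exact (@cone_in_win_in A B O HO C_bip (Kpb B) (Kb B) 0 X HX _
    (conj (proj1 b) (Kb_homology EX b)) b).
Qed.
Lemma eta_le_iso (X : sub_tricat (Kmb B)) :
  cone_in (tsub_restrict (Kmb B) (Kb B))
    (eta_le (proj1_sig X) : @hom (sub_tricat (Kmb B)) X (wob (Qle HO EX 0) (Imb X))).
Proof.
  destruct X as [X HX].
  pose proof (win_ge_Kb HO (0 + 1) (proj1 HX)) as b.
  exact (@cone_in_win_out A B O HO C_bip (Kmb B) (Kb B) 0 X HX _
    (conj (proj2 b) (Kb_homology EX b)) b).
Qed.

(** The inclusion of the truncation serves both as counit and as [mu]: on K^{+,b} its cone is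
    bounded, so it is invertible there. *)
Definition c_ge : coreflection (emb_pb B) trunc_ge :=
  @sub_coreflection K0 N0 (sub_tricat (Kpb B)) Ipb (fun X Y f g E => E)
    (tsub_restrict (Kpb B) (Kb B)) _ trunc_ge (trunc_ge_Kb HO C_bip EX)
    (wmap (Qge HO EX (0 + 1))) (fun X Y f => veq_refl _)
    (fun X => eps_ge (proj1_sig X)) (fun X Y f => eps_ge_nat f)
    (fun X => eps_ge (proj1_sig X)) (fun X => reflexivity _)
    (fun X => vincl_iso (eps_ge_iso X))
    (fun X => @veq_vincl (sub_tricat (Kpb B)) (tsub_restrict (Kpb B) (Kb B))
       (wob (Qge HO EX (0 + 1)) (Ipb (wob (Qge HO EX (0 + 1)) X)))
       (wob (Qge HO EX (0 + 1)) X) _ _ (win_eps_ge (proj1_sig X))).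

Definition r_le : reflection (emb_mb B) trunc_le :=
  @sub_reflection K0 N0 (sub_tricat (Kmb B)) Imb (fun X Y f g E => E)
    (tsub_restrict (Kmb B) (Kb B)) _ trunc_le (trunc_le_Kb HO C_bip EX)
    (wmap (Qle HO EX 0)) (fun X Y f => veq_refl _)
    (fun X => eta_le (proj1_sig X)) (fun X Y f => eta_le_nat f)
    (fun X => eta_le (proj1_sig X)) (fun X => reflexivity _)
    (fun X => vincl_iso (eta_le_iso X))
    (fun X => @veq_vincl (sub_tricat (Kmb B)) (tsub_restrict (Kmb B) (Kb B))
       (wob (Qle HO EX 0) X)
       (wob (Qle HO EX 0) (Imb (wob (Qle HO EX 0) X))) _ _ (win_eta_le (proj1_sig X))).
End Classes.

(** * Adjoints from an orthogonal pair of subcategories *)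

Section OrthogonalPair.
Variables (T TU TV : tricat).
Hypotheses (PT : pretriangulated T) (PU : pretriangulated TU) (PV : pretriangulated TV).
Variables (IU : tri_functor TU T) (IV : tri_functor TV T).
Hypotheses (IU_full : full IU) (IU_faithful : faithful IU).
Hypotheses (IV_full : full IV) (IV_faithful : faithful IV).
Hypothesis orth : forall (X : TU) (Y : TV) (f : hom (IU X) (IV Y)), f == 0.
Hypothesis dec : forall X : T, exists (U : TU) (V : TV) (u : hom (IU U) X)
  (v : hom X (IV V)) (w : hom (IV V) (shift (IU U))), tri u v w.

(** Packed as a type so that one decomposition triangle can be chosen for each object; functoriality
    then comes from the universal properties. *)
Record decomposition (X : T) := {
  dU : TU; dV : TV; du : hom (IU dU) X; dv : hom X (IV dV);
  dw : hom (IV dV) (shift (IU dU)); d_tri : tri du dv dw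
}.
Lemma dec_inhabited (X : T) : exists d : decomposition X, True.
Proof.
  destruct (dec X) as (U & V & u & v & w & H).
  exists (Build_decomposition H); exact Logic.I.
Qed.
Definition chosen (X : T) : decomposition X :=
  proj1_sig (constructive_indefinite_description _ (dec_inhabited X)).

Definition eps (X : T) : hom (IU (dU (chosen X))) X := du (chosen X).
Definition eta (X : T) : hom X (IV (dV (chosen X))) := dv (chosen X).
Lemma eps_eta_tri (X : T) : tri (eps X) (eta X) (dw (chosen X)).
Proof. apply d_tri. Qed.

Lemma orth_shift (X : TU) (Y : TV) (f : hom (shift (IU X)) (IV Y)) : f == 0.
Proof.
  apply (iso_epi (tfun_shift_iso IU X)); rewrite (orth (f o _)); symmetry; apply comp_0l.
Qed.

Lemma eps_ex (X : T) (A : TU) (t : hom (IU A) X) :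
  exists t' : hom A (dU (chosen X)), eps X o fmap IU t' == t.
Proof.
  destruct (tri_weak_ker PT (t := t) (eps_eta_tri X)) as [s Hs]; [apply orth |].
  destruct (IU_full s) as [t' E]; exists t'; rewrite E; exact Hs.
Qed.

(** The translate of the difference factors through a map from a translate of the image of [IU] to
    the image of [IV], which is zero by orthogonality. *)
Lemma eps_uniq (X : T) (A : TU) (s t : hom A (dU (chosen X))) :
  eps X o fmap IU s == eps X o fmap IU t -> s == t.
Proof.
  intro E.
  destruct (tri_weak_ker'' PT (t := fmap shift (fmap IU (s + - t))) (eps_eta_tri X))
    as [k Hk].
  { rewrite <- fmap_comp, fmap_add, fmap_opp, comp_hadd_r, comp_opp_r, E, hadd_opp.
    apply fmap_0. }
  assert (Z : s + - t == 0).
  { apply IU_faithful, (pt_faithful PT).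
    rewrite <- Hk, (orth_shift k), comp_0r, !fmap_0; reflexivity. }
  apply (hadd_inj (h := - t)); rewrite Z, hadd_opp; reflexivity.
Qed.

Lemma eta_ex (X : T) (A : TV) (t : hom X (IV A)) :
  exists t' : hom (dV (chosen X)) A, fmap IV t' o eta X == t.
Proof.
  destruct (tri_weak_coker PT (t := t) (eps_eta_tri X)) as [s Hs]; [apply orth |].
  destruct (IV_full s) as [t' E]; exists t'; rewrite E; exact Hs.
Qed.

Lemma eta_uniq (X : T) (A : TV) (s t : hom (dV (chosen X)) A) :
  fmap IV s o eta X == fmap IV t o eta X -> s == t.
Proof.
  intro E.
  destruct (tri_weak_coker' PT (t := fmap IV (s + - t)) (eps_eta_tri X)) as [k Hk].
  { rewrite fmap_add, fmap_opp, comp_hadd_l, comp_opp_l, E; apply hadd_opp. }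
  assert (Z : s + - t == 0).
  { apply IV_faithful; rewrite <- Hk, (orth_shift k), comp_0l, fmap_0; reflexivity. }
  apply (hadd_inj (h := - t)); rewrite Z, hadd_opp; reflexivity.
Qed.

Definition lU : tri_functor T TU := radj PT PU eps_ex eps_uniq.
Definition qV : tri_functor T TV := ladj PT PV eta_ex eta_uniq.

Lemma eps_lU (X Y : T) (f : hom X Y) : f o eps X == eps Y o fmap IU (fmap lU f).
Proof. symmetry; exact (radj_eps eps_ex eps_uniq f). Qed.
Lemma eta_qV (X Y : T) (f : hom X Y) : eta Y o f == fmap IV (fmap qV f) o eta X.
Proof. symmetry; exact (ladj_eta eta_ex eta_uniq f). Qed.

Lemma mu_ex (A : TU) : exists m : hom (lU (IU A)) A, fmap IU m == eps (IU A).
Proof. exact (IU_full (eps (IU A))). Qed.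
Definition mu (A : TU) : hom (lU (IU A)) A :=
  proj1_sig (constructive_indefinite_description _ (mu_ex A)).
Lemma IU_mu (A : TU) : fmap IU (mu A) == eps (IU A).
Proof. exact (proj2_sig (constructive_indefinite_description _ (mu_ex A))). Qed.

Lemma lam_ex (A : TV) : exists m : hom A (qV (IV A)), fmap IV m == eta (IV A).
Proof. exact (IV_full (eta (IV A))). Qed.
Definition lam (A : TV) : hom A (qV (IV A)) :=
  proj1_sig (constructive_indefinite_description _ (lam_ex A)).
Lemma IV_lam (A : TV) : fmap IV (lam A) == eta (IV A).
Proof. exact (proj2_sig (constructive_indefinite_description _ (lam_ex A))). Qed.

Lemma mu_iso (A : TU) : is_iso (mu A).
Proof.
  destruct (eps_ex (idm (IU A))) as [t Ht]; exists t; split.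
  - apply eps_uniq; rewrite fmap_comp, comp_assoc, Ht, IU_mu, fmap_id, comp_id_r.
    apply comp_id_l.
  - apply IU_faithful; rewrite fmap_comp, IU_mu, Ht, fmap_id; reflexivity.
Qed.
Lemma lam_iso (A : TV) : is_iso (lam A).
Proof.
  destruct (eta_ex (idm (IV A))) as [t Ht]; exists t; split.
  - apply IV_faithful; rewrite fmap_comp, IV_lam, Ht, fmap_id; reflexivity.
  - apply eta_uniq; rewrite fmap_comp, <- comp_assoc, Ht, IV_lam, fmap_id, comp_id_l.
    apply comp_id_r.
Qed.

Lemma lU_eps (X : T) : fmap lU (eps X) == mu (lU X).
Proof. apply eps_uniq; rewrite <- eps_lU, IU_mu; reflexivity. Qed.
Lemma qV_eta (X : T) : fmap qV (eta X) == lam (qV X).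
Proof. apply eta_uniq; rewrite <- eta_qV, IV_lam; reflexivity. Qed.

Lemma lU_IV (A : TV) : is_zero (lU (IV A)).
Proof.
  apply zero_id, eps_uniq; rewrite (orth (eps (IV A))), !comp_0l; reflexivity.
Qed.
Lemma qV_IU (A : TU) : is_zero (qV (IU A)).
Proof.
  apply zero_id, eta_uniq; rewrite (orth (eta (IU A))), !comp_0r; reflexivity.
Qed.

Lemma lU_inv (P : tsub T) : (forall X, P X -> exists A, isomorphic (IV A) X) ->
  forall (X Y : T) (s : hom X Y), cone_in P s -> is_iso (fmap lU s).
Proof.
  intros HP X Y s (Z & g & h & H & HZ).
  apply (tri_zero_iso PU (tfun_tri lU H)).
  destruct (HP Z HZ) as (A & f & Hf).
  exact (zero_iso (ex_intro _ _ (fmap_iso lU Hf)) (lU_IV A)).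
Qed.
Lemma qV_inv (P : tsub T) : (forall X, P X -> exists A, isomorphic (IU A) X) ->
  forall (X Y : T) (s : hom X Y), cone_in P s -> is_iso (fmap qV s).
Proof.
  intros HP X Y s (Z & g & h & H & HZ).
  apply (tri_zero_iso PV (tfun_tri qV H)).
  destruct (HP Z HZ) as (A & f & Hf).
  exact (zero_iso (ex_intro _ _ (fmap_iso qV Hf)) (qV_IU A)).
Qed.

Lemma cone_in_third (D : tricat) (M : tsub D) (X Y Z A : D) (f : hom X Y) (g : hom Y Z)
    (h : hom Z (shift X)) :
  tri f g h -> isomorphic A Z -> M A -> cone_in M f.
Proof.
  intros H (a & b & Hb) HA; exists A, (b o g), (h o a); split; [| exact HA].
  refine (tri_closed _ H).
  exists (idm X), (idm Y), a.
  do 2 (split; [apply is_iso_id |]); split; [exists b; exact Hb |].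
  destruct Hb as [H1 H2].
  rewrite comp_assoc, H2, fmap_id, !comp_id_l, !comp_id_r; repeat split; reflexivity.
Qed.

Section QuotientU.
Variables (N : tsub T) (NU : tsub TU).
Hypothesis HU : forall A, NU A -> N (IU A).
Hypothesis N_U : forall X, N X -> exists A, isomorphic (IU A) X /\ NU A.
Notation lN := (tcomp (vproj_tri NU) lU).

(** In this case [N] comes from the subcategory itself: [lU] does not kill the cone but carries it,
    through [mu], to an object of [NU]; hence the further projection to the quotient. *)
Lemma lN_inv (X Y : T) (s : hom X Y) : cone_in N s -> is_iso (fmap lN s).
Proof.
  intros (Z & g & h & H & HZ); destruct (N_U HZ) as (A & (f & Hf) & HA).
  apply vproj_iso, (cone_in_third (tfun_tri lU H) (A := A)); [| exact HA].
  apply (isomorphic_trans (Y := lU (IU A))).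
  - apply isomorphic_sym; exists (mu A); apply mu_iso.
  - exists (fmap lU f); apply fmap_iso, Hf.
Qed.

Definition pair_coreflection_quotient : coreflection (@verdier_map TU T NU N IU HU) lN :=
  @sub_coreflection T N TU IU IU_faithful NU HU lN lN_inv
    (fun X Y f => fmap lU f) (fun X Y f => veq_refl _) eps eps_lU mu IU_mu
    (fun A => fmap_iso (vproj NU) (mu_iso A))
    (fun X => veq_vincl NU (lU_eps X)).
End QuotientU.

Section QuotientV.
Variables (N : tsub T) (NV : tsub TV).
Hypothesis HV : forall A, NV A -> N (IV A).
Hypothesis N_V : forall X, N X -> exists A, isomorphic (IV A) X /\ NV A.
Notation qN := (tcomp (vproj_tri NV) qV).

Lemma qN_inv (X Y : T) (s : hom X Y) : cone_in N s -> is_iso (fmap qN s).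
Proof.
  intros (Z & g & h & H & HZ); destruct (N_V HZ) as (A & (f & Hf) & HA).
  apply vproj_iso, (cone_in_third (tfun_tri qV H) (A := A)); [| exact HA].
  apply (isomorphic_trans (Y := qV (IV A))).
  - exists (lam A); apply lam_iso.
  - exists (fmap qV f); apply fmap_iso, Hf.
Qed.

Definition pair_reflection_quotient : reflection (@verdier_map TV T NV N IV HV) qN :=
  @sub_reflection T N TV IV IV_faithful NV HV qN qN_inv
    (fun X Y f => fmap qV f) (fun X Y f => veq_refl _) eta eta_qV lam IV_lam
    (fun A => fmap_iso (vproj NV) (lam_iso A))
    (fun X => veq_vincl NV (qV_eta X)).
End QuotientV.

Section NoQuotient.
Variable N : tsub T.

(** Here [N] comes from the opposite member of the pair, so [lU] kills it and already inverts the
    maps with cone in [N]. *)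
Definition pair_coreflection
    (N_V : forall X, N X -> exists A, isomorphic (IV A) X) :
  coreflection (tcomp (vproj_tri N) IU) lU :=
  @full_coreflection T N TU IU IU_faithful lU (lU_inv N_V) eps eps_lU mu IU_mu
    mu_iso lU_eps.

Definition pair_reflection
    (N_U : forall X, N X -> exists A, isomorphic (IU A) X) :
  reflection (tcomp (vproj_tri N) IV) qV :=
  @full_reflection T N TV IV IV_faithful qV (qV_inv N_U) eta eta_qV lam IV_lam
    lam_iso qV_eta.

Lemma pair_tri (X : T) : @tri (verdier N) _ _ _ (vincl N (eps X)) (vincl N (eta X))
  (vincl N (dw (chosen X))).
Proof.
  exists _, X, _, (eps X), (eta X), (dw (chosen X)).
  split; [apply eps_eta_tri |]; apply tri_iso_heq; reflexivity.
Qed.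
End NoQuotient.

End OrthogonalPair.

Lemma quot0_vincl_iso (T : tricat) (N P : tsub T) (NP : forall X, N X -> P X) (X Y : T)
    (s : hom X Y) :
  cone_in P s -> is_iso (fmap (quot0 NP) (vincl N s : @hom (vcat N) X Y)).
Proof. intro H; exact (vproj_iso H). Qed.

Lemma vincl_tri (T : tricat) (N : tsub T) (X Y Z : T) (f : hom X Y) (g : hom Y Z)
    (h : hom Z (shift X)) :
  tri f g h -> @tri (verdier N) X Y Z (vincl N f) (vincl N g) (vincl N h).
Proof.
  intro H; exists X, Y, Z, f, g, h; split; [exact H |].
  apply tri_iso_heq; reflexivity.
Qed.

(** * The stable t-structures and the recollements *)

Section Classes.
Variables (A : preadditive) (B : A -> Prop).
Notation C := (full_sub B).
Notation complex := (complex C).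
Variable O : C.
Hypothesis HO : is_zero O.
Hypothesis C_bip : has_biproducts C.
Variable ex : forall X Y V : C, hom X Y -> hom Y V -> Prop.
Hypothesis EX : exactness ex.
Notation win := (win O).
Notation K0 := (sub_tricat (Kib B)).
Notation N0 := (tsub_restrict (Kib B) (Kb B)).
Notation Npb := (tsub_restrict (Kib B) (Kpb B)).
Notation Nmb := (tsub_restrict (Kib B) (Kmb B)).
Notation D := (verdier N0).
Notation gKib := (good_Kib HO EX).
Notation gKpb := (good_Kpb HO EX).
Notation gKmb := (good_Kmb HO EX).
Notation gKac := (good_Kac HO EX).
Notation gKb := (good_Kb HO).
Notation P0 := (good_pretriangulated HO C_bip gKib).
Notation trunc_ge := (trunc_ge HO C_bip EX).
Notation trunc_le := (trunc_le HO C_bip EX).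
Notation c_ge := (c_ge HO C_bip EX).
Notation r_le := (r_le HO C_bip EX).

Lemma good_surj (Q : tsub (K C)) : good O Q ->
  forall X : sub_tricat Q, exists X', isomorphic (shift X') X.
Proof.
  intros gQ X; exists (exist _ _ (good_unshift gQ (proj2_sig X))).
  exact (unshift_iso (proj1_sig X)).
Qed.

Definition Oge (X : K0) : K0 := Ipb B (wob (Qge HO EX (0 + 1)) X).
Definition Ole (X : K0) : K0 := Imb B (wob (Qle HO EX 0) X).

Lemma trunc_tri_K0 (X : K0) : exists h : hom (Ole X) (shift (Oge X)),
  tri (eps_ge O (proj1_sig X) : hom (Oge X) X) (eta_le O (proj1_sig X) : hom X (Ole X)) h.
Proof.
  exact (@win_tri C O HO C_bip _ _ (proj1_sig X) (@ge_up (0 + 1)) (@le_down 0) (le_ge 0)).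
Qed.

Lemma trunc_tri_D (X : K0) :
  exists h, @tri D _ _ _ (cr_eps c_ge X) (rf_eta r_le X) h.
Proof.
  destruct (trunc_tri_K0 X) as [h H]; exists (vincl N0 h).
  exact (vincl_tri N0 H).
Qed.

Lemma trunc_le_pb (X : Kquot (Kpb B) (Kb B)) : is_zero (trunc_le (emb_pb B X)).
Proof.
  apply (vproj_zero (good_pretriangulated HO C_bip gKmb)
    (X := wob (Qle HO EX 0) (Ipb B X)) (N := tsub_restrict (Kmb B) (Kb B))).
  exact (win_le_Kb HO 0 (proj1 (proj2_sig X))).
Qed.

(** The cone of the counit is the other truncation. Its vanishing modulo K^b makes it only a retract
    of a bounded complex, which [detect_iso] accepts. *)
Lemma eps_ge_detect (X : K0) : is_zero (trunc_le X) -> is_iso (cr_eps c_ge X).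
Proof.
  intro H; destruct (zero_detect_mb HO C_bip EX (X := wob (Qle HO EX 0) X) H)
    as (M & HM & HR).
  destruct (trunc_tri_K0 X) as [h T].
  exact (detect_iso HO C_bip EX T HM HR).
Qed.

Lemma eta_le_detect (X : K0) : is_zero (trunc_ge X) -> is_iso (rf_eta r_le X).
Proof.
  intro H; destruct (zero_detect_pb HO C_bip EX (X := wob (Qge HO EX (0 + 1)) X) H)
    as (M & HM & HR).
  destruct (trunc_tri_K0 X) as [h T].
  exact (detect_iso HO C_bip EX (pt_rot P0 T) (tmem_shift HM) (retract_shift HR)).
Qed.

Lemma pb_surj (X : Kquot (Kpb B) (Kb B)) : exists X', isomorphic (shift X') X.
Proof. exact (verdier_surj (good_surj gKpb) X). Qed.
Lemma mb_surj (X : Kquot (Kmb B) (Kb B)) : exists X', isomorphic (shift X') X.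
Proof. exact (verdier_surj (good_surj gKmb) X). Qed.

Lemma pb_mb_stable : stable_t_structure (ess_image (emb_pb B)) (ess_image (emb_mb B)).
Proof.
  exact (coreflection_stable pb_surj mb_surj trunc_le_pb trunc_tri_D).
Qed.

Lemma pb_iff_D (X : D) :
  ess_image (emb_pb B) X <-> ker_functor (vext (rf_inv r_le)) X.
Proof. exact (ess_image_e_iff r_le trunc_le_pb eps_ge_detect X). Qed.

Lemma mb_iff_D (X : D) :
  ess_image (emb_mb B) X <-> ker_functor (vext (cr_inv c_ge)) X.
Proof. exact (ess_image_i_iff c_ge trunc_le_pb eta_le_detect X). Qed.

Lemma Kb_Npb X : N0 X -> Npb X.
Proof. intros [H _]; exact (conj H (proj2_sig X)). Qed.
Lemma Kb_Nmb X : N0 X -> Nmb X.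
Proof. intros [_ H]; exact (conj H (proj2_sig X)). Qed.

Lemma eta_le_Npb (X : K0) : is_iso (fmap (quot0 Kb_Npb) (rf_eta r_le X)).
Proof.
  apply (quot0_vincl_iso Kb_Npb (s := eta_le O (proj1_sig X) : hom X (Ole X))).
  destruct X as [X HX].
  exact (@cone_in_win_out A B O HO C_bip (Kib B) (Kpb B) 0 X HX _
    (proj2 (Qge HO EX (0 + 1) HX)) (Qge HO EX (0 + 1) HX)).
Qed.
Lemma eps_ge_Nmb (X : K0) : is_iso (fmap (quot0 Kb_Nmb) (cr_eps c_ge X)).
Proof.
  apply (quot0_vincl_iso Kb_Nmb (s := eps_ge O (proj1_sig X) : hom (Oge X) X)).
  destruct X as [X HX].
  exact (@cone_in_win_in A B O HO C_bip (Kib B) (Kmb B) 0 X HX _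
    (proj2 (Qle HO EX 0 HX)) (Qle HO EX 0 HX)).
Qed.

Notation J := (sub_incl (P := Kib B) (Q := Kib B) (fun _ H => H)).
Definition Jk (X : K0) : hom (J X) X := @idm (K C) (proj1_sig X).
Lemma Jk_iso (X : K0) : is_iso (Jk X).
Proof. exact (is_iso_id (C := K C) (proj1_sig X)). Qed.
Lemma Jk_nat (X Y : K0) (f : hom X Y) : Jk Y o fmap J f == f o Jk X.
Proof.
  etransitivity; [exact (comp_id_l (p := K C) f) | symmetry; exact (comp_id_r (p := K C) f)].
Qed.

Lemma P_zero_quot (P : tsub K0) (NP : forall X, N0 X -> P X)
    (HJ : forall X, N0 X -> P (J X)) (X : K0) :
  P X -> is_zero (@verdier_map K0 K0 N0 P J HJ X).
Proof.
  intro HX.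
  apply (proj2 (quot_zero NP HJ Jk_iso (X : D))).
  exact (vproj_zero P0 HX).
Qed.

Definition HJpb (X : K0) : N0 X -> Npb (J X) := Kib_Kb_Kpb (proj2_sig X).
Definition HJmb (X : K0) : N0 X -> Nmb (J X) := Kib_Kb_Kmb (proj2_sig X).

(** If [X] dies modulo K^{+,b}, then so does its truncation to degrees at most 0, because that
    functor descends to this quotient; [pb_iff_D] then places [X] in the image. *)
Lemma pb_iff_quot0 (X : D) : ess_image (emb_pb B) X <-> ker_functor (quot_pb B) X.
Proof.
  split.
  - intros [Y (a & Ha)].
    refine (zero_iso (X := quot_pb B (emb_pb B Y)) _ _).
    + exists (fmap (quot_pb B) a); exact (fmap_iso (quot_pb B) Ha).
    + exact (P_zero_quot Kb_Npb HJpb (X := emb_pb B Y) (proj2_sig Y)).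
  - intro H; apply pb_iff_D.
    apply (proj1 (quot_zero Kb_Npb HJpb Jk_iso (X : D))) in H.
    exact (fmap_zero (vext_functor (trunc_le_Kpb HO C_bip EX)) H).
Qed.
Lemma mb_iff_quot0 (X : D) : ess_image (emb_mb B) X <-> ker_functor (quot_mb B) X.
Proof.
  split.
  - intros [Y (a & Ha)].
    refine (zero_iso (X := quot_mb B (emb_mb B Y)) _ _).
    + exists (fmap (quot_mb B) a); exact (fmap_iso (quot_mb B) Ha).
    + exact (P_zero_quot Kb_Nmb HJmb (X := emb_mb B Y) (proj2_sig Y)).
  - intro H; apply mb_iff_D.
    apply (proj1 (quot_zero Kb_Nmb HJmb Jk_iso (X : D))) in H.
    exact (fmap_zero (vext_functor (trunc_ge_Kmb HO C_bip EX)) H).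
Qed.

Notation Pac := (good_pretriangulated HO C_bip gKac).
Notation Ppb := (good_pretriangulated HO C_bip gKpb).
Notation Pmb := (good_pretriangulated HO C_bip gKmb).

Lemma incl_full (P Q : tsub (K C)) (H : forall X, P X -> Q X) : full (sub_incl H).
Proof. intros X Y h; exists h; apply (heq_equiv (p := K C)). Qed.

Section InjectiveSide.
Hypothesis orth : forall (X : sub_tricat (Kac B)) (Y : sub_tricat (Kpb B))
  (f : hom (Iac B X) (Ipb B Y)), f == 0.
Hypothesis dec : forall X : complex, bounded_homology X ->
  exists (V W : complex) (v : chain_map X V) (i : chain_map V W)
    (p : chain_map W (cshift_ob X)), Kpb B V /\ is_cone v i p /\ acyclic W.


(** The triangle X -> V -> W on the cone is rotated back: the acyclic part of [X] is the inverse
    translate of [W]. *)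
Lemma inj_dec (X : K0) : exists (U : sub_tricat (Kac B)) (V : sub_tricat (Kpb B))
  (u : hom (Iac B U) X) (v : hom X (Ipb B V)) (w : hom (Ipb B V) (shift (Iac B U))),
  tri u v w.
Proof.
  destruct X as [X HX]; destruct (dec HX) as (V & W & v & i & p & HV & HC & HW).
  pose (X0 := exist (Kib B) X HX : K0).
  pose (V0 := exist _ V HV : sub_tricat (Kpb B)).
  pose (W0 := exist _ W (Kac_Kib HW) : K0).
  assert (T : @tri K0 X0 (Ipb B V0) W0 v i p) by exact (cone_tri HC).
  pose (U := exist _ (unshift_ob W) (good_unshift gKac HW) : sub_tricat (Kac B)).
  assert (HI : @isomorphic K0 (shift (Iac B U)) W0) by exact (unshift_iso W).
  destruct HI as (e & e' & He).
  destruct (tri_unrot P0 T He) as (w & _ & T').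
  exists U, V0, w, v, (e' o (i : @hom K0 (Ipb B V0) W0)); exact T'.
Qed.

Notation lU := (lU P0 Pac (@incl_full _ _ (@Kac_Kib A B)) (fun X Y f g E => E) orth inj_dec).
Notation qV := (qV P0 Ppb (@incl_full _ _ (@Kpb_Kib A B)) (fun X Y f g E => E) orth inj_dec).

Lemma N0_Ipb (X : K0) : N0 X ->
  exists Y : sub_tricat (Kpb B), isomorphic (Ipb B Y) X /\ tsub_restrict (Kpb B) (Kb B) Y.
Proof.
  intro H; exists (exist _ (proj1_sig X) (conj (proj1 H) (proj2_sig X))).
  split; [| exact H]; exists (Jk X); apply Jk_iso.
Qed.
Lemma Npb_Ipb (X : K0) : Npb X ->
  exists Y : sub_tricat (Kpb B), isomorphic (Ipb B Y) X.
Proof.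
  intro H; exists (exist _ (proj1_sig X) H).
  exists (Jk X); apply Jk_iso.
Qed.
Lemma N0_Ipb' (X : K0) : N0 X ->
  exists Y : sub_tricat (Kpb B), isomorphic (Ipb B Y) X.
Proof. intro H; destruct (N0_Ipb H) as (Y & HI & _); exists Y; exact HI. Qed.

Definition c_ac : coreflection (tcomp (vproj_tri N0) (Iac B)) lU :=
  pair_coreflection P0 Pac (@incl_full _ _ (@Kac_Kib A B)) (fun X Y f g E => E)
    orth inj_dec N0_Ipb'.
Definition r_pb : reflection (emb_pb B) (tcomp (vproj_tri (tsub_restrict (Kpb B) (Kb B))) qV) :=
  pair_reflection_quotient P0 Ppb (@incl_full _ _ (@Kpb_Kib A B)) (fun X Y f g E => E)
    orth inj_dec _ N0_Ipb.

Lemma pb_iff_quot (X : D) : ess_image (emb_pb B) X <-> ker_functor (quot_pb B) X.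
Proof. exact (pb_iff_quot0 X). Qed.

Lemma q_e_ac (X : sub_tricat (Kac B)) :
  is_zero (tcomp (vproj_tri (tsub_restrict (Kpb B) (Kb B))) qV
    (tcomp (vproj_tri N0) (Iac B) X)).
Proof.
  exact (fmap_zero (vproj (tsub_restrict (Kpb B) (Kb B))) (qV_IU _ _ _ _ orth inj_dec X)).
Qed.

Lemma ac_pb_tri (X : K0) : exists h, @tri D _ _ _ (cr_eps c_ac X) (rf_eta r_pb X) h.
Proof.
  eexists; exact (pair_tri (IU := Iac B) (IV := Ipb B) inj_dec N0 X).
Qed.

Lemma ac_detect (X : K0) :
  is_zero (tcomp (vproj_tri (tsub_restrict (Kpb B) (Kb B))) qV X) ->
  is_iso (cr_eps c_ac X).
Proof.
  intro H; destruct (zero_detect_pb HO C_bip EX (X := qV X) H) as (M & HM & HR).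
  exact (detect_iso HO C_bip EX (eps_eta_tri inj_dec X) HM HR).
Qed.

Lemma ac_surj (X : sub_tricat (Kac B)) : exists X', isomorphic (shift X') X.
Proof. exact (good_surj gKac X). Qed.

Lemma eps_ac_Npb (X : K0) : is_iso (fmap (quot0 Kb_Npb) (cr_eps c_ac X)).
Proof.
  apply (quot0_vincl_iso Kb_Npb (s := eps (IU := Iac B) (IV := Ipb B) inj_dec X)).
  eexists _, _, _; split; [exact (eps_eta_tri inj_dec X) | exact (proj2_sig (qV X))].
Qed.

Lemma injective_ff :
  fully_faithful (emb_ac B) /\ fully_faithful (emb_pb B) /\ fully_faithful (emb_mb B).
Proof.
  split; [exact (cr_ff c_ac) |]; split; [exact (cr_ff c_ge) | exact (rf_ff r_le)].
Qed.

Lemma ac_pb_stable : stable_t_structure (ess_image (emb_ac B)) (ess_image (emb_pb B)).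
Proof. exact (coreflection_stable ac_surj pb_surj q_e_ac ac_pb_tri). Qed.

(** The common term is K^{+,b}/K^b. Its reflection comes from resolutions, paired with the acyclic
    complexes; its coreflection comes from truncation, paired with K^{-,b}/K^b. *)
Lemma injective_recollement : exists r : recollement (emb_pb B) (quot_pb B),
  (forall X, ess_image (rec_j_lower_shriek r) X <-> ess_image (emb_ac B) X) /\
  (forall X, ess_image (rec_j_lower_star r) X <-> ess_image (emb_mb B) X).
Proof.
  exact (recollement_of (NP := Kb_Npb) (HJ := HJpb) (k := Jk) Jk_iso Jk_nat
    (cU := c_ac) (rV := r_pb) (cV := c_ge) (rW := r_le)
    (lU_inv _ _ _ _ orth inj_dec Npb_Ipb) (trunc_le_Kpb HO C_bip EX)
    eps_ac_Npb eta_le_Npb (ess_image_e_iff r_pb q_e_ac ac_detect) mb_iff_D pb_iff_quot).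
Qed.
End InjectiveSide.

Section ProjectiveSide.
Hypothesis orth : forall (X : sub_tricat (Kmb B)) (Y : sub_tricat (Kac B))
  (f : hom (Imb B X) (Iac B Y)), f == 0.
Hypothesis dec : forall X : complex, bounded_homology X ->
  exists (V W : complex) (v : chain_map V X) (i : chain_map X W)
    (p : chain_map W (cshift_ob V)), Kmb B V /\ is_cone v i p /\ acyclic W.

Lemma proj_dec (X : K0) : exists (U : sub_tricat (Kmb B)) (V : sub_tricat (Kac B))
  (u : hom (Imb B U) X) (v : hom X (Iac B V)) (w : hom (Iac B V) (shift (Imb B U))),
  tri u v w.
Proof.
  destruct X as [X HX]; destruct (dec HX) as (V & W & v & i & p & HV & HC & HW).
  exists (exist _ V HV), (exist _ W HW), v, i, p; exact (cone_tri HC).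
Qed.

Notation lU := (lU P0 Pmb (@incl_full _ _ (@Kmb_Kib A B)) (fun X Y f g E => E) orth proj_dec).
Notation qV := (qV P0 Pac (@incl_full _ _ (@Kac_Kib A B)) (fun X Y f g E => E) orth proj_dec).

Lemma N0_Imb (X : K0) : N0 X ->
  exists Y : sub_tricat (Kmb B), isomorphic (Imb B Y) X /\ tsub_restrict (Kmb B) (Kb B) Y.
Proof.
  intro H; exists (exist _ (proj1_sig X) (conj (proj2 H) (proj2_sig X))).
  split; [| exact H]; exists (Jk X); apply Jk_iso.
Qed.
Lemma Nmb_Imb (X : K0) : Nmb X ->
  exists Y : sub_tricat (Kmb B), isomorphic (Imb B Y) X.
Proof.
  intro H; exists (exist _ (proj1_sig X) H).
  exists (Jk X); apply Jk_iso.
Qed.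
Lemma N0_Imb' (X : K0) : N0 X ->
  exists Y : sub_tricat (Kmb B), isomorphic (Imb B Y) X.
Proof. intro H; destruct (N0_Imb H) as (Y & HI & _); exists Y; exact HI. Qed.

Definition c_mb : coreflection (emb_mb B) (tcomp (vproj_tri (tsub_restrict (Kmb B) (Kb B))) lU) :=
  pair_coreflection_quotient P0 Pmb (@incl_full _ _ (@Kmb_Kib A B)) (fun X Y f g E => E)
    orth proj_dec _ N0_Imb.
Definition r_ac : reflection (tcomp (vproj_tri N0) (Iac B)) qV :=
  pair_reflection P0 Pac (@incl_full _ _ (@Kac_Kib A B)) (fun X Y f g E => E)
    orth proj_dec N0_Imb'.

Lemma mb_iff_quot (X : D) : ess_image (emb_mb B) X <-> ker_functor (quot_mb B) X.
Proof. exact (mb_iff_quot0 X). Qed.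

Lemma q_e_mb (X : Kquot (Kmb B) (Kb B)) : is_zero (qV (emb_mb B X)).
Proof. exact (qV_IU _ _ _ _ orth proj_dec X). Qed.

Lemma mb_ac_tri (X : K0) : exists h, @tri D _ _ _ (cr_eps c_mb X) (rf_eta r_ac X) h.
Proof.
  eexists; exact (pair_tri (IU := Imb B) (IV := Iac B) proj_dec N0 X).
Qed.

Lemma mb_ac_detect (X : K0) :
  is_zero (tcomp (vproj_tri (tsub_restrict (Kmb B) (Kb B))) lU X) ->
  is_iso (rf_eta r_ac X).
Proof.
  intro H; destruct (zero_detect_mb HO C_bip EX (X := lU X) H) as (M & HM & HR).
  exact (detect_iso HO C_bip EX (pt_rot P0 (eps_eta_tri proj_dec X)) (tmem_shift HM)
    (retract_shift HR)).
Qed.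

Lemma eta_ac_Nmb (X : K0) : is_iso (fmap (quot0 Kb_Nmb) (rf_eta r_ac X)).
Proof.
  apply (quot0_vincl_iso Kb_Nmb (s := eta (IU := Imb B) (IV := Iac B) proj_dec X)).
  eexists _, _, _; split; [exact (pt_rot P0 (eps_eta_tri proj_dec X)) |].
  exact (tmem_shift (proj2_sig (lU X))).
Qed.

Lemma projective_ff :
  fully_faithful (emb_ac B) /\ fully_faithful (emb_pb B) /\ fully_faithful (emb_mb B).
Proof.
  split; [exact (rf_ff r_ac) |]; split; [exact (cr_ff c_ge) | exact (rf_ff r_le)].
Qed.

Lemma mb_ac_stable : stable_t_structure (ess_image (emb_mb B)) (ess_image (emb_ac B)).
Proof. exact (coreflection_stable mb_surj (good_surj gKac) q_e_mb mb_ac_tri). Qed.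

(** The common term is now K^{-,b}/K^b, reflected onto by truncation and coreflected onto by
    resolutions. *)
Lemma projective_recollement : exists r : recollement (emb_mb B) (quot_mb B),
  (forall X, ess_image (rec_j_lower_shriek r) X <-> ess_image (emb_pb B) X) /\
  (forall X, ess_image (rec_j_lower_star r) X <-> ess_image (emb_ac B) X).
Proof.
  exact (recollement_of (NP := Kb_Nmb) (HJ := HJmb) (k := Jk) Jk_iso Jk_nat
    (cU := c_ge) (rV := r_le) (cV := c_mb) (rW := r_ac)
    (trunc_ge_Kmb HO C_bip EX) (qV_inv _ _ _ _ orth proj_dec Nmb_Imb)
    eps_ge_Nmb eta_ac_Nmb pb_iff_D (ess_image_i_iff c_mb q_e_mb mb_ac_detect) mb_iff_quot).
Qed.
End ProjectiveSide.
End Classes.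

(** * Resolutions *)

Section Recursion.
Variables (State : Z -> Type) (Inv : forall n, State n -> Prop).
Variable Link : forall n, State n -> State (n + 1)%Z -> Prop.
Variables (n0 : Z) (z : forall n, State n).

(** The prescribed values [z] are kept up to [n0] and continued stepwise from there. The index
    reached after [k] steps equals [n0 + k] only propositionally, so the iteration runs over states
    paired with their index. *)
Lemma Z_recursion_up :
  (forall n, (n <= n0)%Z -> Inv (z n)) ->
  (forall n, (n < n0)%Z -> Link (z n) (z (n + 1)%Z)) ->
  (forall n (s : State n), (n0 <= n)%Z -> Inv s ->
     exists s' : State (n + 1)%Z, Inv s' /\ Link s s') ->
  exists s : forall n, State n,
    (forall n, (n <= n0)%Z -> s n = z n) /\ forall n, Link (s n) (s (n + 1)%Z).
Proof.
  intros H1 H2 H3.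
  assert (HF : forall n (s : State n), exists s' : State (n + 1)%Z,
    (n0 <= n)%Z -> Inv s -> Inv s' /\ Link s s').
  (* Outside the range or the invariant the step returns the default [z]; this makes it a total
     function that can be chosen. *)
  { intros n s; destruct (classic ((n0 <= n)%Z /\ Inv s)) as [[Ha Hb] | Hn].
    - destruct (H3 n s Ha Hb) as [s' Hs']; exists s'; intros _ _; exact Hs'.
    - exists (z (n + 1)%Z); intros Ha Hb; destruct (Hn (conj Ha Hb)). }
  pose (F n s := proj1_sig (constructive_indefinite_description _ (HF n s))).
  assert (FP : forall n (s : State n), (n0 <= n)%Z -> Inv s -> Inv (F n s) /\ Link s (F n s))
    by (intros n s; exact (proj2_sig (constructive_indefinite_description _ (HF n s)))).
  clearbody F; clear HF H3.
  pose (t := fix t (k : nat) : {n : Z & State n} := match k with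
    | O => existT _ n0 (z n0)
    | S k => existT _ (projT1 (t k) + 1)%Z (F (projT1 (t k)) (projT2 (t k)))
    end).
  assert (T1 : forall k, projT1 (t k) = (n0 + Z.of_nat k)%Z).
  { induction k as [| k IH]; [simpl; lia |].
    change (projT1 (t (S k))) with (projT1 (t k) + 1)%Z; rewrite IH; lia. }
  assert (T2 : forall k, Inv (projT2 (t k))).
  { induction k as [| k IH]; [apply H1; simpl; lia |].
    apply FP; [rewrite T1; lia | exact IH]. }
  assert (e : forall n, (n0 <= n)%Z -> projT1 (t (Z.to_nat (n - n0))) = n)
    by (intros n Hn; rewrite T1; lia).
  pose (s n := match Z_le_gt_dec n0 n with
    | left Hn => eq_rect _ State (projT2 (t (Z.to_nat (n - n0)))) n (e n Hn)
    | right _ => z n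
    end).
  (* At the indices the iteration itself produces, the transport is along a loop and disappears; all
     later reasoning uses these indices. *)
  assert (S1 : forall k, s (projT1 (t k)) = projT2 (t k)).
  { intro k; unfold s; destruct (Z_le_gt_dec n0 (projT1 (t k))) as [Hn | Hn];
      [| exfalso; rewrite T1 in Hn; lia].
    generalize (e (projT1 (t k)) Hn).
    replace (Z.to_nat (projT1 (t k) - n0)) with k by (rewrite T1; lia).
    intro e'; rewrite (UIP_dec Z.eq_dec e' eq_refl); reflexivity. }
  assert (S2 : forall n, (n <= n0)%Z -> s n = z n).
  { intros n Hn; destruct (Z.eq_dec n n0) as [E | E].
    - subst n; exact (S1 O).
    - unfold s; destruct (Z_le_gt_dec n0 n); [lia | reflexivity]. }
  exists s; split; [exact S2 |].
  intro n; destruct (Z_lt_le_dec n n0) as [Hn | Hn].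
  - rewrite !S2 by lia; apply H2, Hn.
  - rewrite <- (e n Hn); set (k := Z.to_nat (n - n0)).
    rewrite S1; pose proof (S1 (S k)) as E.
    change (projT1 (t (S k))) with (projT1 (t k) + 1)%Z in E; rewrite E.
    apply FP; [rewrite T1; lia | apply T2].
Qed.

Lemma Z_recursion_down :
  (forall n, (n0 <= n)%Z -> Inv (z n)) ->
  (forall n, (n0 <= n)%Z -> Link (z n) (z (n + 1)%Z)) ->
  (forall n (s' : State (n + 1)%Z), (n < n0)%Z -> Inv s' ->
     exists s : State n, Inv s /\ Link s s') ->
  exists s : forall n, State n,
    (forall n, (n0 <= n)%Z -> s n = z n) /\ forall n, Link (s n) (s (n + 1)%Z).
Proof.
  intros H1 H2 H3.
  assert (HF : forall n (s' : State (n + 1)%Z), exists s : State n,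
    (n < n0)%Z -> Inv s' -> Inv s /\ Link s s').
  { intros n s; destruct (classic ((n < n0)%Z /\ Inv s)) as [[Ha Hb] | Hn].
    - destruct (H3 n s Ha Hb) as [s' Hs']; exists s'; intros _ _; exact Hs'.
    - exists (z n); intros Ha Hb; destruct (Hn (conj Ha Hb)). }
  pose (F n s := proj1_sig (constructive_indefinite_description _ (HF n s))).
  assert (FP : forall n (s : State (n + 1)%Z), (n < n0)%Z -> Inv s ->
      Inv (F n s) /\ Link (F n s) s)
    by (intros n s; exact (proj2_sig (constructive_indefinite_description _ (HF n s)))).
  clearbody F; clear HF H3.
  assert (c : forall n, (n = n - 1 + 1)%Z) by (intro; lia).
  (* The downward step expects a state at an index of the form [m + 1], so the current one is first
     moved from [n] to [n - 1 + 1]. *)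
  pose (G n (s : State n) := F (n - 1)%Z (eq_rect _ State s _ (c n))).
  pose (t := fix t (k : nat) : {n : Z & State n} := match k with
    | O => existT _ n0 (z n0)
    | S k => existT _ (projT1 (t k) - 1)%Z (G (projT1 (t k)) (projT2 (t k)))
    end).
  assert (T1 : forall k, projT1 (t k) = (n0 - Z.of_nat k)%Z).
  { induction k as [| k IH]; [simpl; lia |].
    change (projT1 (t (S k))) with (projT1 (t k) - 1)%Z; rewrite IH; lia. }
  assert (IC : forall n m (E : n = m) (s : State n), Inv s -> Inv (eq_rect n State s m E))
    by (intros n m [] s H; exact H).
  assert (T2 : forall k, Inv (projT2 (t k))).
  { induction k as [| k IH]; [apply H1; simpl; lia |].
    apply FP; [rewrite T1; lia | apply IC, IH]. }
  assert (e : forall n, (n <= n0)%Z -> projT1 (t (Z.to_nat (n0 - n))) = n)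
    by (intros n Hn; rewrite T1; lia).
  pose (s n := match Z_le_gt_dec n n0 with
    | left Hn => eq_rect _ State (projT2 (t (Z.to_nat (n0 - n)))) n (e n Hn)
    | right _ => z n
    end).
  assert (S1 : forall k, s (projT1 (t k)) = projT2 (t k)).
  { intro k; unfold s; destruct (Z_le_gt_dec (projT1 (t k)) n0) as [Hn | Hn];
      [| exfalso; rewrite T1 in Hn; lia].
    generalize (e (projT1 (t k)) Hn).
    replace (Z.to_nat (n0 - projT1 (t k))) with k by (rewrite T1; lia).
    intro e'; rewrite (UIP_dec Z.eq_dec e' eq_refl); reflexivity. }
  assert (S2 : forall n, (n0 <= n)%Z -> s n = z n).
  { intros n Hn; destruct (Z.eq_dec n n0) as [E | E].
    - subst n; exact (S1 O).
    - unfold s; destruct (Z_le_gt_dec n n0); [lia | reflexivity]. }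
  exists s; split; [exact S2 |].
  intro n; destruct (Z_lt_le_dec n n0) as [Hn | Hn];
    [| rewrite !S2 by lia; apply H2, Hn].
  assert (SC : forall m m' (E : m = m'), s m' = eq_rect m State (s m) m' E)
    by (intros m m' []; reflexivity).
  assert (H : forall m, (m <= n0)%Z -> Link (s (m - 1)%Z) (s (m - 1 + 1)%Z)).
  { intros m Hm; rewrite <- (e m Hm); set (k := Z.to_nat (n0 - m)).
    rewrite (SC _ _ (c (projT1 (t k)))), S1.
    pose proof (S1 (S k)) as E.
    change (projT1 (t (S k))) with (projT1 (t k) - 1)%Z in E; rewrite E.
    apply FP; [rewrite T1; lia | apply IC, T2]. }
  specialize (H (n + 1)%Z ltac:(lia)); revert H.
  replace (n + 1 - 1)%Z with n by lia; intro H; exact H.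
Qed.
End Recursion.

(** * Exactness tested by extending or lifting maps *)

Section HomExactness.
Variable C : preadditive.
Notation complex := (complex C).

Definition inj_exact (X Y V : C) (f : hom X Y) (g : hom Y V) : Prop :=
  forall (I : C) (k : hom Y I), k o f == 0 -> exists k' : hom V I, k' o g == k.
Definition proj_exact (X Y V : C) (f : hom X Y) (g : hom Y V) : Prop :=
  forall (P : C) (k : hom P Y), g o k == 0 -> exists k' : hom P X, f o k' == k.

Lemma inj_exact_zero (X Y V : C) (f : hom X Y) (g : hom Y V) :
  is_zero Y -> inj_exact f g.
Proof.
  intros HY I k _; exists 0; etransitivity; [| symmetry]; apply zero_from, HY.
Qed.
Lemma proj_exact_zero (X Y V : C) (f : hom X Y) (g : hom Y V) :
  is_zero Y -> proj_exact f g.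
Proof.
  intros HY I k _; exists 0; etransitivity; [| symmetry]; apply zero_to, HY.
Qed.

Section Iso.
Variables (X Y V X' Y' V' : C) (f : hom X Y) (g : hom Y V) (f' : hom X' Y') (g' : hom Y' V').
Variables (a : hom X X') (b : hom Y Y') (c : hom V V').
Hypotheses (Ha : is_iso a) (Hb : is_iso b) (Hc : is_iso c).
Hypotheses (E1 : b o f == f' o a) (E2 : c o g == g' o b).

Lemma inj_exact_iso : inj_exact f g -> inj_exact f' g'.
Proof.
  intros H I k Hk; destruct (H I (k o b)) as [k' Ek'].
  { rewrite <- comp_assoc, E1, comp_assoc, Hk; apply comp_0l. }
  exists (k' o iso_inv Hc); apply (iso_epi Hb).
  rewrite <- comp_assoc, <- E2, comp_assoc, <- (comp_assoc k'), iso_inv_l, comp_id_r.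
  exact Ek'.
Qed.
Lemma proj_exact_iso : proj_exact f g -> proj_exact f' g'.
Proof.
  intros H P k Hk; destruct (H P (iso_inv Hb o k)) as [k' Ek'].
  { apply (iso_mono Hc).
    rewrite comp_assoc, E2, comp_assoc, <- (comp_assoc g'), iso_inv_r, comp_id_r, Hk.
    symmetry; apply comp_0r. }
  exists (a o k'); rewrite comp_assoc, <- E1, <- comp_assoc, Ek', comp_assoc, iso_inv_r.
  apply comp_id_l.
Qed.
End Iso.

Section Cone.
Variables (X Y W : complex) (u : chain_map X Y) (i : chain_map Y W)
  (p : chain_map W (cshift_ob X)).
Variables (iX : forall n : Z, hom (X (n + 1)%Z) (W n))
          (pY : forall n : Z, hom (W n) (Y n)).
Hypothesis HC : forall n : Z, is_biproduct (iX n) (i n) (p n) (pY n).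
Hypothesis HD : forall n : Z, dif W n o iX n ==
  iX (n + 1)%Z o (- dif X (n + 1)%Z) + i (n + 1)%Z o u (n + 1)%Z.

Lemma cone_pY n : pY (n + 1)%Z o dif W n == u (n + 1)%Z o p n + dif Y n o pY n.
Proof.
  apply (bip_ext_from (HC n)); expand.
  - rewrite <- comp_assoc, HD; expand.
    crw (bip_XY (HC (n + 1)%Z)); crw (bip_YY (HC (n + 1)%Z)).
    crw (bip_XX (HC n)); crw (bip_XY (HC n)); expand; abel.
  - rewrite <- (comp_assoc _ (dif W n)), <- (cm_dif i n); expand.
    crw (bip_YY (HC (n + 1)%Z)); crw (bip_YX (HC n)); crw (bip_YY (HC n)); expand; abel.
Qed.
Lemma cone_p n : p (n + 1)%Z o dif W n == - (dif X (n + 1)%Z o p n).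
Proof. rewrite (cm_dif p n); simpl; apply comp_opp_l. Qed.

(** Extend the restriction of [k] to [Y] by [b]; then the component of [k] on [X], corrected by
    [b u], kills the incoming differential of [X] and extends by [a]. The sign in front of [a]
    matches the differential of X[1]. *)
Lemma inj_exact_cone n :
  inj_exact (dif X (n + 1)%Z) (dif X (n + 1 + 1)%Z) -> inj_exact (dif Y n) (dif Y (n + 1)%Z) ->
  inj_exact (dif W n) (dif W (n + 1)%Z).
Proof.
  intros HX HY I k Hk.
  destruct (HY I (k o i (n + 1)%Z)) as [b Hb].
  { rewrite <- comp_assoc, (cm_dif i n), comp_assoc, Hk; apply comp_0l. }
  destruct (HX I (k o iX (n + 1)%Z + - (b o u (n + 1 + 1)%Z))) as [a Ha].
  { assert (E : k o (dif W n o iX n) == 0) by (rewrite comp_assoc, Hk; apply comp_0l).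
    rewrite HD in E; expand_in E; rewrite <- Hb in E.
    rewrite <- (comp_assoc b), <- cm_dif in E; expand_in E.
    expand; rewrite <- (hopp_opp (_ + _)); rewrite <- hopp_0; apply hopp_Proper.
    rewrite <- E; abel. }
  exists (- (a o p (n + 1 + 1)%Z) + b o pY (n + 1 + 1)%Z).
  apply (bip_ext_from (HC (n + 1)%Z)).
  - rewrite <- comp_assoc, HD; expand.
    repeat crw (bip_XX (HC (n + 1 + 1)%Z)); repeat crw (bip_XY (HC (n + 1 + 1)%Z)).
    repeat crw (bip_YX (HC (n + 1 + 1)%Z)); repeat crw (bip_YY (HC (n + 1 + 1)%Z)).
    expand; rewrite Ha; abel.
  - rewrite <- comp_assoc, <- (cm_dif i (n + 1)%Z); expand.
    repeat crw (bip_YX (HC (n + 1 + 1)%Z)); repeat crw (bip_YY (HC (n + 1 + 1)%Z)).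
    expand; rewrite Hb; abel.
Qed.

Lemma proj_exact_cone n :
  proj_exact (dif X (n + 1)%Z) (dif X (n + 1 + 1)%Z) ->
  proj_exact (dif Y n) (dif Y (n + 1)%Z) ->
  proj_exact (dif W n) (dif W (n + 1)%Z).
Proof.
  intros HX HY P k Hk.
  destruct (HX P (p (n + 1)%Z o k)) as [a Ha].
  { rewrite comp_assoc, <- (hopp_opp (_ o p _)), <- cone_p, comp_opp_l, <- comp_assoc, Hk.
    rewrite comp_0r; apply hopp_0. }
  destruct (HY P (u (n + 1)%Z o a + pY (n + 1)%Z o k)) as [b Hb].
  { assert (E : pY (n + 1 + 1)%Z o (dif W (n + 1)%Z o k) == 0) by (rewrite Hk; apply comp_0r).
    rewrite comp_assoc, cone_pY in E; expand_in E; rewrite <- (comp_assoc (u _)), <- Ha in E.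
    expand_in E; expand; rewrite <- cm_dif; exact E. }
  exists (- (iX n o a) + i n o b); apply (bip_ext_to (HC (n + 1)%Z)).
  - rewrite comp_assoc, cone_p; expand.
    crw (bip_XX (HC n)); crw (bip_YX (HC n)); expand; rewrite Ha; abel.
  - rewrite comp_assoc, cone_pY; expand.
    repeat crw (bip_XX (HC n)); repeat crw (bip_XY (HC n));
    repeat crw (bip_YX (HC n)); repeat crw (bip_YY (HC n)); expand.
    rewrite Hb; abel.
Qed.

(** Serves to bound the homology of a resolution. Extending [k u] along the differential of [X]
    completes [k] to a map on the cone that kills the incoming differential; its extension restricts
    to [Y]. *)
Lemma inj_exact_target n :
  inj_exact (dif X n) (dif X (n + 1)%Z) -> inj_exact (dif W n) (dif W (n + 1)%Z) ->
  inj_exact (dif Y n) (dif Y (n + 1)%Z).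
Proof.
  intros HX HW I k Hk.
  destruct (HX I (k o u (n + 1)%Z)) as [a Ha].
  { rewrite <- comp_assoc, cm_dif, comp_assoc, Hk; apply comp_0l. }
  destruct (HW I (a o p (n + 1)%Z + k o pY (n + 1)%Z)) as [b Hb].
  { rewrite comp_hadd_l, <- !comp_assoc, cone_p, cone_pY; expand; rewrite Ha, Hk.
    expand; abel. }
  exists (b o i (n + 1 + 1)%Z).
  rewrite <- comp_assoc, cm_dif, comp_assoc, Hb; expand.
  crw (bip_YX (HC (n + 1)%Z)); crw (bip_YY (HC (n + 1)%Z)); expand; abel.
Qed.

Lemma proj_exact_source n :
  proj_exact (dif Y (n + 1)%Z) (dif Y (n + 1 + 1)%Z) ->
  proj_exact (dif W n) (dif W (n + 1)%Z) ->
  proj_exact (dif X (n + 1)%Z) (dif X (n + 1 + 1)%Z).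
Proof.
  intros HY HW P k Hk.
  destruct (HY P (u (n + 1 + 1)%Z o k)) as [a Ha].
  { rewrite comp_assoc, <- cm_dif, <- comp_assoc, Hk; apply comp_0r. }
  destruct (HW P (iX (n + 1)%Z o k + - (i (n + 1)%Z o a))) as [b Hb].
  { rewrite comp_hadd_r, comp_opp_r, !comp_assoc, HD, <- (cm_dif i); expand.
    rewrite <- (comp_assoc _ (dif X _)), Hk, <- (comp_assoc _ (dif Y _)), Ha; expand; abel. }
  exists (- (p n o b)).
  assert (E : p (n + 1)%Z o (dif W n o b) == k).
  { rewrite Hb; expand; crw (bip_XX (HC (n + 1)%Z)); crw (bip_YX (HC (n + 1)%Z)).
    expand; abel. }
  rewrite <- E, comp_assoc, cone_p; expand; reflexivity.
Qed.
End Cone.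

(** The homotopy is built upwards from the degrees where [V] vanishes. The invariant says that
    [f - d h] kills the incoming differential of [U]; exactness of [U] then extends it to the next
    component. *)
Lemma inj_null_homotopic (U V : complex) (f : chain_map U V) m :
  (forall n, inj_exact (dif U n) (dif U (n + 1)%Z)) ->
  (forall n, (n < m)%Z -> is_zero (V n)) ->
  homotopic f (cm_zero U V).
Proof.
  intros HU HV.
  destruct (@Z_recursion_up (fun n => hom (U (n + 1)%Z) (V n))
    (fun n h => (f (n + 1)%Z + - (dif V n o h)) o dif U n == 0)
    (fun n h h' => f (n + 1)%Z == 0 + (dif V n o h + h' o dif U (n + 1)%Z))
    (m - 1) (fun n => 0)) as (h & _ & Hh).
  - intros n Hn; expand; rewrite cm_dif, (zero_to (f n)) by (apply HV; lia).
    expand; abel.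
  - intros n Hn; rewrite (zero_to (f (n + 1)%Z)) by (apply HV; lia); expand; abel.
  - intros n h Hn Inv; destruct (HU n _ _ Inv) as [h' E]; exists h'; split.
    + rewrite comp_hadd_l, comp_opp_l, <- (comp_assoc _ h'), E, cm_dif; expand.
      rewrite dif_dif; expand; abel.
    + rewrite E; abel.
  - exists h; exact Hh.
Qed.

(** Dually, one descends from the degrees where [U] vanishes, lifting [f - h d] through the exact
    complex [V]. *)
Lemma proj_null_homotopic (U V : complex) (f : chain_map U V) m :
  (forall n, proj_exact (dif V n) (dif V (n + 1)%Z)) ->
  (forall n, (m < n)%Z -> is_zero (U n)) ->
  homotopic f (cm_zero U V).
Proof.
  intros HV HU.
  destruct (@Z_recursion_down (fun n => hom (U (n + 1)%Z) (V n))
    (fun n h => dif V n o (f n + - (h o dif U n)) == 0)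
    (fun n h h' => f (n + 1)%Z == 0 + (dif V n o h + h' o dif U (n + 1)%Z))
    (m + 1) (fun n => 0)) as (h & _ & Hh).
  - intros n Hn; rewrite (zero_from (f n)) by (apply HU; lia).
    expand; abel.
  - intros n Hn; rewrite (zero_from (f (n + 1)%Z)) by (apply HU; lia); expand; abel.
  - intros n h' Hn Inv; destruct (HV n _ _ Inv) as [h E]; exists h; split.
    + rewrite comp_hadd_r, comp_opp_r, comp_assoc, E, <- cm_dif; expand.
      rewrite <- (comp_assoc h'), dif_dif; expand; abel.
    + rewrite E; abel.
  - exists h; exact Hh.
Qed.
End HomExactness.

Lemma zero_from_eq (C : preadditive) (X Y : C) (f g : hom X Y) : is_zero X -> f == g.
Proof. intro H; etransitivity; [| symmetry]; apply zero_from, H. Qed.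
Lemma zero_to_eq (C : preadditive) (X Y : C) (f g : hom X Y) : is_zero Y -> f == g.
Proof. intro H; etransitivity; [| symmetry]; apply zero_to, H. Qed.

(** * Resolutions by weak cokernels and weak kernels *)

Section Resolutions.
Variables (C : preadditive) (O : C).
Hypothesis HO : is_zero O.
Hypothesis C_bip : has_biproducts C.
Notation complex := (complex C).

Section Injective.
Hypothesis weak_coker : forall (X Y : C) (f : hom X Y), exists (W : C) (c : hom Y W),
  c o f == 0 /\ forall (I : C) (k : hom Y I), k o f == 0 -> exists k', k' o c == k.

(** Take the weak cokernel of the matrix S + X0 -> V + X1 with entries [t], [v] into [V] and [0],
    [-d] into [X1]: maps killing this matrix are exactly the compatible pairs [b], [a] with [b]
    killing [t]. *)
Lemma weak_pushout (S X0 X1 V : C) (t : hom S V) (v : hom X0 V) (d : hom X0 X1) :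
  exists (V' : C) (dl : hom V V') (v' : hom X1 V'),
    dl o t == 0 /\ dl o v == v' o d /\
    forall (I : C) (a : hom X1 I) (b : hom V I), b o t == 0 -> a o d == b o v ->
      exists k : hom V' I, k o dl == b /\ k o v' == a.
Proof.
  destruct (C_bip S X0) as (E & iS & iX & pS & pX & H).
  destruct (C_bip V X1) as (E' & jV & jX & qV & qX & H').
  destruct (weak_coker (jV o t o pS + jV o v o pX + - (jX o d o pX))) as (W & c & c0 & cW).
  exists W, (c o jV), (c o jX).
  destruct H as [H1 H2 H3 H4 H5], H' as [K1 K2 K3 K4 K5]; split; [| split].
  - assert (E0 : c o (jV o t o pS + jV o v o pX + - (jX o d o pX)) o iS == 0)
      by (rewrite c0; apply comp_0l).
    expand_in E0; rewrite <- E0; repeat crw H1; repeat crw H3; expand; abel.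
  - assert (E0 : c o (jV o t o pS + jV o v o pX + - (jX o d o pX)) o iX == 0)
      by (rewrite c0; apply comp_0l).
    expand_in E0; apply (hadd_inj (h := - (c o jX o d))); rewrite hadd_opp, <- E0.
    repeat crw H4; repeat crw H2; expand; abel.
  - intros I a b Hb Ha; destruct (cW I (b o qV + a o qX)) as [k Hk].
    + expand; repeat crw K1; repeat crw K2; repeat crw K3; repeat crw K4; expand.
      rewrite Hb, Ha; expand; abel.
    + exists k; split; rewrite comp_assoc, Hk; expand;
        repeat crw K1; repeat crw K2; repeat crw K3; repeat crw K4; expand; abel.
Qed.

(** A stage holds the term V^n, the map from X^n, and the incoming differential [ut], whose source
    is stored as a separate object [uS]. *)
Record up_state (X : complex) (n : Z) := {
  uV : C; uv : hom (X n) uV; uS : C; ut : hom uS uV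
}.

(* A morphism kills [ut s'] iff it kills [dl]; this links the differential of one
   step to the next without equalities between objects. *)
Definition up_link (X : complex) (n0 n : Z) (s : up_state X n) (s' : up_state X (n + 1)) :
    Prop :=
  exists dl : hom (uV s) (uV s'),
    dl o ut s == 0 /\ dl o uv s == uv s' o dif X n /\
    ((n0 <= n)%Z -> forall (I : C) (a : hom (X (n + 1)%Z) I) (b : hom (uV s) I),
      b o ut s == 0 -> a o dif X n == b o uv s ->
      exists k : hom (uV s') I, k o dl == b /\ k o uv s' == a) /\
    forall (I : C) (b : hom (uV s') I), b o ut s' == 0 <-> b o dl == 0.

(** Below [n0] the terms of [V] vanish and the cone is exact because [X] is. From [n0] on, exactness
    of the cone is the weak pushout property by which each new term of [V] was chosen. *)
Lemma injective_resolution (X : complex) n0 :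
  (forall n, (n < n0)%Z -> inj_exact (dif X (n + 1)%Z) (dif X (n + 1 + 1)%Z)) ->
  exists (V : complex) (v : chain_map X V),
    (forall n, (n <= n0)%Z -> is_zero (V n)) /\
    forall (W : complex) (i : chain_map V W) (p : chain_map W (cshift_ob X)),
      is_cone v i p -> forall n, inj_exact (dif W n) (dif W (n + 1)%Z).
Proof.
  intro HX.
  destruct (@Z_recursion_up (up_state X) (fun _ _ => True) (@up_link X n0) n0
    (fun n => {| uV := O; uv := 0; uS := O; ut := 0 |})) as (s & Hz & Hs).
  - auto.
  - intros n Hn; exists 0; simpl.
    split; [apply comp_0l |]; split; [rewrite !comp_0l; reflexivity |].
    split; [lia |]; intros I b; rewrite !comp_0r; split; reflexivity.
  - intros n s Hn _.
    destruct (weak_pushout (ut s) (uv s) (dif X n)) as (V' & dl & v' & E1 & E2 & E3).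
    exists {| uV := V'; uv := v'; uS := uV s; ut := dl |}; split; [exact Logic.I |].
    exists dl; simpl; split; [exact E1 |]; split; [exact E2 |].
    split; [intros _; exact E3 |]; intros; reflexivity.
  - pose (dl n := proj1_sig (constructive_indefinite_description _ (Hs n))).
    assert (Hdl : forall n, dl n o ut (s n) == 0 /\
        dl n o uv (s n) == uv (s (n + 1)%Z) o dif X n /\
        ((n0 <= n)%Z -> forall (I : C) (a : hom (X (n + 1)%Z) I) (b : hom (uV (s n)) I),
          b o ut (s n) == 0 -> a o dif X n == b o uv (s n) ->
          exists k : hom (uV (s (n + 1)%Z)) I, k o dl n == b /\ k o uv (s (n + 1)%Z) == a) /\
        forall (I : C) (b : hom (uV (s (n + 1)%Z)) I),
          b o ut (s (n + 1)%Z) == 0 <-> b o dl n == 0)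
      by (intro n; exact (proj2_sig (constructive_indefinite_description _ (Hs n)))).
    clearbody dl; clear Hs.
    assert (DD : forall n, dl (n + 1)%Z o dl n == 0).
    { intro n; apply (proj2 (proj2 (proj2 (Hdl n)))), (Hdl (n + 1)%Z). }
    pose (V := @Complex C (fun n => uV (s n)) dl DD).
    assert (Ev : forall n, uv (s (n + 1)%Z) o dif X n == dif V n o uv (s n)).
    { intro n; symmetry; apply (Hdl n). }
    pose (v := @ChainMap C X V (fun n => uv (s n)) Ev).
    exists V, v.
    assert (VZ : forall n, (n <= n0)%Z -> is_zero (V n)).
    { intros n Hn; simpl; rewrite (Hz n Hn); exact HO. }
    split; [exact VZ |].
    intros W i p (iX & pY & HC & HD) n I k Hk.
    pose (a := k o iX (n + 1)%Z); pose (b := k o i (n + 1)%Z).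
    assert (Eb : b o dif V n == 0).
    { unfold b; rewrite <- comp_assoc, (cm_dif i n), comp_assoc, Hk; apply comp_0l. }
    assert (Ea : a o dif X (n + 1)%Z == b o v (n + 1)%Z).
    { assert (E : k o (dif W n o iX n) == 0) by (rewrite comp_assoc, Hk; apply comp_0l).
      rewrite HD in E; expand_in E; unfold a, b.
      apply (hadd_inj (h := - (k o iX (n + 1)%Z o dif X (n + 1)%Z))).
      rewrite hadd_opp, <- E; abel. }
    (* In components, the extension sought is a pair: [g] on the summand from [X] and [e] on [V]. *)
    assert (H : exists (g : hom (X (n + 1 + 1 + 1)%Z) I) (e : hom (V (n + 1 + 1)%Z) I),
      - (g o dif X (n + 1 + 1)%Z) + e o v (n + 1 + 1)%Z == a /\
      e o dif V (n + 1)%Z == b).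
    { destruct (Z_lt_le_dec (n + 1) n0) as [Hn | Hn].
      - destruct (HX n ltac:(lia) I (- a)) as [g Hg].
        { assert (Z : is_zero (V (n + 1)%Z)) by (apply VZ; lia).
          rewrite comp_opp_l, Ea, (zero_from b Z), comp_0l; apply hopp_0. }
        exists g, 0; rewrite Hg; split; [expand; abel |].
        apply zero_from_eq, VZ; lia.
      - destruct (Hdl (n + 1)%Z) as (_ & _ & U & _).
        destruct (U Hn I a b) as (e & E1 & E2); [| exact Ea |].
        + apply (proj2 (proj2 (proj2 (Hdl n)))), Eb.
        + exists 0, e; split; [| exact E1].
          etransitivity; [| exact E2]; expand; apply hadd_0l. }
    destruct H as (g & e & E1 & E2).
    exists (g o p (n + 1 + 1)%Z + e o pY (n + 1 + 1)%Z).
    apply (bip_ext_from (HC (n + 1)%Z)).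
    + rewrite <- comp_assoc, HD; expand.
      repeat crw (bip_XX (HC (n + 1 + 1)%Z)); repeat crw (bip_XY (HC (n + 1 + 1)%Z)).
      repeat crw (bip_YX (HC (n + 1 + 1)%Z)); repeat crw (bip_YY (HC (n + 1 + 1)%Z)).
      expand; fold a; rewrite <- E1; abel.
    + rewrite <- comp_assoc, <- (cm_dif i (n + 1)%Z); expand.
      repeat crw (bip_YX (HC (n + 1 + 1)%Z)); repeat crw (bip_YY (HC (n + 1 + 1)%Z)).
      expand; fold b; rewrite <- E2; abel.
Qed.
End Injective.

Section Projective.
Hypothesis weak_ker : forall (X Y : C) (f : hom X Y), exists (W : C) (c : hom W X),
  f o c == 0 /\ forall (P : C) (k : hom P X), f o k == 0 -> exists k', c o k' == k.

Lemma weak_pullback (T X0 X1 V' : C) (t : hom V' T) (v' : hom V' X1) (d : hom X0 X1) :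
  exists (V : C) (dl : hom V V') (v : hom V X0),
    t o dl == 0 /\ v' o dl == d o v /\
    forall (P : C) (a : hom P X0) (b : hom P V'), t o b == 0 -> v' o b == d o a ->
      exists k : hom P V, dl o k == b /\ v o k == a.
Proof.
  destruct (C_bip T X1) as (E & iS & iX & pS & pX & H).
  destruct (C_bip V' X0) as (E' & jV & jX & qV & qX & H').
  destruct (weak_ker (iS o t o qV + iX o v' o qV + - (iX o d o qX))) as (W & c & c0 & cW).
  exists W, (qV o c), (qX o c).
  destruct H as [H1 H2 H3 H4 H5], H' as [K1 K2 K3 K4 K5]; split; [| split].
  - assert (E0 : pS o ((iS o t o qV + iX o v' o qV + - (iX o d o qX)) o c) == 0)
      by (rewrite c0; apply comp_0r).
    expand_in E0; expand; rewrite <- E0; rewrite H1, H4; expand; abel.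
  - assert (E0 : pX o ((iS o t o qV + iX o v' o qV + - (iX o d o qX)) o c) == 0)
      by (rewrite c0; apply comp_0r).
    expand_in E0; expand; apply (hadd_inj (h := - (d o qX o c))); rewrite hadd_opp, <- E0.
    rewrite H2, H3; expand; abel.
  - intros P a b Hb Ha; destruct (cW P (jV o b + jX o a)) as [k Hk].
    + expand; repeat crw K1; repeat crw K2; repeat crw K3; repeat crw K4; expand.
      rewrite <- (comp_assoc iS), Hb, <- !(comp_assoc iX), Ha; expand; abel.
    + exists k; split; rewrite <- comp_assoc, Hk; expand;
        rewrite ?K1, ?K2, ?K3, ?K4; expand; abel.
Qed.

Record down_state (X : complex) (n : Z) := {
  lV : C; lv : hom lV (X n); lT : C; lt : hom lV lT
}.

(** Dual to [up_link]: [lt s] and [dl] annihilate the same morphisms into V^n, which identifies [dl]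
    with the outgoing differential recorded in the stage. *)
Definition down_link (X : complex) (n0 n : Z) (s : down_state X n)
    (s' : down_state X (n + 1)) : Prop :=
  exists dl : hom (lV s) (lV s'),
    lt s' o dl == 0 /\ lv s' o dl == dif X n o lv s /\
    ((n < n0)%Z -> forall (P : C) (a : hom P (X n)) (b : hom P (lV s')),
      lt s' o b == 0 -> lv s' o b == dif X n o a ->
      exists k : hom P (lV s), dl o k == b /\ lv s o k == a) /\
    forall (P : C) (b : hom P (lV s)), lt s o b == 0 <-> dl o b == 0.

Lemma projective_resolution (X : complex) n0 :
  (forall n, (n0 <= n + 1)%Z -> proj_exact (dif X n) (dif X (n + 1)%Z)) ->
  exists (V : complex) (v : chain_map V X),
    (forall n, (n0 <= n)%Z -> is_zero (V n)) /\
    forall (W : complex) (i : chain_map X W) (p : chain_map W (cshift_ob V)),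
      is_cone v i p -> forall n, proj_exact (dif W n) (dif W (n + 1)%Z).
Proof.
  intro HX.
  destruct (@Z_recursion_down (down_state X) (fun _ _ => True) (@down_link X n0) n0
    (fun n => {| lV := O; lv := 0; lT := O; lt := 0 |})) as (s & Hz & Hs).
  - auto.
  - intros n Hn; exists 0; simpl.
    split; [apply comp_0r |]; split; [rewrite !comp_0r; reflexivity |].
    split; [lia |]; intros I b; rewrite !comp_0l; split; reflexivity.
  - intros n s' Hn _.
    destruct (weak_pullback (lt s') (lv s') (dif X n)) as (V & dl & v & E1 & E2 & E3).
    exists {| lV := V; lv := v; lT := lV s'; lt := dl |}; split; [exact Logic.I |].
    exists dl; simpl; split; [exact E1 |]; split; [exact E2 |].
    split; [intros _; exact E3 |]; intros; reflexivity.
  - pose (dl n := proj1_sig (constructive_indefinite_description _ (Hs n))).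
    assert (Hdl : forall n, lt (s (n + 1)%Z) o dl n == 0 /\
        lv (s (n + 1)%Z) o dl n == dif X n o lv (s n) /\
        ((n < n0)%Z -> forall (P : C) (a : hom P (X n)) (b : hom P (lV (s (n + 1)%Z))),
          lt (s (n + 1)%Z) o b == 0 -> lv (s (n + 1)%Z) o b == dif X n o a ->
          exists k : hom P (lV (s n)), dl n o k == b /\ lv (s n) o k == a) /\
        forall (P : C) (b : hom P (lV (s n))), lt (s n) o b == 0 <-> dl n o b == 0)
      by (intro n; exact (proj2_sig (constructive_indefinite_description _ (Hs n)))).
    clearbody dl; clear Hs.
    assert (DD : forall n, dl (n + 1)%Z o dl n == 0).
    { intro n; apply (proj2 (proj2 (proj2 (Hdl (n + 1)%Z)))), (Hdl n). }
    pose (V := @Complex C (fun n => lV (s n)) dl DD).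
    assert (Ev : forall n, lv (s (n + 1)%Z) o dif V n == dif X n o lv (s n)).
    { intro n; apply (Hdl n). }
    pose (v := @ChainMap C V X (fun n => lv (s n)) Ev).
    exists V, v.
    assert (VZ : forall n, (n0 <= n)%Z -> is_zero (V n)).
    { intros n Hn; simpl; rewrite (Hz n Hn); exact HO. }
    split; [exact VZ |].
    intros W i p (iX & pY & HC & HD) n P k Hk.
    pose (b := p (n + 1)%Z o k); pose (a := pY (n + 1)%Z o k).
    assert (Eb : dif V (n + 1 + 1)%Z o b == 0).
    { assert (E : p (n + 1 + 1)%Z o (dif W (n + 1)%Z o k) == 0) by (rewrite Hk; apply comp_0r).
      rewrite comp_assoc, (cone_p p (n + 1)%Z) in E; expand_in E.
      rewrite <- (hopp_opp (_ o b)); unfold b; rewrite comp_assoc, E; apply hopp_0. }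
    assert (Ea : v (n + 1 + 1)%Z o b + dif X (n + 1)%Z o a == 0).
    { unfold a, b; rewrite !comp_assoc, <- comp_hadd_l, <- (cone_pY HC HD).
      rewrite <- comp_assoc, Hk; apply comp_0r. }
    assert (H : exists (g : hom P (V (n + 1)%Z)) (e : hom P (X n)),
      - (dif V (n + 1)%Z o g) == b /\ v (n + 1)%Z o g + dif X n o e == a).
    { destruct (Z_lt_le_dec (n + 1) n0) as [Hn | Hn].
      - destruct (Hdl (n + 1)%Z) as (_ & _ & U & _).
        (* The component [b] enters with a sign because the differential of the cone restricts to
           minus that of [V]. *)
        destruct (U Hn P a (- b)) as (g & E1 & E2).
        + etransitivity; [apply comp_opp_r |]; etransitivity; [| apply hopp_0].
          apply hopp_Proper, (proj2 (proj2 (proj2 (Hdl (n + 1 + 1)%Z)))), Eb.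
        + etransitivity; [apply comp_opp_r |]; symmetry; apply hopp_unique.
          rewrite hadd_comm; exact Ea.
        + exists g, 0; split.
          * rewrite <- (hopp_opp b); apply hopp_Proper, E1.
          * etransitivity; [| exact E2]; expand; apply hadd_0.
      - assert (Z : is_zero (V (n + 1 + 1)%Z)) by (apply VZ; lia).
        destruct (HX n Hn P a) as [e He].
        { rewrite <- Ea, (zero_to b Z); expand; abel. }
        exists 0, e; split; [apply zero_to_eq, Z |].
        rewrite He; expand; abel. }
    destruct H as (g & e & E1 & E2).
    exists (iX n o g + i n o e).
    apply (bip_ext_to (HC (n + 1)%Z)).
    + rewrite comp_assoc, (cone_p p n); expand.
      repeat crw (bip_XX (HC n)); repeat crw (bip_YX (HC n)); expand; fold b; rewrite <- E1.
      expand; abel.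
    + rewrite comp_assoc, (cone_pY HC HD); expand.
      repeat crw (bip_XX (HC n)); repeat crw (bip_XY (HC n)).
      repeat crw (bip_YX (HC n)); repeat crw (bip_YY (HC n)).
      expand; fold a; rewrite <- E2; abel.
Qed.
End Projective.
End Resolutions.

Lemma zero_is_zero (C : preadditive) (X Y : C) (f : hom X Y) :
  f == 0 -> epi f -> is_zero Y.
Proof.
  intros E H; apply zero_id, H; rewrite E, comp_0l, comp_id_l; reflexivity.
Qed.

(** * Abelian categories *)

Section Abelian.
Variable A : preadditive.
Hypothesis HA : abelian A.

Lemma kernel_mono (K X Y : A) (g : hom X Y) (k : hom K X) : is_kernel g k -> mono k.
Proof.
  intros [H1 H2] W u v E; destruct (H2 W (k o v)) as (w & _ & Hw).
  { rewrite comp_assoc, H1; apply comp_0l. }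
  rewrite (Hw u E), (Hw v); reflexivity.
Qed.
Lemma cokernel_epi (X Y Q : A) (f : hom X Y) (c : hom Y Q) : is_cokernel f c -> epi c.
Proof.
  intros [H1 H2] W u v E; destruct (H2 W (v o c)) as (w & _ & Hw).
  { rewrite <- comp_assoc, H1; apply comp_0r. }
  rewrite (Hw u E), (Hw v); reflexivity.
Qed.

Lemma epi_of_cancel (X Y : A) (e : hom X Y) :
  (forall (W : A) (t : hom Y W), t o e == 0 -> t == 0) -> epi e.
Proof.
  intros H W u v E; apply (hadd_inj (h := - v)); rewrite hadd_opp; apply H.
  rewrite comp_hadd_l, comp_opp_l, E; apply hadd_opp.
Qed.
Lemma mono_cancel (X Y W : A) (m : hom X Y) (t : hom W X) : mono m -> m o t == 0 -> t == 0.
Proof. intros H E; apply H; rewrite E, comp_0r; reflexivity. Qed.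

(** [I] is the kernel of the cokernel of [g]. If [t] kills [e], then [g] factors through [m o l]
    with [l] the kernel of [t]. This mono is the kernel of some [s], which kills [g] and hence [m];
    so [l] has a right inverse and [t] is zero. *)
Lemma image_factorization (X Y : A) (g : hom X Y) :
  exists (I : A) (e : hom X I) (m : hom I Y), epi e /\ mono m /\ m o e == g.
Proof.
  destruct (ab_cokernel HA g) as (Q & q & Hq), (ab_kernel HA q) as (I & m & Hm).
  destruct Hq as [Q1 Q2]; pose proof (kernel_mono Hm) as Mm.
  destruct (proj2 Hm _ g Q1) as (e & Ee & _).
  exists I, e, m; split; [| split; [exact Mm | exact Ee]].
  apply epi_of_cancel; intros W t Ht.
  destruct (ab_kernel HA t) as (L & l & Hl).
  destruct (proj2 Hl _ e Ht) as (e' & Ee' & _).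
  assert (Mml : mono (m o l)).
  { intros V u v E; apply (kernel_mono Hl), Mm; rewrite !comp_assoc; exact E. }
  destruct (ab_mono HA Mml) as (S & s & Hs).
  assert (Es : s o g == 0).
  { rewrite <- Ee, <- Ee', (comp_assoc m), comp_assoc, (proj1 Hs); apply comp_0l. }
  destruct (Q2 _ s Es) as (s' & Es' & _).
  destruct (proj2 Hs _ m) as (r & Er & _).
  { rewrite <- Es', <- comp_assoc, (proj1 Hm); apply comp_0r. }
  assert (El : l o r == idm I).
  { apply Mm; rewrite comp_assoc, Er, comp_id_r; reflexivity. }
  rewrite <- (comp_id_r t), <- El, comp_assoc, (proj1 Hl); apply comp_0l.
Qed.

Section Homology.
Variables (X Y V : A) (f : hom X Y) (g : hom Y V).

(** As the homology is zero, [phi] kills the kernel of [g], so it factors through the epi part of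
    [g]; injectivity of [I] extends it along the mono part. *)
Lemma vanishing_extends (I : A) (phi : hom Y I) :
  injective I -> homology_vanishes f g -> phi o f == 0 -> exists psi, psi o g == phi.
Proof.
  intros HI (H & (K & k & f' & c & Hk & Ef & Hc) & HZ) Hphi.
  assert (E : phi o k == 0).
  { destruct (proj2 Hc _ (phi o k)) as (u & Eu & _).
    { rewrite <- comp_assoc, Ef; exact Hphi. }
    rewrite <- Eu, (zero_from u HZ); apply comp_0l. }
  destruct (image_factorization g) as (J & e & m & He & Hm & Eg).
  destruct (ab_epi HA He) as (W & w & Hw).
  assert (E' : phi o w == 0).
  { destruct (proj2 Hk _ w) as (w' & Ew & _).
    { rewrite <- Eg, <- comp_assoc, (proj1 Hw); apply comp_0r. }
    rewrite <- Ew, comp_assoc, E; apply comp_0l. }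
  destruct (proj2 Hw _ phi E') as (phi' & Ephi & _).
  destruct (HI _ _ m phi' Hm) as [psi Epsi].
  exists psi; rewrite <- Eg, comp_assoc, Epsi; exact Ephi.
Qed.

Lemma vanishing_lifts (P : A) (phi : hom P Y) :
  projective P -> homology_vanishes f g -> g o phi == 0 -> exists psi, f o psi == phi.
Proof.
  intros HP (H & (K & k & f' & c & Hk & Ef & Hc) & HZ) Hphi.
  destruct (proj2 Hk _ phi Hphi) as (phi' & Ephi & _).
  assert (He : epi f').
  { apply epi_of_cancel; intros W t Ht; destruct (proj2 Hc _ t Ht) as (u & Eu & _).
    rewrite <- Eu, (zero_from u HZ); apply comp_0l. }
  destruct (HP _ _ f' phi' He) as [psi Epsi].
  exists psi; rewrite <- Ef, <- comp_assoc, Epsi; exact Ephi.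
Qed.

Hypothesis gf : g o f == 0.

Lemma homology_exists : exists (K H : A) (k : hom K Y) (f' : hom X K) (c : hom K H),
  is_kernel g k /\ k o f' == f /\ is_cokernel f' c.
Proof.
  destruct (ab_kernel HA g) as (K & k & Hk).
  destruct (proj2 Hk _ f gf) as (f' & Ef & _).
  destruct (ab_cokernel HA f') as (H & c & Hc).
  exists K, H, k, f', c; auto.
Qed.

(** Embed the homology in an injective [J] and extend the resulting map from the kernel of [g] to
    [chi] on [Y]. It kills [f], so it factors through [g] and vanishes on the kernel; hence the
    homology is zero. *)
Lemma vanishing_of_extends : enough_injectives A ->
  (forall (I : A) (phi : hom Y I), injective I -> phi o f == 0 ->
     exists psi, psi o g == phi) ->
  homology_vanishes f g.
Proof.
  intros EI HE; destruct homology_exists as (K & H & k & f' & c & Hk & Ef & Hc).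
  exists H; split; [exists K, k, f', c; auto |].
  apply (zero_is_zero (f := c)); [| exact (cokernel_epi Hc)].
  destruct (EI H) as (J & m & HJ & Hm).
  destruct (HJ _ _ k (m o c) (kernel_mono Hk)) as [chi Echi].
  destruct (HE J chi HJ) as [psi Epsi].
  { rewrite <- Ef, comp_assoc, Echi, <- comp_assoc, (proj1 Hc); apply comp_0r. }
  apply (mono_cancel Hm).
  rewrite <- Echi, <- Epsi, <- comp_assoc, (proj1 Hk); apply comp_0r.
Qed.

Lemma vanishing_of_lifts : enough_projectives A ->
  (forall (P : A) (phi : hom P Y), projective P -> g o phi == 0 ->
     exists psi, f o psi == phi) ->
  homology_vanishes f g.
Proof.
  intros EP HE; destruct homology_exists as (K & H & k & f' & c & Hk & Ef & Hc).
  exists H; split; [exists K, k, f', c; auto |].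
  apply (zero_is_zero (f := c)); [| exact (cokernel_epi Hc)].
  destruct (EP K) as (P & e & HP & He).
  destruct (HE P (k o e) HP) as [psi Epsi].
  { rewrite comp_assoc, (proj1 Hk); apply comp_0l. }
  assert (E : f' o psi == e).
  { apply (kernel_mono Hk); rewrite comp_assoc, Ef; exact Epsi. }
  apply He; rewrite <- E, comp_assoc, (proj1 Hc), !comp_0l; reflexivity.
Qed.
End Homology.
End Abelian.

(** * Complexes of injective objects *)

Section Injectives.
Variable A : preadditive.
Hypotheses (HA : abelian A) (EI : enough_injectives A).
Notation Inj := (@injective A).
Notation C := (full_sub Inj).

Lemma inj_zero : exists Z : C, is_zero Z.
Proof.
  destruct (ab_zero HA) as [Z HZ].
  assert (HI : injective Z).
  { intros X Y m f _; exists 0; apply zero_to_eq, HZ. }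
  exists (exist _ Z HI); apply zero_full_sub; exact HZ.
Qed.

Lemma inj_bip : has_biproducts C.
Proof.
  intros X Y; destruct X as [X' HX]; destruct Y as [Y' HY].
  destruct (ab_biproduct HA X' Y') as (S & iX & iY & pX & pY & H).
  assert (HI : injective S).
  { intros V W m f Hm.
    destruct (HX _ _ m (pX o f) Hm) as [a Ea], (HY _ _ m (pY o f) Hm) as [b Eb].
    exists (iX o a + iY o b).
    rewrite comp_hadd_l, <- !comp_assoc, Ea, Eb, !comp_assoc, <- comp_hadd_l, (bip_id H).
    apply comp_id_l. }
  exists (exist _ S HI), iX, iY, pX, pY.
  destruct H as [H1 H2 H3 H4 H5]; split; assumption.
Qed.

(** The cokernel in [A] need not be injective; embedding it in an injective object preserves the
    existence of factorizations into injectives. *)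
Lemma inj_weak_coker (X Y : C) (f : hom X Y) : exists (W : C) (c : hom Y W),
  c o f == 0 /\ forall (I : C) (k : hom Y I), k o f == 0 -> exists k', k' o c == k.
Proof.
  revert f; destruct X as [X' HX]; destruct Y as [Y' HY]; cbn; intro f.
  destruct (ab_cokernel HA f) as (Q & q & Hq), (EI Q) as (J & m & HJ & Hm).
  exists (exist _ J HJ), (m o q); split.
  - cbn; rewrite <- comp_assoc, (proj1 Hq); apply comp_0r.
  - intros [I HI] k Hk; cbn in k, Hk.
    destruct (proj2 Hq _ k Hk) as (k1 & E1 & _), (HI _ _ m k1 Hm) as [k2 E2].
    exists k2; cbn; rewrite comp_assoc, E2; exact E1.
Qed.

Lemma inj_exactness : exactness (B := Inj) (@inj_exact C).
Proof.
  split.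
  - intros X n; split.
    + intros H [I HI] k Hk; exact (vanishing_extends HA HI H Hk).
    + intro H; apply (vanishing_of_extends HA (dif_dif (underlying X) n) EI).
      intros I phi HI Hphi; exact (H (exist _ I HI) phi Hphi).
  - intros X Y V f g; apply inj_exact_zero.
  - intros X Y V X' Y' V' f g f' g' a b c Ha Hb Hc E1 E2.
    exact (inj_exact_iso Hb Hc E1 E2).
  - intros X Y W u i p n (iX & pY & HC & HD); exact (inj_exact_cone HC HD (n := n)).
Qed.

Lemma inj_orth (X : sub_tricat (Kac Inj)) (Y : sub_tricat (Kpb Inj))
  (f : hom (Iac Inj X) (Ipb Inj Y)) : f == 0.
Proof.
  revert f; destruct X as [X' HX]; destruct Y as [Y' [HY HY']]; intro f.
  destruct (proj1 (bounded_below_iff _) HY) as [m Hm].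
  refine (inj_null_homotopic (f : chain_map X' Y') (m := m) _ Hm).
  intro n; apply (ex_spec inj_exactness), HX.
Qed.

Lemma inj_decomposition (X : complex C) : bounded_homology X ->
  exists (V W : complex C) (v : chain_map X V) (i : chain_map V W)
    (p : chain_map W (cshift_ob X)), Kpb Inj V /\ is_cone v i p /\ acyclic W.
Proof.
  intros [m HX]; destruct inj_zero as [O HO].
  assert (EX : forall n, (m < Z.abs (n + 1))%Z -> inj_exact (dif X n) (dif X (n + 1)%Z))
    by (intros n Hn; apply (ex_spec inj_exactness), HX, Hn).
  (* Exactness is needed in the degrees [n + 2] with [n < n0]; this bound places them below [-|m|],
     outside the range of homology. *)
  destruct (injective_resolution HO inj_bip inj_weak_coker (X := X) (n0 := - Z.abs m - 2))
    as (V & v & VZ & HV).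
  { intros n Hn; apply EX; lia. }
  destruct (cone_exists inj_bip v) as (W & i & p & HC).
  exists V, W, v, i, p; split; [| split; [exact HC |]].
  - split.
    + apply bounded_below_iff; exists (- Z.abs m - 2)%Z; intros n Hn; apply VZ; lia.
    + exists m; intros n Hn; apply (ex_spec inj_exactness).
      (* The homology bound of [X] passes to [V] because the cone is acyclic. *)
      pose proof (HV W i p HC n) as HW; destruct HC as (iX & pY & HC & HD).
      exact (inj_exact_target HC HD (EX n Hn) HW).
  - intro n; apply (ex_spec inj_exactness), (HV W i p HC).
Qed.
End Injectives.

(** * Complexes of projective objects *)

Section Projectives.
Variable A : preadditive.
Hypotheses (HA : abelian A) (EP : enough_projectives A).
Notation Proj := (@projective A).
Notation C := (full_sub Proj).

Lemma proj_zero : exists Z : C, is_zero Z.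
Proof.
  destruct (ab_zero HA) as [Z HZ].
  assert (HI : projective Z).
  { intros X Y m f _; exists 0; apply zero_from_eq, HZ. }
  exists (exist _ Z HI); apply zero_full_sub; exact HZ.
Qed.

Lemma proj_bip : has_biproducts C.
Proof.
  intros X Y; destruct X as [X' HX]; destruct Y as [Y' HY].
  destruct (ab_biproduct HA X' Y') as (S & iX & iY & pX & pY & H).
  assert (HI : projective S).
  { intros V W e f He.
    destruct (HX _ _ e (f o iX) He) as [a Ea], (HY _ _ e (f o iY) He) as [b Eb].
    exists (a o pX + b o pY).
    rewrite comp_hadd_r, !comp_assoc, Ea, Eb, <- !comp_assoc, <- comp_hadd_r, (bip_id H).
    apply comp_id_r. }
  exists (exist _ S HI), iX, iY, pX, pY.
  destruct H as [H1 H2 H3 H4 H5]; split; assumption.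
Qed.

Lemma proj_weak_ker (X Y : C) (f : hom X Y) : exists (W : C) (c : hom W X),
  f o c == 0 /\ forall (P : C) (k : hom P X), f o k == 0 -> exists k', c o k' == k.
Proof.
  revert f; destruct X as [X' HX]; destruct Y as [Y' HY]; cbn; intro f.
  destruct (ab_kernel HA f) as (L & l & Hl), (EP L) as (J & e & HJ & He).
  exists (exist _ J HJ), (l o e); split.
  - cbn; rewrite comp_assoc, (proj1 Hl); apply comp_0l.
  - intros [P HP] k Hk; cbn in k, Hk.
    destruct (proj2 Hl _ k Hk) as (k1 & E1 & _), (HP _ _ e k1 He) as [k2 E2].
    exists k2; cbn; rewrite <- comp_assoc, E2; exact E1.
Qed.

Lemma proj_exactness : exactness (B := Proj) (@proj_exact C).
Proof.
  split.
  - intros X n; split.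
    + intros H [P HP] k Hk; exact (vanishing_lifts HP H Hk).
    + intro H; apply (vanishing_of_lifts HA (dif_dif (underlying X) n) EP).
      intros P phi HP Hphi; exact (H (exist _ P HP) phi Hphi).
  - intros X Y V f g; apply proj_exact_zero.
  - intros X Y V X' Y' V' f g f' g' a b c Ha Hb Hc E1 E2.
    exact (proj_exact_iso Hb Hc E1 E2).
  - intros X Y W u i p n (iX & pY & HC & HD); exact (proj_exact_cone HC HD (n := n)).
Qed.

Lemma proj_orth (X : sub_tricat (Kmb Proj)) (Y : sub_tricat (Kac Proj))
  (f : hom (Imb Proj X) (Iac Proj Y)) : f == 0.
Proof.
  revert f; destruct X as [X' [HX HX']]; destruct Y as [Y' HY]; intro f.
  destruct (proj1 (bounded_above_iff _) HX) as [m Hm].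
  refine (proj_null_homotopic (f : chain_map X' Y') (m := m) _ Hm).
  intro n; apply (ex_spec proj_exactness), HY.
Qed.

Lemma proj_decomposition (X : complex C) : bounded_homology X ->
  exists (V W : complex C) (v : chain_map V X) (i : chain_map X W)
    (p : chain_map W (cshift_ob V)), Kmb Proj V /\ is_cone v i p /\ acyclic W.
Proof.
  intros [m HX]; destruct proj_zero as [O HO].
  assert (EX : forall n, (m < Z.abs (n + 1))%Z -> proj_exact (dif X n) (dif X (n + 1)%Z))
    by (intros n Hn; apply (ex_spec proj_exactness), HX, Hn).
  (* Exactness is needed in the degrees [n + 1] from [n0] on, which lie above [|m|], outside the
     range of homology. *)
  destruct (projective_resolution HO proj_bip proj_weak_ker (X := X) (n0 := Z.abs m + 2))
    as (V & v & VZ & HV).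
  { intros n Hn; apply EX; lia. }
  destruct (cone_exists proj_bip v) as (W & i & p & HC).
  exists V, W, v, i, p; split; [| split; [exact HC |]].
  - split.
    + apply bounded_above_iff; exists (Z.abs m + 2)%Z; intros n Hn; apply VZ; lia.
    (* The index is shifted by one because [proj_exact_source] speaks of the source of a cone one
       degree higher than of the cone itself. *)
    + exists m; refine (@forall_shift (fun n => (m < Z.abs (n + 1))%Z ->
        H_vanishes (underlying V) n) _).
      intros n Hn; apply (ex_spec proj_exactness).
      pose proof (HV W i p HC n) as HW; destruct HC as (iX & pY & HC & HD).
      exact (proj_exact_source HC HD (EX (n + 1)%Z Hn) HW).
  - intro n; apply (ex_spec proj_exactness), (HV W i p HC).
Qed.
End Projectives.

(** Regarding the outer categories as full subcategories presupposes that the canonical functors are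
    fully faithful; this is proved as part of each statement, and membership is expressed by
    essential images. *)
Theorem theorem2p4 :
  (forall A : preadditive, abelian A -> enough_injectives A ->
    let Inj := @injective A in
    (fully_faithful (emb_ac Inj) /\ fully_faithful (emb_pb Inj) /\
     fully_faithful (emb_mb Inj)) /\
    (stable_t_structure (ess_image (emb_ac Inj)) (ess_image (emb_pb Inj)) /\
     stable_t_structure (ess_image (emb_pb Inj)) (ess_image (emb_mb Inj))) /\
    (exists r : recollement (emb_pb Inj) (quot_pb Inj),
      (forall X, ess_image (rec_j_lower_shriek r) X <-> ess_image (emb_ac Inj) X) /\
      (forall X, ess_image (rec_j_lower_star r) X <-> ess_image (emb_mb Inj) X)))
  /\
  (forall A' : preadditive, abelian A' -> enough_projectives A' ->
    let Proj := @projective A' in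
    (fully_faithful (emb_ac Proj) /\ fully_faithful (emb_pb Proj) /\
     fully_faithful (emb_mb Proj)) /\
    (stable_t_structure (ess_image (emb_pb Proj)) (ess_image (emb_mb Proj)) /\
     stable_t_structure (ess_image (emb_mb Proj)) (ess_image (emb_ac Proj))) /\
    (exists r : recollement (emb_mb Proj) (quot_mb Proj),
      (forall X, ess_image (rec_j_lower_shriek r) X <-> ess_image (emb_pb Proj) X) /\
      (forall X, ess_image (rec_j_lower_star r) X <-> ess_image (emb_ac Proj) X))).
Proof.
  split.
  - intros A HA EI Inj; destruct (inj_zero HA) as [O HO].
    pose proof (inj_exactness HA EI) as EX.
    pose proof (inj_orth HA EI) as H1; pose proof (inj_decomposition HA EI) as H2.
    split; [exact (injective_ff HO (inj_bip HA) EX H1 H2) |].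
    split; [split |].
    + exact (ac_pb_stable HO (inj_bip HA) EX H1 H2).
    + exact (pb_mb_stable HO (inj_bip HA) EX).
    + exact (injective_recollement HO (inj_bip HA) EX H1 H2).
  - intros A HA EP Proj; destruct (proj_zero HA) as [O HO].
    pose proof (proj_exactness HA EP) as EX.
    pose proof (proj_orth HA EP) as H1; pose proof (proj_decomposition HA EP) as H2.
    split; [exact (projective_ff HO (proj_bip HA) EX H1 H2) |].
    split; [split |].
    + exact (pb_mb_stable HO (proj_bip HA) EX).
    + exact (mb_ac_stable HO (proj_bip HA) EX H1 H2).
    + exact (projective_recollement HO (proj_bip HA) EX H1 H2).
Qed.
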